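(* Fix $T>0$. Then, under the Robin boundary condition (R), there exist constants $C_1,C_2\in(0,\infty)$ such that $$C_1\,M\le\mathrm{Var}\big(w(t,x)\mid w(t_1,x_1),\dots,w(t_m,x_m)\big)\le C_2\,M,\qquad M:=\min\Big\{\min_{1\le j\le m}\rho^2((t,x),(t_j,x_j)),\ \sqrt t\Big\},$$ for all $m\in\{1,2,\dots\}$ and all $(t,x),(t_1,x_1),\dots,(t_m,x_m)\in[0,T]\times[0,L]$ (the constants $C_1,C_2$ do not depend on $m$ nor on these points).
   Context: Fix $L>0$ and let $\xi$ be a space-time white noise on $[0,\infty)\times[0,L]$. The Robin boundary condition (R) is $\partial_xw+\alpha w=0$ at $x=0$ and $\partial_xw+\beta w=0$ at $x=L$, where $\alpha,\beta\in\mathbb{R}$ are constants. Let $\{(\lambda_n,f_n)\}_{n\ge1}$ be the eigenpairs of $-\frac12\partial_x^2$ on $(0,L)$ with condition (R) ($\lambda_1\le\lambda_2\le\cdots$, $\{f_n\}$ orthonormal in $L^2([0,L])$), and $G_t(x,y)=\sum_{n\ge1}e^{-\lambda_nt}f_n(x)f_n(y)$ the heat kernel. The centered Gaussian random field $w$ is the mild solution of $\partial_tw=\frac12\partial_x^2w+\xi$, $w(0,\cdot)=0$, i.e. $w(t,x)=\int_{(0,t)\times[0,L]}G_{t-s}(x,y)\,\xi(ds\,dy)$ for $t>0$ and $w(0,x)=0$. The parabolic metric is $\rho((t,x),(s,y))=\max\{|t-s|^{1/4},|x-y|^{1/2}\}$. *)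

(* Defs.v *)
From HB Require Import structures.
From mathcomp Require Export all_boot all_order all_algebra.
From mathcomp Require Export all_classical all_reals all_analysis.
Export Order.TTheory GRing.Theory Num.Theory.
Export numFieldNormedType.Exports.

Set Implicit Arguments.
Unset Strict Implicit.
Unset Printing Implicit Defensive.

Global Open Scope classical_set_scope.
Global Open Scope ring_scope.

Definition generated_sigma (d : measure_display) (Omega : measurableType d)
    (R : realType) (I : Type) (Y : I -> Omega -> R) : set (set Omega) :=
  <<s \bigcup_j preimage_set_system setT (Y j) measurable >>.

Definition is_cond_exp (d : measure_display) (Omega : measurableType d)
    (R : realType) (P : probability Omega R) (G : set (set Omega))
    (X Z : Omega -> R) : Prop :=
  [/\ forall B : set R, measurable B -> G (Z @^-1` B),
      P.-integrable setT (EFin \o Z) &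
      forall A, G A ->
        (\int[P]_(o in A) (Z o)%:E = \int[P]_(o in A) (X o)%:E)%E].

(* A chosen version of E[X | G]; versions agree almost surely.  It is the junk
   value 0 when no version exists, e.g. when X is not integrable. *)
Definition cond_exp (d : measure_display) (Omega : measurableType d)
    (R : realType) (P : probability Omega R) (G : set (set Omega))
    (X : Omega -> R) : Omega -> R :=
  xget (fun=> 0) [set Z | is_cond_exp P G X Z].

Definition cond_var (d : measure_display) (Omega : measurableType d)
    (R : realType) (P : probability Omega R) (G : set (set Omega))
    (X : Omega -> R) : Omega -> R :=
  cond_exp P G (fun o => (X o - cond_exp P G X o) ^+ 2).

(* [normal_prob m 0] is not the Dirac mass at [m] in the library, hence the
   case distinction. *)
Definition gaussian_law (R : realType) (m s : R) (B : set R) : \bar R :=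
  if s == 0 then \d_m B else normal_prob m s B.

Definition spacetime (R : realType) (L : R) : set (R * R) :=
  `[0, +oo[ `*` `[0, L].

Notation leb2 := (lebesgue_measure \x lebesgue_measure)%E.

Definition finite_cell (R : realType) (L : R) (A : set (R * R)) : Prop :=
  [/\ measurable A, A `<=` spacetime L & (leb2 A < +oo)%E].

(* The values of [xi] outside the sets satisfying [finite_cell L] are
   irrelevant. *)
Definition white_noise (d : measure_display) (Omega : measurableType d)
    (R : realType) (P : probability Omega R) (L : R)
    (xi : set (R * R) -> {RV P >-> R}) : Prop :=
  (forall (n : nat) (c : 'I_n -> R) (A : 'I_n -> set (R * R)),
      (forall i, finite_cell L (A i)) ->
      exists s : R, forall B : set R, measurable B ->
        P ((fun o => \sum_i c i * xi (A i) o) @^-1` B) = gaussian_law 0 s B)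
  /\ (forall A B, finite_cell L A -> finite_cell L B ->
        ('E_P[fun o => (xi A o * xi B o)%R])%E = leb2 (A `&` B)).

(* [X] is (almost surely) the integral of the deterministic function [h]
   against [xi]: the limit in L^2(P) of the integrals of step functions
   converging to [h] in L^2([0, +oo[ * [0, L]). *)
Definition is_wiener_integral (d : measure_display) (Omega : measurableType d)
    (R : realType) (P : probability Omega R) (L : R)
    (xi : set (R * R) -> {RV P >-> R}) (h : R * R -> R) (X : Omega -> R)
    : Prop :=
  measurable_fun (spacetime L) h /\
  exists (k : nat -> nat) (c : nat -> nat -> R) (A : nat -> nat -> set (R * R)),
    [/\ forall n i, finite_cell L (A n i),
        (fun n => (\int[leb2]_(p in spacetime L)
           ((h p - \sum_(i < k n) c n i * \1_(A n i) p) ^+ 2)%R%:E)%E)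
          @ \oo --> 0%E &
        (fun n => 'E_P[fun o =>
             ((X o - \sum_(i < k n) c n i * xi (A n i) o) ^+ 2)%R])%E
          @ \oo --> 0%E].

(* The derivatives at 0 and L are one-sided: they are the limits of f' from
   inside the interval, so values of [f] off [0, L] play no role. *)
Definition robin_eigenpair (R : realType) (L alpha beta : R)
    (mu : R) (f : R -> R) : Prop :=
  [/\ derivable_oo_LRcontinuous f 0 L /\
        {in `]0, L[, forall x, derivable (derive1 f) x 1},
      {in `]0, L[, forall x, - (1 / 2) * derive1 (derive1 f) x = mu * f x},
      (fun x => derive1 f x + alpha * f x) @ 0^'+ --> 0,
      (fun x => derive1 f x + beta * f x) @ L^'- --> 0 &
      exists2 x, x \in `[0, L] & f x != 0].

(* An enumeration, with multiplicity, of all the eigenpairs; the index starts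
   at 0 instead of 1. *)
Definition robin_eigensystem (R : realType) (L alpha beta : R)
    (lam : nat -> R) (f : nat -> R -> R) : Prop :=
  [/\ forall n, robin_eigenpair L alpha beta (lam n) (f n),
      {homo lam : m n / (m <= n)%N >-> m <= n},
      forall m n, (\int[lebesgue_measure]_(x in `[0%R, L]) (f m x * f n x)%R%:E
                   = ((m == n)%:R)%R%:E)%E &
      forall mu g, robin_eigenpair L alpha beta mu g ->
        exists (N : nat) (c : nat -> R),
          (forall n, (n < N)%N -> c n != 0 -> lam n = mu) /\
          {in `[0, L], forall x, g x = \sum_(n < N) c n * f n x}].

Definition heat_kernel (R : realType) (lam : nat -> R) (f : nat -> R -> R)
    (t x y : R) : R :=
  limn (series (fun n => expR (- lam n * t) * f n x * f n y)).

Definition mild_solution (d : measure_display) (Omega : measurableType d)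
    (R : realType) (P : probability Omega R) (L : R)
    (lam : nat -> R) (f : nat -> R -> R) (xi : set (R * R) -> {RV P >-> R})
    (w : R * R -> {RV P >-> R}) : Prop :=
  (forall t x, 0 < t -> x \in `[0, L] ->
     is_wiener_integral L xi
       ((fun p => heat_kernel lam f (t - p.1) x p.2) \_ (`]0, t[ `*` `[0, L]))
       (w (t, x)))
  /\ (forall x, x \in `[0, L] -> {ae P, forall o, w (0, x) o = 0}).

Definition rho (R : realType) (p q : R * R) : R :=
  Num.max (`|p.1 - q.1| `^ (1 / 4)) (`|p.2 - q.2| `^ (1 / 2)).

(* Main.v *)
Require Import Defs.
From mathcomp Require Import measurable_realfun lebesgue_integral_under ring lra.

(** The value [w p] is, up to null sets, the integral against the noise of the
kernel [kernel p], the heat kernel seen from the point [p].  Integration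
against the noise is an isometry, and in a Gaussian family the conditional
variance given finitely many members is almost surely constant, equal to the
squared distance to their linear span ([cond_var_wiener]).  The theorem is
therefore a statement about L^2 of space-time: the squared distance from
[kernel p] to the span of the [kernel (q j)] is of the order of M.

The heart of the conditional variance formula is that the residual of the
orthogonal projection is independent of the conditioning variables.  Joint
Gaussianity makes the mixed cosine integrals factor ([char_res]); a random
variable whose cosine integrals against all linear combinations of the [Y j]
vanish has zero integral on every event of their sigma-algebra
([fourier_null_sigma]), and this is applied to the residual and to its
centred square.

Upper bound.  The distance is at most the norm of [kernel p], and at most the
norm of [kernel p - kernel (q j)].  In the orthonormal system of eigenfunctions
both are sums over n whose general term is at most a constant times
min(r, 1/n^2), with r = t for the norm, r = (x - y)^2 for a displacement in
space and r = |t - s| for a displacement in time; such a sum is at most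
4 sqrt r ([sum_min_le]), which gives [kernel_bounds].  The estimate uses that
the eigenvalues grow at least quadratically ([weyl]) and that eigenfunctions
are bounded uniformly in n, with derivatives of size the square root of the
eigenvalue ([eigenfunction_bounds]).

Lower bound.  For smooth tau with tau(0) = 0 and smooth X obeying the Robin
conditions, put phi = tau' X - (1/2) tau X''.  Integrating by parts in time
and space gives <kernel q, phi> = tau(t_q) X(x_q) at every point q
([kernel_test]), because the heat kernel inverts the heat operator.  Choose
tau X to be a bump of size M^2 in time and M in space around p; it vanishes
at all the [q j] and at time 0, so any combination r of [kernel p] minus the
[kernel (q j)] satisfies <r, phi> = X(x_p), and the inequality of
Cauchy and Schwarz yields ||r||^2 >= X(x_p)^2 / ||phi||^2, while
||phi||^2 is of order 1 / M ([kernel_lower]).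

The pointwise convergence of eigenfunction expansions used in [kernel_test]
is not part of the definition of an eigensystem, which only asserts that all
eigenfunctions have been enumerated.  Completeness comes from [minmax]: on
the complement of the first N eigenfunctions the shifted operator is bounded
below by its N-th eigenvalue.  Its proof replaces the compactness of the
resolvent by an explicit estimate for the ordinary differential equation
([apriori]). *)

Set Implicit Arguments.
Unset Strict Implicit.
Unset Printing Implicit Defensive.

(** * Square-integrable functions *)

Section L2.
Context (d : measure_display) (T : measurableType d) (R : realType).
Variables (mu : {measure set T -> \bar R}) (D : set T).
Hypothesis mD : measurable D.
Implicit Types f g h : T -> R.

Definition L2 f := measurable_fun D f /\
  mu.-integrable D (EFin \o (fun x => f x ^+ 2)).

Definition ip f g := \int[mu]_(x in D) (f x * g x).

Lemma L2_intM f g : L2 f -> L2 g -> mu.-integrable D (EFin \o (fun x => f x * g x)).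
Proof.
move=> [mf If] [mg Ig].
have I : mu.-integrable D (EFin \o (fun x => f x ^+ 2 + g x ^+ 2)).
  exact: (integrableD mD If Ig).
apply: (le_integrable mD _ _ I).
  by apply/measurable_EFinP; exact: measurable_funM.
move=> x Dx /=; rewrite lee_fin [leRHS]ger0_norm ?addr_ge0 ?sqr_ge0//.
rewrite ler_norml; apply/andP; split; nra.
Qed.

Lemma L2_intZl f g k : L2 f -> L2 g ->
  mu.-integrable D (EFin \o (fun x => k * (f x * g x))).
Proof. by move=> Lf Lg; apply: (integrableZl mD k (L2_intM Lf Lg)). Qed.

Lemma L20 : L2 (fun=> 0).
Proof.
split=> //; under [X in integrable _ _ (_ \o X)]eq_fun do rewrite expr0n.
exact: integrable0.
Qed.

Lemma L2D f g : L2 f -> L2 g -> L2 (fun x => f x + g x).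
Proof.
move=> Lf Lg; split; first by apply: measurable_funD; [exact: Lf.1|exact: Lg.1].
have -> : (EFin \o (fun x => (f x + g x) ^+ 2)) =
   (EFin \o (fun x => (f x ^+ 2 + 2 * (f x * g x)) + g x ^+ 2)).
  by apply/funext => x /=; congr EFin; ring.
exact: (integrableD mD (integrableD mD Lf.2 (L2_intZl 2 Lf Lg)) Lg.2).
Qed.

Lemma L2Z k f : L2 f -> L2 (fun x => k * f x).
Proof.
move=> Lf; split; first by apply: measurable_funM => //; exact: Lf.1.
have -> : (EFin \o (fun x => (k * f x) ^+ 2)) =
   (EFin \o (fun x => k ^+ 2 * (f x * f x))).
  by apply/funext => x /=; congr EFin; ring.
exact: L2_intZl.
Qed.

Lemma L2B f g : L2 f -> L2 g -> L2 (fun x => f x - g x).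
Proof.
move=> Lf Lg; have -> : (fun x => f x - g x) = (fun x => f x + -1 * g x).
  by apply/funext => x; rewrite mulN1r.
by apply: L2D => //; exact: L2Z.
Qed.

Lemma L2_sum (I : Type) (s : seq I) (p : pred I) (F : I -> T -> R) :
  (forall i, p i -> L2 (F i)) -> L2 (fun x => \sum_(i <- s | p i) F i x).
Proof.
move=> LF; elim: s => [|i s IH].
  by under eq_fun do rewrite big_nil; exact: L20.
under eq_fun do rewrite big_cons.
have [pi|_] := boolP (p i) => //.
by apply: L2D => //; exact: LF.
Qed.

Lemma ipC f g : ip f g = ip g f.
Proof. by rewrite /ip; under eq_Rintegral do rewrite mulrC. Qed.

Lemma ipDl f g h : L2 f -> L2 g -> L2 h ->
  ip (fun x => f x + g x) h = ip f h + ip g h.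
Proof.
move=> Lf Lg Lh; rewrite /ip.
under eq_Rintegral do rewrite mulrDl.
by rewrite RintegralD//; exact: L2_intM.
Qed.

Lemma ipZl k f h : L2 f -> L2 h -> ip (fun x => k * f x) h = k * ip f h.
Proof.
move=> Lf Lh; rewrite /ip.
under eq_Rintegral do rewrite -mulrA.
by rewrite RintegralZl//; exact: L2_intM.
Qed.

Lemma ipDr f g h : L2 f -> L2 g -> L2 h ->
  ip h (fun x => f x + g x) = ip h f + ip h g.
Proof. by move=> *; rewrite ipC ipDl// ipC [ip g h]ipC. Qed.

Lemma ipZr k f h : L2 f -> L2 h -> ip h (fun x => k * f x) = k * ip h f.
Proof. by move=> *; rewrite ipC ipZl// ipC. Qed.

Lemma ipBl f g h : L2 f -> L2 g -> L2 h ->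
  ip (fun x => f x - g x) h = ip f h - ip g h.
Proof.
move=> Lf Lg Lh; have -> : (fun x => f x - g x) = (fun x => f x + -1 * g x).
  by apply/funext => x; rewrite mulN1r.
by rewrite ipDl ?ipZl ?mulN1r//; exact: L2Z.
Qed.

Lemma ipBr f g h : L2 f -> L2 g -> L2 h ->
  ip h (fun x => f x - g x) = ip h f - ip h g.
Proof. by move=> *; rewrite ipC ipBl// ipC [ip g h]ipC. Qed.

Lemma ip0l h : ip (fun=> 0) h = 0.
Proof. by rewrite /ip; under eq_Rintegral do rewrite mul0r; rewrite Rintegral_cst// mul0r. Qed.

Lemma ip_suml (I : Type) (s : seq I) (p : pred I) (F : I -> T -> R) h :
  (forall i, p i -> L2 (F i)) -> L2 h ->
  ip (fun x => \sum_(i <- s | p i) F i x) h = \sum_(i <- s | p i) ip (F i) h.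
Proof.
move=> LF Lh; elim: s => [|i s IH].
  by under eq_fun do rewrite big_nil; rewrite ip0l big_nil.
rewrite big_cons -IH; under eq_fun do rewrite big_cons.
have [pi|_] := boolP (p i) => //.
by rewrite ipDl//; [exact: LF|exact: L2_sum].
Qed.

Lemma ip_sumr (I : Type) (s : seq I) (p : pred I) (F : I -> T -> R) h :
  (forall i, p i -> L2 (F i)) -> L2 h ->
  ip h (fun x => \sum_(i <- s | p i) F i x) = \sum_(i <- s | p i) ip h (F i).
Proof.
by move=> LF Lh; rewrite ipC ip_suml//; apply: eq_bigr => i _; rewrite ipC.
Qed.

Lemma ip_ge0 f : 0 <= ip f f.
Proof. by apply: Rintegral_ge0 => x _; rewrite -expr2 sqr_ge0. Qed.

Lemma eq_ip f f' g g' : {in D, f =1 f'} -> {in D, g =1 g'} -> ip f g = ip f' g'.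
Proof. by move=> ff gg; apply: eq_Rintegral => x xD; rewrite ff// gg. Qed.

Lemma eq_L2 f g : {in D, f =1 g} -> L2 f -> L2 g.
Proof.
move=> fg [mf If]; split; first exact: eq_measurable_fun mf.
by apply: eq_integrable If => // x xD; rewrite /= fg.
Qed.

(** Nonnegativity of the quadratic polynomial k -> ||f - k g||^2. *)
Lemma ip_CS f g : L2 f -> L2 g -> ip f g ^+ 2 <= ip f f * ip g g.
Proof.
move=> Lf Lg.
have H k : 0 <= ip f f - 2 * k * ip f g + k ^+ 2 * ip g g.
  have := ip_ge0 (fun x => f x - k * g x).
  have Lk := L2Z k Lg.
  rewrite ipBl ?ipBr ?ipZl ?ipZr//; try exact: L2B.
  rewrite (ipC g f); lra.
have [g0|gp] := eqVneq (ip g g) 0; last first.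
  have gp' : 0 < ip g g by rewrite lt_def gp ip_ge0.
  have := mulr_ge0 (H (ip f g / ip g g)) (ltW gp').
  rewrite (_ : _ * ip g g = ip f f * ip g g - ip f g ^+ 2) ?subr_ge0//.
  by field.
rewrite g0 mulr0; have [->|fg] := eqVneq (ip f g) 0; first by rewrite expr0n.
(* When ||g|| = 0 the polynomial is affine in k, and this k makes it equal to
   -1 unless <f, g> vanishes. *)
have {H} := H ((ip f f + 1) / (2 * ip f g)).
rewrite (_ : (_ ^+ 2) * _ = 0) ?g0 ?mulr0 ?addr0 //.
have -> : 2 * ((ip f f + 1) / (2 * ip f g)) * ip f g = ip f f + 1 by field.
by rewrite opprD addrA subrr add0r ler0N1.
Qed.

Lemma ip_sqD f g : L2 f -> L2 g ->
  ip (fun x => f x + g x) (fun x => f x + g x) <= 2 * ip f f + 2 * ip g g.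
Proof.
move=> Lf Lg.
have := ip_ge0 (fun x => f x - g x).
rewrite ipBl ?ipBr ?ipDl ?ipDr//; try exact: L2B; try exact: L2D.
rewrite (ipC g f); lra.
Qed.

Lemma ip_le_sqrt f g : L2 f -> L2 g -> `|ip f g| <= Num.sqrt (ip f f) * Num.sqrt (ip g g).
Proof.
move=> Lf Lg; rewrite -sqrtrM ?ip_ge0// -sqrtr_sqr ler_wsqrtr//; exact: ip_CS.
Qed.

Lemma cvg_ip (f g : T -> R) (u v : nat -> T -> R) :
  L2 f -> L2 g -> (forall n, L2 (u n)) -> (forall n, L2 (v n)) ->
  ip (fun x => f x - u n x) (fun x => f x - u n x) @[n --> \oo] --> 0 ->
  ip (fun x => g x - v n x) (fun x => g x - v n x) @[n --> \oo] --> 0 ->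
  ip (u n) (v n) @[n --> \oo] --> ip f g.
Proof.
move=> Lf Lg Lu Lv cu cv.
have E n : ip (u n) (v n) = ip f g - (ip (fun x => f x - u n x) g +
   ip f (fun x => g x - v n x) -
   ip (fun x => f x - u n x) (fun x => g x - v n x)).
  rewrite !ipBl ?ipBr//; try exact: L2B; ring.
have sq w : (w : nat -> R) @ \oo --> 0 -> Num.sqrt (w n) @[n --> \oo] --> 0.
  by move=> w0; rewrite -[X in _ --> X](@sqrtr0 R); apply: cvg_comp w0 _; exact: sqrt_continuous.
have bnd (w z : nat -> R) : (forall n, `|w n| <= z n) -> z @ \oo --> 0 -> w @ \oo --> 0.
  move=> wz z0; apply/norm_cvg0P; apply: (squeeze_cvgr _ _ z0); last exact: cvg_cst.
  by near=> n; rewrite normr_ge0 wz.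
rewrite (_ : (fun n => _) = (fun n => ip f g - (ip (fun x => f x - u n x) g +
   ip f (fun x => g x - v n x) -
   ip (fun x => f x - u n x) (fun x => g x - v n x)))); last exact/funext.
rewrite -[X in _ --> X]subr0; apply: cvgB; first exact: cvg_cst.
rewrite -[X in _ --> X](subr0) -[X in _ --> X - _](addr0 0).
apply: cvgB; first apply: cvgD.
- apply: (bnd _ (fun n => Num.sqrt (ip (fun x => f x - u n x) (fun x => f x - u n x)) * Num.sqrt (ip g g))).
    by move=> n; apply: ip_le_sqrt => //; exact: L2B.
  by rewrite -[X in _ --> X](mul0r (Num.sqrt (ip g g))); apply: cvgM; [exact: sq|exact: cvg_cst].
- apply: (bnd _ (fun n => Num.sqrt (ip f f) * Num.sqrt (ip (fun x => g x - v n x) (fun x => g x - v n x)))).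
    by move=> n; apply: ip_le_sqrt => //; exact: L2B.
  by rewrite -[X in _ --> X](mulr0 (Num.sqrt (ip f f))); apply: cvgM; [exact: cvg_cst|exact: sq].
- apply: (bnd _ (fun n => Num.sqrt (ip (fun x => f x - u n x) (fun x => f x - u n x)) * Num.sqrt (ip (fun x => g x - v n x) (fun x => g x - v n x)))).
    by move=> n; apply: ip_le_sqrt => //; exact: L2B.
  by rewrite -[X in _ --> X](mul0r 0); apply: cvgM; exact: sq.
Unshelve. all: by end_near. Qed.

Lemma L2_EFin f : L2 f -> (\int[mu]_(x in D) (f x ^+ 2)%:E)%E = (ip f f)%:E.
Proof.
move=> Lf; rewrite /ip /Rintegral fineK.
  by apply: eq_integral => x _; rewrite expr2.
by apply: integrable_fin_num => //; exact: L2_intM.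
Qed.

Lemma L2_lty f : measurable_fun D f -> (\int[mu]_(x in D) (f x ^+ 2)%:E < +oo)%E -> L2 f.
Proof.
move=> mf fi; split => //; apply/integrableP; split.
  by apply/measurable_EFinP; exact: measurable_funX.
rewrite (eq_integral (fun x => (f x ^+ 2)%:E))// => x _ /=.
by rewrite ger0_norm ?sqr_ge0.
Qed.

(** Convergence of the extended integrals to 0 forces them to be finite from
some rank on, whence the square integrability of the limit. *)
Lemma L2_cvg f (u : nat -> T -> R) : measurable_fun D f -> (forall n, L2 (u n)) ->
  (\int[mu]_(x in D) ((f x - u n x) ^+ 2)%:E)%E @[n --> \oo] --> 0%E ->
  L2 f /\ ip (fun x => f x - u n x) (fun x => f x - u n x) @[n --> \oo] --> 0.
Proof.
move=> mf Lu cu.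
have Lf : L2 f.
  have [[n _ /(_ n (leqnn n)) Hn] _] := (fine_cvgP _ _).1 cu.
  have : L2 (fun x => f x - u n x).
    apply: L2_lty; last by rewrite ltey_eq Hn.
    by apply: measurable_funB => //; exact: (Lu n).1.
  move=> /L2D /(_ (Lu n)); apply: eq_L2 => x _; exact: subrK.
split=> //.
have [_] := (fine_cvgP _ _).1 cu; apply: cvg_trans; apply: near_eq_cvg.
by near=> n => /=; rewrite L2_EFin//; exact: L2B.
Unshelve. all: by end_near. Qed.

End L2.

(** * Calculus on the line *)

Section calculus.
Context (R : realType).
Local Notation leb := (@lebesgue_measure R).
Implicit Types (f g h F : R -> R) (x y k a b : R).

Lemma derD f g x a b : is_derive x 1 f a -> is_derive x 1 g b ->
  is_derive x 1 (fun y => f y + g y) (a + b).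
Proof. by move=> ? ?; exact: is_deriveD. Qed.

Lemma derB f g x a b : is_derive x 1 f a -> is_derive x 1 g b ->
  is_derive x 1 (fun y => f y - g y) (a - b).
Proof. by move=> ? ?; exact: is_deriveB. Qed.

Lemma derM f g x a b : is_derive x 1 f a -> is_derive x 1 g b ->
  is_derive x 1 (fun y => f y * g y) (a * g x + f x * b).
Proof.
move=> df dg; have /is_derive_eq := @is_deriveM _ _ f g x 1 a b df dg; apply.
by rewrite /GRing.scale/= addrC mulrC.
Qed.

Lemma derZ k f x a : is_derive x 1 f a -> is_derive x 1 (fun y => k * f y) (k * a).
Proof. by move=> ?; exact: is_deriveZ. Qed.

Lemma derN f x a : is_derive x 1 f a -> is_derive x 1 (fun y => - f y) (- a).
Proof. by move=> ?; exact: is_deriveN. Qed.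

Lemma der_comp f g x a b : is_derive (g x) 1 f a -> is_derive x 1 g b ->
  is_derive x 1 (fun y => f (g y)) (a * b).
Proof. by move=> ? ?; exact: is_derive1_comp. Qed.

Lemma derX2 f x a : is_derive x 1 f a -> is_derive x 1 (fun y => f y ^+ 2) (2 * (f x * a)).
Proof.
move=> df; have /is_derive_eq := derM df df.
by rewrite -[X in is_derive _ _ X]/(fun y => f y ^+ 2); apply; ring.
Qed.

Lemma der_scale g dg k x : (forall y : R, is_derive y 1 g (dg y)) ->
  is_derive x 1 (fun x => g (k * x)) (k * dg (k * x)).
Proof.
move=> dg_; have /is_derive_eq := der_comp (dg_ (k * x)) (derZ k (is_derive_id x 1)).
by apply; rewrite mulr1 mulrC.
Qed.

Lemma deriv_continuous F f : (forall x : R, is_derive x 1 F (f x)) -> continuous F.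
Proof.
move=> dF x; apply: differentiable_continuous; apply/derivable1_diffP.
by have [] := dF x.
Qed.

(** Differentiability is assumed on the whole line; this spares all one-sided
derivatives at the end points, at the price of working with functions that
extend beyond the interval. *)
Lemma FTC_global F f a b : (forall x : R, is_derive x 1 F (f x)) -> continuous f ->
  a <= b -> \int[leb]_(x in `[a, b]) f x = F b - F a.
Proof.
move=> dF cf; rewrite le_eqVlt => /predU1P[->|ab].
  by rewrite subrr set_itv1 Rintegral_set1.
have cF := deriv_continuous dF.
rewrite /Rintegral (@continuous_FTC2 _ f F)//.
- by apply: continuous_subspaceT.
- split.
  + by move=> x _; have [] := dF x.
  + apply: cvg_at_right_filter; exact: cF.
  + apply: cvg_at_left_filter; exact: cF.
- by move=> x _; rewrite derive1E; have [_ ->] := dF x.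
Qed.

Lemma continuous_integrable f a b : continuous f -> leb.-integrable `[a, b] (EFin \o f).
Proof.
move=> cf; apply: continuous_compact_integrable; first exact: segment_compact.
exact: continuous_subspaceT.
Qed.

Lemma continuous_L2 f a b : continuous f -> L2 leb `[a, b] f.
Proof.
move=> cf; split.
  apply: measurable_funS (continuous_measurable_fun cf) => //.
apply: continuous_integrable => x.
by apply: (@continuous_comp _ _ _ f (fun y => y ^+ 2)); [exact: cf|exact: exprn_continuous].
Qed.

(** Integrals from a variable base point - A are differentiable to the right
of - A only, so a primitive on the line is glued from those with base point
beyond |x|, normalised at 0. *)
Lemma primitive_exists h : continuous h -> exists F, forall x : R, is_derive x 1 F (h x).
Proof.
move=> ch.
pose G (A x : R) : R := \int[leb]_(t in `[- A, x]) h t.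
have dG (A x : R) : - A < x -> is_derive x 1 (G A) (h x).
  move=> Ax; have x1 : x < x + 1 by rewrite ltrDl.
  have [dG EG] := continuous_FTC1_closed x1 (continuous_integrable (- A) (x + 1) ch) Ax (ch x).
  by apply: DeriveDef; [exact: dG|rewrite -derive1E; exact: EG].
pose P x := G (`|x| + 1) x - G (`|x| + 1) 0.
exists P => x.
pose A := `|x| + 2.
have nx (y : R) : `|y| < A -> P y = G A y - G A 0.
  move=> yA; have B : - A <= - (`|y| + 1) \/ - (`|y| + 1) <= - A by apply/orP; exact: le_total.
  have y1 : - (`|y| + 1) <= y by rewrite lerNl; apply: (le_trans (ler_norm _)); rewrite normrN; lra.
  have y0 : - (`|y| + 1) <= 0 by have := normr_ge0 y; lra.
  have A0 : 0 <= A by rewrite /A; have := normr_ge0 x; lra.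
  have Ay : - A <= y by rewrite lerNl; apply: (le_trans (ler_norm _)); rewrite normrN; lra.
  have split_ a b z : - a <= - b -> - b <= z -> G a z = \int[leb]_(t in `[- a, - b]) h t +
     \int[leb]_(t in `]- b, z]) h t.
    move=> ab bz; rewrite /G -[RHS]addrC; apply/eqP; rewrite -subr_eq; apply/eqP.
    rewrite Rintegral_itvB//; first exact: continuous_integrable.
  have oc b z : \int[leb]_(t in `]- b, z]) h t = G b z.
    rewrite /G Rintegral_itv_obnd_cbnd//; apply: integrableS (continuous_integrable (-b) z ch) => //.
    exact: subset_itv_oc_cc.
  case: B => B; rewrite /P.
    by rewrite (split_ A (`|y| + 1) y)// (split_ A (`|y| + 1) 0)// !oc; lra.
  by rewrite (split_ (`|y| + 1) A y)// ?(split_ (`|y| + 1) A 0)// ?oc; [lra|rewrite oppr_le0].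
have -> : h x = h x - 0 by rewrite subr0.
have : is_derive x 1 (fun y => G A y - G A 0) (h x - 0).
  apply: is_deriveB; apply: dG.
  by rewrite /A ltrNl; have := ler_norm (- x); rewrite normrN; lra.
apply: near_eq_is_derive.
near=> y; rewrite nx//.
have : `|y - x| < 1 by near: y; apply: cvgr_distC_lt.
move=> yx; rewrite /A; have := ler_normD (y - x) x; rewrite subrK; lra.
Unshelve. all: by end_near. Qed.

Lemma is_derive0_cst f a b : (forall x : R, is_derive x 1 f 0) -> f a = f b.
Proof. by move=> df; exact: is_derive_0_is_cst. Qed.

End calculus.

(** * The Robin boundary value problem *)

Section fundamental.
Context (R : realType).

(** Cosine and sine, their hyperbolic analogues, or 1 and x, according to the
sign of c: in all cases - (1/2) C'' = c C and - (1/2) S'' = c S, and the last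
identity says that the Wronskian is 1. *)
Lemma fundamental_system (c : R) : exists C S : R -> R,
  [/\ forall x : R, is_derive x 1 C (- (2 * c) * S x),
      forall x : R, is_derive x 1 S (C x), C 0 = 1, S 0 = 0 &
      forall x, C x ^+ 2 + 2 * c * S x ^+ 2 = 1].
Proof.
have [c0|c0|c0] := ltrgt0P c.
- pose k := Num.sqrt (2 * c).
  have k0 : k != 0 by rewrite gt_eqF// sqrtr_gt0 mulr_gt0.
  have k2 : k ^+ 2 = 2 * c by rewrite sqr_sqrtr// mulr_ge0// ltW.
  exists (fun x => cos (k * x)), (fun x => k^-1 * sin (k * x)); split.
  + move=> x; have := der_scale k x (@is_derive_cos R).
    by move/is_derive_eq; apply; rewrite -k2; field.
  + move=> x; have := derZ k^-1 (der_scale k x (@is_derive_sin R)).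
    by move/is_derive_eq; apply; rewrite /GRing.scale/=; field.
  + by rewrite mulr0 cos0.
  + by rewrite mulr0 sin0 mulr0.
  + move=> x; rewrite -k2 exprMn mulrA exprVn divff ?expf_neq0// mul1r.
    exact: cos2Dsin2.
- pose k := Num.sqrt (- (2 * c)).
  have k0 : k != 0 by rewrite gt_eqF// sqrtr_gt0; lra.
  have k2 : - (k ^+ 2) = 2 * c by rewrite sqr_sqrtr ?opprK//; lra.
  exists (fun x => (expR (k * x) + expR (- k * x)) / 2),
         (fun x => (expR (k * x) - expR (- k * x)) / (2 * k)); split.
  + move=> x; have /is_derive_eq := derM (derD (der_scale k x (@is_derive_expR R))
      (der_scale (- k) x (@is_derive_expR R))) (is_derive_cst (2^-1 : R) x 1).
    by apply; rewrite -k2 /=; field.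
  + move=> x; have /is_derive_eq := derM (derB (der_scale k x (@is_derive_expR R))
      (der_scale (- k) x (@is_derive_expR R))) (is_derive_cst ((2 * k)^-1 : R) x 1).
    by apply=> /=; field.
  + by rewrite !mulr0 expR0; field.
  + by rewrite !mulr0 expR0; field.
  + move=> x; rewrite -k2.
    have E : expR (k * x) * expR (- k * x) = 1 by rewrite -expRD mulNr subrr expR0.
    by rewrite -[RHS]E; field.
- exists (fun=> 1), id; rewrite c0; split => //.
  + by move=> x; rewrite mulr0 oppr0 mul0r; exact: is_derive_cst.
  + by move=> x; exact: is_derive_id.
  + by move=> x; rewrite mulr0 mul0r addr0 expr1n.
Qed.

End fundamental.

Section robin_form.
Context (R : realType) (L alpha beta : R).
Hypothesis L0 : 0 < L.
Local Notation leb := (@lebesgue_measure R).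
Local Notation dot := (ip leb `[0, L]).
Implicit Types (f g h u v : R -> R) (x y z : R).

Lemma mI : measurable (`[0, L] : set (measurableTypeR R)). Proof. by []. Qed.
Hint Resolve mI : core.

Lemma cL2 f : continuous f -> L2 leb `[0, L] f.
Proof. exact: continuous_L2. Qed.

Lemma dotC f g : dot f g = dot g f. Proof. exact: ipC. Qed.
Lemma dot_ge0 f : 0 <= dot f f. Proof. exact: ip_ge0. Qed.

Definition C1 v v1 := (forall x : R, is_derive x 1 v (v1 x)) /\ continuous v1.

Lemma C1_cont v v1 : C1 v v1 -> continuous v.
Proof. by case=> dv _; exact: deriv_continuous dv. Qed.

(** The domain of the operator. The two derivatives are carried along as data,
so that nothing ever has to be extracted from a derivative operator. *)
Definition robin_dom v v1 v2 := [/\ C1 v v1, C1 v1 v2,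
  v1 0 + alpha * v 0 = 0 & v1 L + beta * v L = 0].

Lemma continuous_ip_bound f (K : R) : continuous f -> 0 <= K ->
  (forall x, 0 <= x <= L -> `|f x| <= K) -> (dot f f) <= L * K ^+ 2.
Proof.
move=> cf K0 fK; apply: (@le_trans _ _ (\int[leb]_(x in `[0, L]) (K ^+ 2))).
  apply: le_Rintegral => //.
  - by apply: L2_intM => //; exact: cL2.
  - by apply: continuous_integrable => x; exact: cvg_cst.
  - move=> x /=; rewrite in_itv/= => /fK fx.
    by rewrite -expr2 -[leLHS]ger0_norm ?sqr_ge0// normrX lerXn2r// nnegrE.
rewrite Rintegral_cst//= lebesgue_measure_itv/= lte_fin L0 oppr0 addr0 mulrC//.
Qed.

Lemma Rint_sub f x y : continuous f -> 0 <= x -> y <= L -> (forall z, 0 <= f z) ->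
  \int[leb]_(z in `[x, y]) f z <= \int[leb]_(z in `[0, L]) f z.
Proof.
move=> cf x0 yL f0; rewrite /Rintegral; apply: fine_le.
- by apply: integrable_fin_num => //; exact: continuous_integrable.
- by apply: integrable_fin_num => //; exact: continuous_integrable.
apply: ge0_subset_integral => //.
- apply/measurable_EFinP; apply: measurable_funS (continuous_measurable_fun cf) => //.
- by move=> z _; rewrite lee_fin.
- by apply: subset_itv; rewrite bnd_simp.
Qed.

Lemma partial_CS f g x y : continuous f -> continuous g -> 0 <= x -> x <= y -> y <= L ->
  `|\int[leb]_(z in `[x, y]) (f z * g z)| <= Num.sqrt (dot f f) * Num.sqrt (dot g g).
Proof.
move=> cf cg x0 xy yL.
have cn h : continuous h -> continuous (fun z => `|h z|).
  by move=> ch z; apply: (@continuous_comp _ _ _ h Num.norm); [exact: ch|exact: norm_continuous].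
have cfg : continuous (fun z => f z * g z) by move=> z; apply: cvgM; [exact: cf|exact: cg].
apply: (le_trans (le_normr_Rintegral _ (continuous_integrable _ _ cfg))) => //.
apply: (le_trans (Rint_sub (cn _ cfg) x0 yL _)) => //.
under eq_Rintegral do rewrite normrM.
have nn h : ip leb `[0, L] (fun z => `|h z|) (fun z => `|h z|) = (dot h h).
  by apply: eq_Rintegral => z _; rewrite -expr2 -normrX ger0_norm ?sqr_ge0.
have := ip_le_sqrt mI (cL2 (cn _ cf)) (cL2 (cn _ cg)).
by rewrite !nn; apply: le_trans; exact: ler_norm.
Qed.

(** The value at x is compared with the mean of v^2 over the interval, the
oscillation of v^2 being at most the integral of |2 v v'|. *)
Lemma trace_ineq v v1 x : C1 v v1 -> 0 <= x <= L ->
  v x ^+ 2 <= (dot v v) / L + 2 * (Num.sqrt (dot v v) * Num.sqrt (dot v1 v1)).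
Proof.
move=> Cv /andP[x0 xL]; have cv := C1_cont Cv; have [dv cv1] := Cv.
set Q := Num.sqrt _ * _.
have dv2 (y : R) : is_derive y 1 (fun z => v z ^+ 2) (2 * (v y * v1 y)).
  exact: derX2.
have c2 : continuous (fun y => 2 * (v y * v1 y)).
  by move=> z; apply: cvgM; [exact: cvg_cst|apply: cvgM; [exact: cv|exact: cv1]].
have cvv : continuous (fun y => v y * v1 y).
  by move=> z; apply: cvgM; [exact: cv|exact: cv1].
have H a b : 0 <= a -> a <= b -> b <= L -> `|v b ^+ 2 - v a ^+ 2| <= 2 * Q.
  move=> a0 ab bL; rewrite -(FTC_global dv2 c2 ab) RintegralZl//; last exact: continuous_integrable.
  by rewrite normrM ger0_norm// ler_pM2l//; exact: partial_CS.
have Hy y : 0 <= y <= L -> v x ^+ 2 - 2 * Q <= v y * v y.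
  move=> /andP[y0 yL]; rewrite -expr2; have [xy|/ltW yx] := leP x y.
    by have := H _ _ x0 xy yL; rewrite ler_norml => /andP[]; lra.
  by have := H _ _ y0 yx xL; rewrite ler_norml => /andP[]; lra.
have : \int[leb]_(y in `[0, L]) (v x ^+ 2 - 2 * Q) <= (dot v v).
  apply: le_Rintegral => //.
  - by apply: continuous_integrable => z; exact: cvg_cst.
  - by apply: L2_intM => //; exact: cL2.
rewrite Rintegral_cst//= lebesgue_measure_itv/= lte_fin L0 oppr0 addr0/= => Hv.
by rewrite -lerBlDr ler_pdivlMr.
Qed.

Lemma green v v1 v2 u u1 : robin_dom v v1 v2 -> C1 u u1 ->
  (dot v2 u) = alpha * (v 0 * u 0) - beta * (v L * u L) - (dot v1 u1).
Proof.
move=> [Cv Cv1 v0 vL] Cu; have [dv cv1] := Cv; have [dv1 cv2] := Cv1; have [du cu1] := Cu.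
have cu := C1_cont Cu.
have d (x : R) : is_derive x 1 (fun x => v1 x * u x) (v2 x * u x + v1 x * u1 x).
  exact: derM.
have c1 : continuous (fun x => v2 x * u x) by move=> z; apply: cvgM; [exact: cv2|exact: cu].
have c2 : continuous (fun x => v1 x * u1 x) by move=> z; apply: cvgM; [exact: cv1|exact: cu1].
have c3 : continuous (fun x => v2 x * u x + v1 x * u1 x).
  by move=> z; apply: cvgD; [exact: c1|exact: c2].
have := FTC_global d c3 (ltW L0).
rewrite RintegralD//; [|exact: continuous_integrable..].
rewrite -/((dot v2 u)) -/((dot v1 u1)).
have -> : v1 0 = - (alpha * v 0) by lra.
have -> : v1 L = - (beta * v L) by lra.
by lra.
Qed.

Lemma green_sym v v1 v2 u u1 u2 : robin_dom v v1 v2 -> robin_dom u u1 u2 -> (dot v2 u) = (dot v u2).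
Proof.
move=> dv du; have [Cv _ _ _] := dv; have [Cu _ _ _] := du.
by rewrite (green dv Cu) (dotC v u2) (green du Cv) (dotC u1) (mulrC (u 0)) (mulrC (u L)).
Qed.

Let B := `|alpha| + `|beta|.
(** What is left of the boundary terms of [green] after half of ||v'||^2 has
been used to absorb them. *)
Definition form_const := B / L + 2 * B ^+ 2.

(** The boundary terms are estimated by [trace_ineq], and the product
||v|| ||v'|| is split so that ||v'||^2 appears with a factor 1/2. *)
Lemma form_bound v v1 v2 : robin_dom v v1 v2 ->
  (dot v1 v1) <= - 2 * (dot v2 v) + 2 * form_const * (dot v v).
Proof.
move=> dv; have [Cv _ _ _] := dv.
rewrite (green dv Cv) /form_const.
set y := (dot v1 v1); set z := (dot v v).
have y0 : 0 <= y by exact: dot_ge0.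
have z0 : 0 <= z by exact: dot_ge0.
have B0 : 0 <= B by rewrite addr_ge0.
have t x : 0 <= x <= L -> v x * v x <= z / L + 2 * (Num.sqrt z * Num.sqrt y).
  by rewrite -expr2; exact: trace_ineq.
have t0 := t 0; rewrite lexx ltW// in t0; have {t0} := t0 isT.
have tL := t L; rewrite lexx ltW// in tL; have {tL} := tL isT.
set tr := z / L + _ => hL h0.
have a1 : alpha * (v 0 * v 0) <= `|alpha| * tr.
  apply: (le_trans (ler_norm _)); rewrite normrM ler_wpM2l// ger0_norm//.
  by rewrite -expr2 sqr_ge0.
have b1 : - (beta * (v L * v L)) <= `|beta| * tr.
  apply: (le_trans (ler_norm _)); rewrite normrN normrM ler_wpM2l// ger0_norm//.
  by rewrite -expr2 sqr_ge0.
have : 2 * B * (Num.sqrt z * Num.sqrt y) <= y / 2 + 2 * B ^+ 2 * z.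
  have := sqr_ge0 (Num.sqrt y - 2 * B * Num.sqrt z).
  rewrite sqrrB exprMn !sqr_sqrtr//; lra.
have : B * tr = B * L^-1 * z + 2 * B * (Num.sqrt z * Num.sqrt y).
  by rewrite /tr; ring.
have : B * tr = `|alpha| * tr + `|beta| * tr by rewrite /B mulrDl.
lra.
Qed.

Lemma form_lower v v1 v2 : robin_dom v v1 v2 -> - (form_const * (dot v v)) <= - (dot v2 v).
Proof.
move=> dv; have := form_bound dv; have := dot_ge0 v1; lra.
Qed.

Lemma form_const_ge0 : 0 <= form_const.
Proof.
have B0 : 0 <= B by rewrite addr_ge0.
by rewrite addr_ge0 ?divr_ge0 ?mulr_ge0 ?sqr_ge0// ltW.
Qed.

End robin_form.

Section cont.
Context (R : realType).
Implicit Types (f g h u v : R -> R) (x y z k : R).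

Lemma contD f g : continuous f -> continuous g -> continuous (fun x => f x + g x).
Proof. by move=> cf cg x; apply: cvgD; [exact: cf|exact: cg]. Qed.
Lemma contB f g : continuous f -> continuous g -> continuous (fun x => f x - g x).
Proof. by move=> cf cg x; apply: cvgB; [exact: cf|exact: cg]. Qed.
Lemma contM f g : continuous f -> continuous g -> continuous (fun x => f x * g x).
Proof. by move=> cf cg x; apply: cvgM; [exact: cf|exact: cg]. Qed.
Lemma contZ k f : continuous f -> continuous (fun x => k * f x).
Proof. by move=> cf x; apply: cvgM; [exact: cvg_cst|exact: cf]. Qed.
Lemma cont_cst k : continuous (fun _ : R => k).
Proof. by move=> x; exact: cvg_cst. Qed.
Lemma cont_sum (n : nat) (F : nat -> R -> R) : (forall i, continuous (F i)) ->
  continuous (fun x => \sum_(i < n) F i x).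
Proof.
move=> cF; elim: n => [|n IH].
  by under eq_fun do rewrite big_ord0; exact: cont_cst.
by under eq_fun do rewrite big_ord_recr; exact: contD.
Qed.

Lemma squeeze0 (u w : nat -> R) : (forall n, 0 <= u n <= w n) ->
  w @ \oo --> 0 -> u @ \oo --> 0.
Proof.
move=> uw w0; apply: (squeeze_cvgr _ _ w0); last exact: cvg_cst.
by near=> n; exact: uw.
Unshelve. all: by end_near. Qed.

Lemma cont_bound f (a b : R) : a <= b -> continuous f ->
  exists2 M, 0 <= M & forall x, a <= x <= b -> `|f x| <= M.
Proof.
move=> ab cf.
have cn : {within `[a, b], continuous (fun x => `|f x|)}.
  apply: continuous_subspaceT => z.
  by apply: (@continuous_comp _ _ _ f Num.norm); [exact: cf|exact: norm_continuous].
have [c _ Hc] := EVT_max ab cn.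
by exists `|f c| => // x xab; apply: Hc; rewrite in_itv.
Qed.

End cont.

Section robin_problem.
Context (R : realType) (L alpha beta : R).
Hypothesis L0 : 0 < L.
Local Notation leb := (@lebesgue_measure R).
Local Notation dot := (ip leb `[0, L]).
Local Notation dom := (robin_dom L alpha beta).
Implicit Types (f g h u v s : R -> R) (x y z c : R).
Local Hint Resolve mI : core.

Lemma dotDl f g h : continuous f -> continuous g -> continuous h ->
  dot (fun x => f x + g x) h = dot f h + dot g h.
Proof. by move=> cf cg ch; apply: ipDl => //; exact: cL2. Qed.
Lemma dotBl f g h : continuous f -> continuous g -> continuous h ->
  dot (fun x => f x - g x) h = dot f h - dot g h.
Proof. by move=> cf cg ch; apply: ipBl => //; exact: cL2. Qed.
Lemma dotZl k f h : continuous f -> continuous h ->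
  dot (fun x => k * f x) h = k * dot f h.
Proof. by move=> cf ch; apply: ipZl => //; exact: cL2. Qed.
Lemma dotDr f g h : continuous f -> continuous g -> continuous h ->
  dot h (fun x => f x + g x) = dot h f + dot h g.
Proof. by move=> cf cg ch; apply: ipDr => //; exact: cL2. Qed.
Lemma dotBr f g h : continuous f -> continuous g -> continuous h ->
  dot h (fun x => f x - g x) = dot h f - dot h g.
Proof. by move=> cf cg ch; apply: ipBr => //; exact: cL2. Qed.
Lemma dotZr k f h : continuous f -> continuous h ->
  dot h (fun x => k * f x) = k * dot h f.
Proof. by move=> cf ch; apply: ipZr => //; exact: cL2. Qed.
Lemma dot_CS f g : continuous f -> continuous g ->
  `|dot f g| <= Num.sqrt (dot f f) * Num.sqrt (dot g g).
Proof. by move=> cf cg; apply: ip_le_sqrt => //; exact: cL2. Qed.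
Lemma dot_sqD f g : continuous f -> continuous g ->
  dot (fun x => f x + g x) (fun x => f x + g x) <= 2 * dot f f + 2 * dot g g.
Proof. by move=> cf cg; apply: ip_sqD => //; exact: cL2. Qed.
Lemma dot_suml n (F : nat -> R -> R) h : (forall i, continuous (F i)) -> continuous h ->
  dot (fun x => \sum_(i < n) F i x) h = \sum_(i < n) dot (F i) h.
Proof.
move=> cF ch; have -> : (fun x => \sum_(i < n) F i x) = fun x => \sum_(i <- index_enum 'I_n) F (nat_of_ord i) x by [].
by rewrite ip_suml// => [i _|]; exact: cL2.
Qed.

Lemma dom_cont v v1 v2 : dom v v1 v2 -> [/\ continuous v, continuous v1 & continuous v2].
Proof. by case=> Cv Cv1 _ _; split; [exact: C1_cont Cv|exact: Cv.2|exact: Cv1.2]. Qed.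

Lemma C1D f f1 g g1 : C1 f f1 -> C1 g g1 -> C1 (fun x => f x + g x) (fun x => f1 x + g1 x).
Proof. by move=> [df cf] [dg cg]; split; [move=> x; exact: derD|exact: contD]. Qed.
Lemma C1Z k f f1 : C1 f f1 -> C1 (fun x => k * f x) (fun x => k * f1 x).
Proof. by move=> [df cf]; split; [move=> x; exact: derZ|exact: contZ]. Qed.

Lemma domD v v1 v2 u u1 u2 : dom v v1 v2 -> dom u u1 u2 ->
  dom (fun x => v x + u x) (fun x => v1 x + u1 x) (fun x => v2 x + u2 x).
Proof.
move=> [Cv Cv1 v0 vL] [Cu Cu1 u0 uL]; split; [exact: C1D|exact: C1D|lra|lra].
Qed.

Lemma domZ k v v1 v2 : dom v v1 v2 ->
  dom (fun x => k * v x) (fun x => k * v1 x) (fun x => k * v2 x).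
Proof.
move=> [Cv Cv1 v0 vL]; split; [exact: C1Z|exact: C1Z| |].
  by transitivity (k * (v1 0 + alpha * v 0)); [ring|rewrite v0 mulr0].
by transitivity (k * (v1 L + beta * v L)); [ring|rewrite vL mulr0].
Qed.

Lemma dom_sum n (F F1 F2 : nat -> R -> R) : (forall i, dom (F i) (F1 i) (F2 i)) ->
  dom (fun x => \sum_(i < n) F i x) (fun x => \sum_(i < n) F1 i x)
      (fun x => \sum_(i < n) F2 i x).
Proof.
move=> dF; elim: n => [|n IH].
  under eq_fun do rewrite big_ord0; under [X in robin_dom _ _ _ _ X _]eq_fun do rewrite big_ord0.
  under [X in robin_dom _ _ _ _ _ X]eq_fun do rewrite big_ord0.
  split; try by rewrite mulr0 addr0.
  - by split; [move=> x; exact: is_derive_cst|exact: cont_cst].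
  - by split; [move=> x; exact: is_derive_cst|exact: cont_cst].
under eq_fun do rewrite big_ord_recr; under [X in robin_dom _ _ _ _ X _]eq_fun do rewrite big_ord_recr.
under [X in robin_dom _ _ _ _ _ X]eq_fun do rewrite big_ord_recr.
exact: domD.
Qed.

Definition fundamental c (C S : R -> R) := [/\ forall x : R, is_derive x 1 C (- (2 * c) * S x),
      forall x : R, is_derive x 1 S (C x), C 0 = 1, S 0 = 0 &
      forall x, C x ^+ 2 + 2 * c * S x ^+ 2 = 1].

Section apriori.
Variables (c : R) (C S : R -> R).
Hypothesis fCS : fundamental c C S.
(** The solution of - (1/2) v'' = c v with v(0) = 1 obeying the condition at 0;
[Delta] measures its failure to obey the condition at L, and vanishes exactly
at the eigenvalues. *)
Definition phi x := C x - alpha * S x.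
Definition dphi x := - (2 * c) * S x - alpha * C x.
Definition Delta := dphi L + beta * phi L.

Lemma fundC : continuous C. Proof. by case: fCS => dC _ _ _ _; exact: (deriv_continuous dC). Qed.
Lemma fundS : continuous S. Proof. by case: fCS => _ dS _ _ _; exact: (deriv_continuous dS). Qed.

Lemma phi_C1 : C1 phi dphi.
Proof.
case: fCS => dC dS _ _ _; split.
  by move=> x; apply: derB => //; exact: derZ.
by apply: contB; apply: contZ; [exact: fundS|exact: fundC].
Qed.

Lemma dphi_C1 : C1 dphi (fun x => - (2 * c) * phi x).
Proof.
case: fCS => dC dS _ _ _; split.
  move=> x; have /is_derive_eq := derB (derZ (- (2 * c)) (dS x)) (derZ alpha (dC x)).
  by apply; rewrite /phi; ring.
by apply: contZ; exact: C1_cont phi_C1.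
Qed.

Lemma phi0 : phi 0 = 1. Proof. by case: fCS => _ _ C0 S0 _; rewrite /phi C0 S0; ring. Qed.
Lemma dphi0 : dphi 0 = - alpha. Proof. by case: fCS => _ _ C0 S0 _; rewrite /dphi C0 S0; ring. Qed.

Lemma phi_dom : Delta = 0 -> dom phi dphi (fun x => - (2 * c) * phi x).
Proof.
move=> D0; split; [exact: phi_C1|exact: dphi_C1| |exact: D0].
by rewrite phi0 dphi0; ring.
Qed.

Lemma phi_norm_gt0 : 0 < dot phi phi.
Proof.
rewrite lt_def dot_ge0 andbT; apply/eqP => p0.
have := trace_ineq L0 phi_C1; move=> /(_ 0); rewrite lexx ltW// => /(_ isT).
by rewrite p0 sqrtr0 phi0 !mul0r mulr0 addr0 expr1n ler10.
Qed.

(** Variation of constants: v C - v' S and 2 c v S + v' C have derivatives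
2 s S and - 2 s C, and the Wronskian identity recovers v and v' from them. *)
Lemma duhamel v v1 v2 s : dom v v1 v2 -> (forall x, s x = - 2^-1 * v2 x - c * v x) ->
  forall x, 0 <= x <= L ->
  let p := \int[leb]_(z in `[0, x]) (s z * S z) in
  let q := \int[leb]_(z in `[0, x]) (s z * C z) in
  v x = v 0 * phi x + (2 * C x * p - 2 * S x * q) /\
  v1 x = v 0 * dphi x - (4 * c * S x * p + 2 * C x * q).
Proof.
move=> dv sE x /andP[x0 xL] p q; have [cv cv1 cv2] := dom_cont dv.
have [[Dv _] [Dv1 _] bv _] := dv.
have [dC dS C0 S0 CS] := fCS.
have cs : continuous s.
  rewrite (_ : s = fun x => - 2^-1 * v2 x - c * v x); last exact/funext.
  by apply: contB; apply: contZ.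
have E1 : v x * C x - v1 x * S x = v 0 + 2 * p.
  have d (z : R) : is_derive z 1 (fun z => v z * C z - v1 z * S z) (2 * (s z * S z)).
    have /is_derive_eq := derB (derM (Dv z) (dC z)) (derM (Dv1 z) (dS z)); apply.
    by rewrite sE; field.
  have cd : continuous (fun z => 2 * (s z * S z)).
    by apply: contZ; apply: contM => //; exact: fundS.
  have := FTC_global d cd x0; rewrite RintegralZl//; last first.
    by apply: continuous_integrable; apply: contM => //; exact: fundS.
  by rewrite -/p C0 S0; lra.
have E2 : 2 * c * (v x * S x) + v1 x * C x = v1 0 - 2 * q.
  have d (z : R) : is_derive z 1 (fun z => 2 * c * (v z * S z) + v1 z * C z) (- 2 * (s z * C z)).
    have /is_derive_eq := derD (derZ (2 * c) (derM (Dv z) (dS z))) (derM (Dv1 z) (dC z)); apply.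
    by rewrite sE; field.
  have cd : continuous (fun z => - 2 * (s z * C z)).
    by apply: contZ; apply: contM => //; exact: fundC.
  have := FTC_global d cd x0; rewrite RintegralZl//; last first.
    by apply: continuous_integrable; apply: contM => //; exact: fundC.
  by rewrite -/q C0 S0; lra.
have v10 : v1 0 = - (alpha * v 0) by lra.
rewrite v10 in E2.
split.
- transitivity (C x * (v x * C x - v1 x * S x) + S x * (2 * c * (v x * S x) + v1 x * C x)).
    have -> : C x * (v x * C x - v1 x * S x) + S x * (2 * c * (v x * S x) + v1 x * C x) =
      v x * (C x ^+ 2 + 2 * c * S x ^+ 2) by ring.
    by rewrite CS mulr1.
  by rewrite E1 E2 /phi; ring.
- transitivity (C x * (2 * c * (v x * S x) + v1 x * C x) - 2 * c * S x * (v x * C x - v1 x * S x)).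
    have -> : C x * (2 * c * (v x * S x) + v1 x * C x) - 2 * c * S x * (v x * C x - v1 x * S x) =
      v1 x * (C x ^+ 2 + 2 * c * S x ^+ 2) by ring.
    by rewrite CS mulr1.
  by rewrite E1 E2 /dphi; ring.
Qed.

(** By [duhamel], v - v(0) phi is bounded by ||s||, so only v(0) is in doubt.
If c is not an eigenvalue the condition at L determines it; if it is one, the
orthogonality to the eigenfunction phi does. *)
Lemma apriori : exists2 B, 0 <= B & forall v v1 v2 s, dom v v1 v2 ->
  (forall x, s x = - 2^-1 * v2 x - c * v x) ->
  (Delta = 0 -> dot v phi = 0) -> dot v v <= B * dot s s.
Proof.
have [MC MC0 HC] := cont_bound (ltW L0) fundC.
have [MS MS0 HS] := cont_bound (ltW L0) fundS.
have cphi : continuous phi by exact: C1_cont phi_C1.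
have [MP MP0 HP] := cont_bound (ltW L0) cphi.
pose KS := Num.sqrt (dot S S); pose KC := Num.sqrt (dot C C).
have KS0 : 0 <= KS by exact: sqrtr_ge0.
have KC0 : 0 <= KC by exact: sqrtr_ge0.
pose K1 := 2 * MC * KS + 2 * MS * KC.
pose K2 := 4 * `|c| * MS * KS + 2 * MC * KC.
have K10 : 0 <= K1 by rewrite addr_ge0// !mulr_ge0.
have K20 : 0 <= K2 by rewrite addr_ge0// !mulr_ge0.
pose nP := Num.sqrt (dot phi phi).
have nP0 : 0 <= nP by exact: sqrtr_ge0.
pose K0 := if Delta == 0 then Num.sqrt (L * K1 ^+ 2) * nP / dot phi phi
           else (K2 + `|beta| * K1) / `|Delta|.
have K00 : 0 <= K0.
  rewrite /K0; case: ifP => _.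
    by rewrite divr_ge0 ?dot_ge0// mulr_ge0// sqrtr_ge0.
  by rewrite divr_ge0// addr_ge0// mulr_ge0.
exists (L * (K0 * MP + K1) ^+ 2); first by rewrite mulr_ge0 ?sqr_ge0// ltW.
move=> v v1 v2 s dv sE orth.
have [cv cv1 cv2] := dom_cont dv.
have cs : continuous s.
  rewrite (_ : s = fun x => - 2^-1 * v2 x - c * v x); last exact/funext.
  by apply: contB; apply: contZ.
pose n := Num.sqrt (dot s s).
have n0 : 0 <= n by exact: sqrtr_ge0.
have n2 : n ^+ 2 = dot s s by rewrite sqr_sqrtr ?dot_ge0.
pose psi x := v x - v 0 * phi x.
have bp x : 0 <= x <= L -> `|\int[leb]_(z in `[0, x]) (s z * S z)| <= n * KS.
  by move=> /andP[x0 xL]; exact: partial_CS cs fundS _ _ _.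
have bq x : 0 <= x <= L -> `|\int[leb]_(z in `[0, x]) (s z * C z)| <= n * KC.
  by move=> /andP[x0 xL]; exact: partial_CS cs fundC _ _ _.
have bpsi x : 0 <= x <= L -> `|psi x| <= K1 * n.
  move=> xI; have [E _] := duhamel dv sE xI.
  rewrite /psi E addrC addrA [X in `|X + _|]addrC subrr add0r.
  apply: (le_trans (ler_normB _ _)).
  rewrite (_ : K1 * n = 2 * MC * (n * KS) + 2 * MS * (n * KC)); last by rewrite /K1; ring.
  rewrite lerD// normrM ler_pM// ?bp ?bq// normrM (@ger0_norm _ 2)// ler_pM2l// ?HC ?HS//.
have LL : 0 <= L <= L by rewrite lexx ltW.
have bpsi1 : `|v1 L - v 0 * dphi L| <= K2 * n.
  have [_ E] := duhamel dv sE LL.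
  rewrite E addrC addrA [X in `|X + _|]addrC subrr add0r normrN.
  apply: (le_trans (ler_normD _ _)).
  rewrite (_ : K2 * n = 4 * `|c| * MS * (n * KS) + 2 * MC * (n * KC)); last by rewrite /K2; ring.
  rewrite lerD// normrM ler_pM// ?bp ?bq//.
    rewrite !normrM (@ger0_norm _ 4)// ler_wpM2l ?mulr_ge0// HS//.
  by rewrite normrM (@ger0_norm _ 2)// ler_pM2l// ?HC.
have bv0 : `|v 0| <= K0 * n.
  rewrite /K0; case: ifPn => [/eqP D0|D0].
    have E : dot v phi = v 0 * dot phi phi + dot psi phi.
      by rewrite /psi dotBl ?dotZl//; [ring|exact: contZ].
    rewrite orth// in E.
    have E' : `|v 0| * dot phi phi <= Num.sqrt (L * K1 ^+ 2) * nP * n.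
      have -> : `|v 0| * dot phi phi = `|dot psi phi|.
        rewrite -[X in _ * X]ger0_norm ?dot_ge0// -normrM -normrN; congr `|_|; lra.
      have cpsi : continuous psi by apply: contB => //; exact: contZ.
      apply: (le_trans (dot_CS cpsi cphi)).
      rewrite -/nP mulrAC ler_wpM2r// -[leRHS]ger0_norm ?mulr_ge0 ?sqrtr_ge0//.
      rewrite -sqrtr_sqr ler_wsqrtr// exprMn sqr_sqrtr ?mulr_ge0 ?sqr_ge0 ?(ltW L0)//.
      rewrite -mulrA -exprMn; apply: continuous_ip_bound => //; exact: mulr_ge0.
    by rewrite mulrAC ler_pdivlMr ?phi_norm_gt0.
  have [_ _ _ vL] := dv.
  rewrite mulrAC ler_pdivlMr ?normr_gt0// -normrM.
  have -> : v 0 * Delta = - ((v1 L - v 0 * dphi L) + beta * psi L).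
    rewrite /Delta /psi; lra.
  rewrite normrN; apply: (le_trans (ler_normD _ _)).
  rewrite mulrDl lerD// normrM -mulrA ler_wpM2l// bpsi//.
rewrite -n2 -mulrA -exprMn; apply: continuous_ip_bound => //.
  by rewrite mulr_ge0// addr_ge0// mulr_ge0.
move=> x xI; have -> : v x = v 0 * phi x + psi x by rewrite /psi; ring.
apply: (le_trans (ler_normD _ _)).
rewrite mulrDl lerD ?bpsi// normrM mulrAC ler_pM// HP//.
Qed.

(** A particular solution by variation of constants obeys the condition at 0;
adding the multiple k of phi corrects the condition at L. *)
Lemma resolvent h : continuous h -> Delta != 0 ->
  exists v v1 v2, dom v v1 v2 /\ forall x, h x = - 2^-1 * v2 x - c * v x.
Proof.
move=> ch D0; have [dC dS C0 S0 CS] := fCS.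
have [P0 dP0] := primitive_exists (contM ch fundS).
have [Q0 dQ0] := primitive_exists (contM ch fundC).
pose P x := P0 x - P0 0; pose Q x := Q0 x - Q0 0.
have dP (x : R) : is_derive x 1 P (h x * S x).
  by have /is_derive_eq := derB (dP0 x) (is_derive_cst (P0 0) x 1); apply; rewrite subr0.
have dQ (x : R) : is_derive x 1 Q (h x * C x).
  by have /is_derive_eq := derB (dQ0 x) (is_derive_cst (Q0 0) x 1); apply; rewrite subr0.
pose psi x := 2 * (C x * P x) - 2 * (S x * Q x).
pose psi1 x := - (4 * c) * (S x * P x) - 2 * (C x * Q x).
have d1 (x : R) : is_derive x 1 psi (psi1 x).
  have /is_derive_eq := derB (derZ 2 (derM (dC x) (dP x))) (derZ 2 (derM (dS x) (dQ x))); apply.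
  by rewrite /psi1; ring.
have d2 (x : R) : is_derive x 1 psi1 (- (2 * c) * psi x - 2 * h x).
  have /is_derive_eq := derB (derZ (- (4 * c)) (derM (dS x) (dP x))) (derZ 2 (derM (dC x) (dQ x))); apply.
  transitivity (- (2 * c) * psi x - 2 * h x * (C x ^+ 2 + 2 * c * S x ^+ 2)).
    by rewrite /psi; ring.
  by rewrite CS mulr1.
have cpsi : continuous psi by exact: deriv_continuous d1.
pose k := - (psi1 L + beta * psi L) / Delta.
exists (fun x => k * phi x + psi x), (fun x => k * dphi x + psi1 x),
  (fun x => k * (- (2 * c) * phi x) + (- (2 * c) * psi x - 2 * h x)).
have cpsi1 : continuous psi1 by exact: deriv_continuous d2.
have P00 : P 0 = 0 by rewrite /P subrr.
have Q00 : Q 0 = 0 by rewrite /Q subrr.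
split; last by move=> x; field.
split.
- by apply: C1D; [apply: C1Z; exact: phi_C1|].
- apply: C1D; [apply: C1Z; exact: dphi_C1|split => //].
  by apply: contB; exact: contZ.
- by rewrite phi0 dphi0 /psi /psi1 P00 Q00; ring.
- have -> : k * dphi L + psi1 L + beta * (k * phi L + psi L) = k * Delta + (psi1 L + beta * psi L).
    by rewrite /Delta; ring.
  by rewrite /k; field.
Qed.

End apriori.

(** An eigenvalue below - c_0 / 2, where c_0 is [form_const], would contradict
[form_lower]. *)
Lemma Delta_neq0 c C S : fundamental (- c) C S -> form_const L alpha beta / 2 < c -> Delta (- c) C S != 0.
Proof.
move=> fCS cc; apply/eqP => D0.
have := form_lower L0 (phi_dom fCS D0).
have cp := C1_cont (phi_C1 fCS).
rewrite dotZl//; have := phi_norm_gt0 fCS.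
set n := dot _ _ => n0 H.
have : 2 * c * n <= form_const L alpha beta * n by lra.
by rewrite ler_pM2r//; lra.
Qed.

End robin_problem.

(** * Eigenfunctions as solutions on the whole line *)

Section eigenpair.
Context (R : realType) (L alpha beta : R).
Hypothesis L0 : 0 < L.
Implicit Types (f g h u v s : R -> R) (x y z c : R).

(** The hypothesis holds on the open interval only, as for the eigenfunctions,
about whose derivative nothing is assumed outside it. *)
Lemma cst_on_oo (a b : R) g : {in `]a, b[, forall x : R, is_derive x 1 g 0} ->
  {in `]a, b[ &, forall x y, g x = g y}.
Proof.
move=> dg x y xI yI; wlog xy : x y xI yI / x <= y.
  by move=> H; have [|/ltW] := leP x y => xy; [exact: H|apply/esym/H].
move: xy; rewrite le_eqVlt => /predU1P[->//|xy].
have sub z : z \in `[x, y] -> z \in `]a, b[.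
  move: xI yI; rewrite !in_itv/= => /andP[ax xb] /andP[ay yb] /andP[xz zy].
  by rewrite (lt_le_trans ax xz) (le_lt_trans zy yb).
have [z zI E] : exists2 z, z \in `]x, y[ & g y - g x = 0 * (y - x).
  apply: (@MVT _ g (fun=> 0)) => //.
    move=> z zI; apply: dg; apply: sub; exact: subset_itv_oo_cc.
  apply: derivable_within_continuous => z zI; have [] := dg z (sub z zI); done.
by apply/eqP; rewrite eq_sym -subr_eq0 E mul0r.
Qed.

(** On the open interval f C - f' S and 2 mu f S + f' C are constant; their
values are read off from the limits at 0, where the Robin condition ties f'
to f. Eigenfunctions thus extend to smooth functions on the line. *)
Lemma eigenpair_repr mu f C S : fundamental mu C S -> robin_eigenpair L alpha beta mu f ->
  (forall x, 0 <= x <= L -> f x = f 0 * phi alpha C S x) /\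
  Delta L alpha beta mu C S = 0.
Proof.
move=> fCS [[[df f0 fL] ddf] ode bc0 bcL [x0 x0I fx0]].
have [dC dS C0 S0 CS] := fCS.
have dfx x : x \in `]0, L[ -> is_derive x 1 f (derive1 f x).
  by move=> xI; apply: DeriveDef; [exact: df|rewrite derive1E].
have ddfx x : x \in `]0, L[ -> is_derive x 1 (derive1 f) (- (2 * mu) * f x).
  move=> xI; apply: DeriveDef; first exact: ddf.
  by rewrite -derive1E; have := ode x xI; lra.
pose W1 x := f x * C x - derive1 f x * S x.
pose W2 x := 2 * mu * (f x * S x) + derive1 f x * C x.
have dW1 : {in `]0, L[, forall x : R, is_derive x 1 W1 0}.
  move=> x xI.
  have /is_derive_eq := derB (derM (dfx x xI) (dC x)) (derM (ddfx x xI) (dS x)); apply; ring.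
have dW2 : {in `]0, L[, forall x : R, is_derive x 1 W2 0}.
  move=> x xI.
  have /is_derive_eq := derD (derZ (2 * mu) (derM (dfx x xI) (dS x))) (derM (ddfx x xI) (dC x)); apply; ring.
have cC : continuous C by exact: fundC fCS.
have cS : continuous S by exact: fundS fCS.
have f'0 : derive1 f x @[x --> 0^'+] --> - (alpha * f 0).
  have -> : - (alpha * f 0) = 0 - alpha * f 0 by rewrite sub0r.
  have : derive1 f x + alpha * f x - alpha * f x @[x --> 0^'+] --> 0 - alpha * f 0.
    apply: cvgB => //; apply: cvgM => //; exact: cvg_cst.
  by apply: cvg_trans; apply: near_eq_cvg; near=> x; rewrite addrK.
have cr g : continuous g -> g x @[x --> 0^'+] --> g 0 by move=> cg; apply: cvg_at_right_filter; exact: cg.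
have W10 : W1 x @[x --> 0^'+] --> f 0.
  rewrite (_ : f 0 = f 0 * C 0 - - (alpha * f 0) * S 0); last by rewrite C0 S0; ring.
  by apply: cvgB; apply: cvgM => //; exact: cr.
have W20 : W2 x @[x --> 0^'+] --> - (alpha * f 0).
  rewrite [X in _ --> X](_ : _ = 2 * mu * (f 0 * S 0) + - (alpha * f 0) * C 0); last by rewrite C0 S0; ring.
  by apply: cvgD; apply: cvgM => //; [exact: cvg_cst|apply: cvgM => //; exact: cr|exact: cr].
have oL : \forall x \near 0^'+, x \in `]0, L[.
  by near=> x; rewrite in_itv/=; apply/andP; split; near: x; [exact: nbhs_right_gt|exact: nbhs_right_lt].
have oL' : \forall x \near L^'-, x \in `]0, L[.
  by near=> x; rewrite in_itv/=; apply/andP; split; near: x; [exact: nbhs_left_gt|exact: nbhs_left_lt].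
have cstlim (W : R -> R) (l x : R) : {in `]0, L[, forall x : R, is_derive x 1 W 0} -> W x @[x --> 0^'+] --> l ->
    x \in `]0, L[ -> W x = l.
  move=> dW Wl xI; have Wc : W y @[y --> 0^'+] --> W x.
    have : (fun _ : R => W x) y @[y --> 0^'+] --> W x by exact: cvg_cst.
    apply: cvg_trans; apply: near_eq_cvg; near=> y.
    have yI : y \in `]0, L[ by near: y.
    exact: (cst_on_oo dW xI yI).
  exact: (cvg_unique _ Wc Wl).
have E1 x : x \in `]0, L[ -> f x = f 0 * phi alpha C S x.
  move=> xI; have w1 := cstlim _ _ _ dW1 W10 xI; have w2 := cstlim _ _ _ dW2 W20 xI.
  transitivity (C x * W1 x + S x * W2 x).
    transitivity (f x * (C x ^+ 2 + 2 * mu * S x ^+ 2)); first by rewrite CS mulr1.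
    by rewrite /W1 /W2; ring.
  by rewrite w1 w2 /phi; ring.
have E2 x : x \in `]0, L[ -> derive1 f x = f 0 * dphi alpha mu C S x.
  move=> xI; have w1 := cstlim _ _ _ dW1 W10 xI; have w2 := cstlim _ _ _ dW2 W20 xI.
  transitivity (C x * W2 x - 2 * mu * S x * W1 x).
    transitivity (derive1 f x * (C x ^+ 2 + 2 * mu * S x ^+ 2)); first by rewrite CS mulr1.
    by rewrite /W1 /W2; ring.
  by rewrite w1 w2 /dphi; ring.
have cphi : continuous (phi alpha C S) by exact: C1_cont (phi_C1 alpha fCS).
have cdphi : continuous (dphi alpha mu C S) by exact: C1_cont (dphi_C1 alpha fCS).
have cl g : continuous g -> g x @[x --> L^'-] --> g L by move=> cg; apply: cvg_at_left_filter; exact: cg.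
have EL : f L = f 0 * phi alpha C S L.
  apply: (cvg_unique _ fL) => //=.
  have : f 0 * phi alpha C S x @[x --> L^'-] --> f 0 * phi alpha C S L.
    by apply: cvgM; [exact: cvg_cst|exact: cl].
  by apply: cvg_trans; apply: near_eq_cvg; near=> x; apply/esym/E1; near: x.
have E0 x : 0 <= x <= L -> f x = f 0 * phi alpha C S x.
  move=> /andP[]; rewrite le_eqVlt => /predU1P[<- _|x0p]; first by rewrite (phi0 alpha fCS) mulr1.
  by rewrite le_eqVlt => /predU1P[->//|xL]; apply: E1; rewrite in_itv/= x0p.
split => //.
have f00 : f 0 != 0.
  apply: contra_neq fx0 => f00; move: x0I; rewrite in_itv/= => x0I.
  by rewrite (E0 x0 x0I) f00 mul0r.
have : f 0 * Delta L alpha beta mu C S = 0.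
  apply/esym/(cvg_unique _ bcL) => //=.
  have : f 0 * (dphi alpha mu C S x + beta * phi alpha C S x) @[x --> L^'-] --> f 0 * Delta L alpha beta mu C S.
    apply: cvgM; first exact: cvg_cst.
    by apply: cvgD; [exact: cl|apply: cvgM; [exact: cvg_cst|exact: cl]].
  apply: cvg_trans; apply: near_eq_cvg; near=> x.
  have xI : x \in `]0, L[ by near: x.
  by rewrite (E2 x xI) (E1 x xI); ring.
by move/eqP; rewrite mulf_eq0 (negbTE f00) => /eqP.
Unshelve. all: by end_near. Qed.

Lemma dom_derive1 v v1 : C1 v v1 -> derive1 v = v1.
Proof. by move=> [dv _]; apply/funext => x; rewrite derive1E; have [] := dv x. Qed.

Lemma dom_eigenpair mu v v1 : robin_dom L alpha beta v v1 (fun x => - (2 * mu) * v x) ->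
  (exists2 x, 0 <= x <= L & v x != 0) -> robin_eigenpair L alpha beta mu v.
Proof.
move=> [Cv Cv1 b0 bL] [x xI vx]; have E := dom_derive1 Cv; have E1 := dom_derive1 Cv1.
have [dv cv1] := Cv; have [dv1 _] := Cv1; have cv := C1_cont Cv.
split.
- split; last by rewrite E => y _; have [] := dv1 y.
  split; first by move=> y _; have [] := dv y.
    by apply: cvg_at_right_filter; exact: cv.
  by apply: cvg_at_left_filter; exact: cv.
- by move=> y _; rewrite E E1; field.
- rewrite E -[X in _ --> X]b0; apply: cvg_at_right_filter; apply: cvgD; first exact: cv1.
  by apply: cvgM; [exact: cvg_cst|exact: cv].
- rewrite E -[X in _ --> X]bL; apply: cvg_at_left_filter; apply: cvgD; first exact: cv1.
  by apply: cvgM; [exact: cvg_cst|exact: cv].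
- by exists x => //; rewrite in_itv.
Qed.

End eigenpair.

(** * A spectral bound on the complement of the first eigenfunctions *)

Section spectral.
Context (R : realType) (L alpha beta : R) (lam : nat -> R) (F F1 : nat -> R -> R).
Hypothesis L0 : 0 < L.
Local Notation leb := (@lebesgue_measure R).
Local Notation dot := (ip leb `[0, L]).
Local Notation dom := (robin_dom L alpha beta).
Local Notation c0 := (form_const L alpha beta).
Hypothesis HF : forall n, dom (F n) (F1 n) (fun x => - (2 * lam n) * F n x).
Hypothesis HO : forall m n, dot (F m) (F n) = (m == n)%:R.
Hypothesis Hlam : {homo lam : m n / (m <= n)%N >-> m <= n}.
Hypothesis Hspan : forall m g, robin_eigenpair L alpha beta m g ->
  exists (N : nat) (c : nat -> R), (forall n, (n < N)%N -> c n != 0 -> lam n = m) /\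
    {in `[0, L], forall x, g x = \sum_(n < N) c n * F n x}.
Implicit Types (f g h u v s : R -> R) (x y z c : R).
Local Hint Resolve mI : core.

(** With this shift the quadratic form of - (1/2) d^2/dx^2 + c_1 is at least
||v||^2, so that all shifted eigenvalues are at least 1. *)
Definition spectral_shift := c0 / 2 + 1.
Definition shifted_lam n := lam n + spectral_shift.
Local Notation c1 := spectral_shift.
Local Notation mu := shifted_lam.

(** v is the image of h under the inverse of the shifted operator. *)
Definition solves h v := exists v1 v2, dom v v1 v2 /\
  forall x, h x = - 2^-1 * v2 x + c1 * v x.

Lemma solves_cont h v : solves h v -> continuous h /\ continuous v.
Proof.
move=> [v1 [v2 [dv hE]]]; have [cv cv1 cv2] := dom_cont dv; split => //.
rewrite (_ : h = fun x => - 2^-1 * v2 x + c1 * v x); last exact/funext.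
by apply: contD; apply: contZ.
Qed.

Lemma solves_ex h : continuous h -> exists v, solves h v.
Proof.
move=> ch; have [C [S fCS]] := fundamental_system (- c1).
have D0 : Delta L alpha beta (- c1) C S != 0 by apply: Delta_neq0 => //; rewrite /c1; lra.
have [v [v1 [v2 [dv hE]]]] := resolvent fCS ch D0.
by exists v, v1, v2; split => // x; rewrite hE; ring.
Qed.

Lemma solves_sym h v g u : solves h v -> solves g u -> dot h u = dot v g.
Proof.
move=> Sv Su; have [ch cv] := solves_cont Sv; have [cg cu] := solves_cont Su.
move: Sv Su => [v1 [v2 [dv hE]]] [u1 [u2 [du gE]]].
have [_ _ cv2] := dom_cont dv; have [_ _ cu2] := dom_cont du.
rewrite (_ : h = fun x => - 2^-1 * v2 x + c1 * v x); last exact/funext.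
rewrite (_ : g = fun x => - 2^-1 * u2 x + c1 * u x); last exact/funext.
rewrite dotDl ?dotDr ?dotZl ?dotZr//; try exact: contZ.
by rewrite (green_sym L0 dv du).
Qed.

Lemma solves_coercive h v : solves h v -> dot v v <= dot h v.
Proof.
move=> Sv; have [ch cv] := solves_cont Sv.
move: Sv => [v1 [v2 [dv hE]]]; have [_ _ cv2] := dom_cont dv.
rewrite (_ : h = fun x => - 2^-1 * v2 x + c1 * v x); last exact/funext.
rewrite dotDl ?dotZl//; try exact: contZ.
have := form_lower L0 dv; rewrite /c1; lra.
Qed.

Lemma solves_eig n : solves (fun x => mu n * F n x) (F n).
Proof.
by exists (F1 n), (fun x => - (2 * lam n) * F n x); split => // x; rewrite /mu; field.
Qed.

Lemma F_cont n : continuous (F n). Proof. by have [] := dom_cont (HF n). Qed.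

Lemma solves_coef h v n : solves h v -> dot h (F n) = mu n * dot v (F n).
Proof.
move=> Sv; rewrite (solves_sym Sv (solves_eig n)) dotZr//; last by case: (solves_cont Sv).
exact: F_cont.
Qed.

Lemma mu_ge1 n : 1 <= mu n.
Proof.
have := solves_coercive (solves_eig n); rewrite dotZl; try exact: F_cont.
have := form_lower L0 (HF n); rewrite dotZl; try exact: F_cont.
rewrite HO eqxx /= /mu /c1; lra.
Qed.

Lemma mu_gt0 n : 0 < mu n. Proof. exact: lt_le_trans (mu_ge1 n). Qed.

(** Were the claim false, let g_k be the iterated images of h under the inverse
of the shifted operator A; they remain orthogonal to the first N
eigenfunctions. The ratios of consecutive squared norms have a supremum rho
larger than mu_N^(-2). Put m = rho^(-1/2) < mu_N. Then w = g_(k+1) + m g_(k+2)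
satisfies (A - m) w = g_k - m^2 g_(k+2), and since every eigenfunction of A at
the level m is a combination of the first N ones, w is orthogonal to it, so
[apriori] bounds w by the right-hand side. This forces every ratio below
(1 - 1/B') rho, which contradicts the choice of rho. *)
Lemma minmax N h v : solves h v -> (forall n, (n < N)%N -> dot v (F n) = 0) ->
  mu N ^+ 2 * dot v v <= dot h h.
Proof.
move=> Sv orth; rewrite leNgt; apply/negP => contra.
pose K f := xget (fun=> 0) [set w | solves f w].
have KP f : continuous f -> solves f (K f).
  by move=> cf; have [w fw] := solves_ex cf; exact: (@xgetI _ _ _ w).
pose g k := if k is k'.+1 then iter k' K v else h.
have Sg k : solves (g k) (g k.+1).
  elim: k => [//|k IH]; rewrite [g k.+2]/(K (g k.+1)).
  by apply: KP; case: (solves_cont IH).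
have cg k : continuous (g k) by case: (solves_cont (Sg k)).
have gorth k n : (n < N)%N -> dot (g k) (F n) = 0.
  move=> nN; elim: k => [|k IH]; first by rewrite (solves_coef n Sv) orth// mulr0.
  move: IH; rewrite (solves_coef n (Sg k)) => /eqP; rewrite mulf_eq0.
  by rewrite gt_eqF ?mu_gt0//= => /eqP.
pose b k := dot (g k) (g k).
have b2 k : dot (g k) (g k.+2) = b k.+1 by rewrite (solves_sym (Sg k) (Sg k.+1)).
have bco k : b k.+1 <= dot (g k) (g k.+1) by exact: solves_coercive.
have CS i j : dot (g i) (g j) ^+ 2 <= b i * b j by apply: ip_CS => //; exact: cL2.
have b0 k : 0 <= b k by exact: dot_ge0.
have bp : forall k, 0 < b k.
  have b1 : 0 < b 1%N.
    rewrite lt_def b0 andbT; apply/eqP => b10.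
    by move: contra; rewrite -/(b 1%N) b10 mulr0 ltNge dot_ge0.
  elim => [|[_|k IH]]; last 2 first.
  - exact: b1.
  - rewrite lt_def b0 andbT; apply/eqP => bk.
    have := CS k k.+2; rewrite b2 bk mulr0 => H.
    have : 0 < b k.+1 ^+ 2 by rewrite exprn_gt0.
    by rewrite ltNge H.
  rewrite lt_def b0 andbT; apply/eqP => bk.
  have := CS 0%N 2%N; rewrite b2 bk mul0r => H.
  have : 0 < b 1%N ^+ 2 by rewrite exprn_gt0.
  by rewrite ltNge H.
pose r k := b k.+1 / b k.
have r_le1 k : r k <= 1.
  rewrite ler_pdivrMr// mul1r -(ler_pM2r (bp k.+1)).
  apply: le_trans (CS k k.+1); rewrite -expr2 lerXn2r// ?nnegrE//.
  exact: le_trans (b0 _) (bco k).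
have hs : has_sup (range r).
  by split; [exists (r 0%N); exists 0%N|exists 1 => _ [k _ <-]].
pose rho := sup (range r).
have r_le k : r k <= rho by apply: ub_le_sup; [exact: hs.2|exists k].
have muN2 : 0 < mu N ^+ 2 by rewrite exprn_gt0// mu_gt0.
have rho_gt : (mu N ^+ 2)^-1 < rho.
  apply: lt_le_trans (r_le 0%N); rewrite ltr_pdivlMr// -(ltr_pM2l muN2) mulrA.
  by rewrite divff ?gt_eqF// mul1r.
have rho0 : 0 < rho by apply: lt_trans rho_gt; rewrite invr_gt0.
(* Heuristically 1 / m is the norm of the inverse on the complement of the
   first N eigenfunctions, so that m should be an eigenvalue. *)
pose m := (Num.sqrt rho)^-1.
have m0 : 0 < m by rewrite invr_gt0 sqrtr_gt0.
have m2 : m ^+ 2 = rho^-1 by rewrite exprVn sqr_sqrtr// ltW.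
have mlt : m < mu N.
  rewrite -(@ltr_pXn2r _ 2)// ?nnegrE ?(ltW m0) ?(ltW (mu_gt0 N))//.
  by rewrite m2 -[ltRHS]invrK ltf_pV2// posrE invr_gt0.
pose c := m - c1.
have clt : c < lam N by rewrite /c ltrBlDr.
have [C [S fCS]] := fundamental_system c.
have [B B0 HB] := apriori alpha beta L0 fCS.
have key k : b k <= (2 + 2 * m ^+ 2 * B) * (b k - m ^+ 2 * b k.+1).
  have [v1 [v2 [dv vE]]] := Sg k; have [u1 [u2 [du uE]]] := Sg k.+1.
  have dw := domD dv (domZ m du).
  pose w x := g k.+1 x + m * g k.+2 x.
  pose s x := g k x - m ^+ 2 * g k.+2 x.
  have cw : continuous w by apply: contD => //; exact: contZ.
  have cs : continuous s by apply: contB => //; exact: contZ.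
  have sE x : s x = - 2^-1 * (v2 x + m * u2 x) - c * w x.
    have -> : - 2^-1 * (v2 x + m * u2 x) - c * w x =
      (- 2^-1 * v2 x + c1 * g k.+1 x) + m * (- 2^-1 * u2 x + c1 * g k.+2 x) - m * w x.
      by rewrite /w /c; ring.
    by rewrite -vE -uE /s /w; ring.
  have worth n : (n < N)%N -> dot w (F n) = 0.
    move=> nN; rewrite /w dotDl ?dotZl//; try exact: F_cont; try exact: contZ.
    by rewrite !gorth// mulr0 addr0.
  have ws : dot w w <= B * dot s s.
    apply: (HB _ _ _ _ dw sE) => D0.
    have ep : robin_eigenpair L alpha beta c (phi alpha C S).
      apply: (dom_eigenpair (phi_dom fCS D0)); exists 0; first by rewrite lexx ltW.
      by rewrite (phi0 alpha fCS) oner_neq0.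
    have [M [k0 [k0E phiE]]] := Hspan ep.
    have cF n : continuous (fun x => k0 n * F n x) by apply: contZ; exact: F_cont.
    transitivity (dot w (fun x => \sum_(n < M) k0 n * F n x)).
      by apply: eq_ip => x xI //; rewrite phiE//; move: xI; rewrite inE.
    rewrite dotC (@dot_suml _ L M (fun n x => k0 n * F n x))//; apply: big1 => n _.
    rewrite dotZl//; last exact: F_cont.
    have [->|kn] := eqVneq (k0 n) 0; first by rewrite mul0r.
    rewrite dotC worth ?mulr0//.
    rewrite ltnNge; apply/negP => Nn; have := Hlam Nn.
    by rewrite (k0E n) ?ltn_ord// leNgt clt.
  have E1 : dot (fun x => s x + m * w x) (fun x => s x + m * w x) =
      b k + 2 * m * dot (g k) (g k.+1) + m ^+ 2 * b k.+1.
    rewrite (_ : (fun x => s x + m * w x) = fun x => g k x + m * g k.+1 x); last first.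
      by apply/funext => x; rewrite /s /w; ring.
    rewrite dotDl ?dotDr ?dotZl ?dotZr//; try exact: contZ; try (apply: contD => //; exact: contZ).
    by rewrite (dotC _ (g k.+1) (g k)) /b; ring.
  have E2 : dot s s = b k - 2 * m ^+ 2 * b k.+1 + m ^+ 2 * m ^+ 2 * b k.+2.
    rewrite /s dotBl ?dotBr ?dotZl ?dotZr//; try exact: contZ; try (apply: contB => //; exact: contZ).
    by rewrite (dotC _ (g k.+2) (g k)) b2 /b; ring.
  have E3 : dot (fun x => s x + m * w x) (fun x => s x + m * w x) <=
     2 * dot s s + 2 * (m ^+ 2 * dot w w).
    apply: (le_trans (dot_sqD L cs (contZ (k := m) cw))).
    by rewrite dotZl ?dotZr//; [lra|exact: contZ].
  (* The ratio b_(k+2) / b_(k+1) is at most rho = m^(-2). *)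
  have E4 : dot s s <= b k - m ^+ 2 * b k.+1.
    have : m ^+ 2 * b k.+2 <= b k.+1.
      by rewrite m2 mulrC ler_pdivrMr// mulrC -ler_pdivrMr// r_le.
    move=> H; have := ler_wpM2l (sqr_ge0 m) H; rewrite E2; lra.
  have m20 : 0 <= m ^+ 2 by exact: sqr_ge0.
  have E5 : b k <= 2 * dot s s + 2 * (m ^+ 2 * (B * dot s s)).
    have H1 : 0 <= 2 * m * dot (g k) (g k.+1).
      by rewrite mulr_ge0 ?mulr_ge0 ?(ltW m0)//; exact: le_trans (b0 _) (bco k).
    have H2 : 0 <= m ^+ 2 * b k.+1 by rewrite mulr_ge0.
    have H3 := ler_wpM2l m20 ws.
    rewrite E1 in E3; lra.
  apply: (le_trans E5).
  have -> : 2 * dot s s + 2 * (m ^+ 2 * (B * dot s s)) = (2 + 2 * m ^+ 2 * B) * dot s s by ring.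
  by rewrite ler_wpM2l// addr_ge0// mulr_ge0// mulr_ge0.
set B' := 2 + _ in key.
have B'0 : 0 < B' by have := mulr_ge0 (sqr_ge0 m) B0; rewrite /B'; lra.
have : rho <= (1 - B'^-1) * rho.
  apply: ge_sup; first by exists (r 0%N); exists 0%N.
  move=> _ [k _ <-]; rewrite ler_pdivrMr//.
  have H : B'^-1 * b k <= b k - rho^-1 * b k.+1 by rewrite ler_pdivrMl// -m2; exact: key.
  have : rho * (B'^-1 * b k) <= rho * (b k - rho^-1 * b k.+1) by rewrite ler_pM2l.
  rewrite mulrBr [rho * (rho^-1 * _)]mulrA divff ?gt_eqF// mul1r; lra.
have H : 0 < B'^-1 * rho by rewrite mulr_gt0// invr_gt0.
lra.
Qed.

End spectral.

(** * Eigenvalue growth, eigenfunction bounds and pointwise expansions *)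

Section spectral_estimates.
Context (R : realType) (L alpha beta : R) (lam : nat -> R) (F F1 : nat -> R -> R).
Hypothesis L0 : 0 < L.
Local Notation leb := (@lebesgue_measure R).
Local Notation dot := (ip leb `[0, L]).
Local Notation dom := (robin_dom L alpha beta).
Local Notation c0 := (form_const L alpha beta).
Local Notation c1 := (spectral_shift L alpha beta).
Local Notation mu := (shifted_lam L alpha beta lam).
Local Notation solves := (solves L alpha beta).
Hypothesis HF : forall n, dom (F n) (F1 n) (fun x => - (2 * lam n) * F n x).
Hypothesis HO : forall m n, dot (F m) (F n) = (m == n)%:R.
Hypothesis Hlam : {homo lam : m n / (m <= n)%N >-> m <= n}.
Implicit Types (f g h u v s : R -> R) (x y z c : R).
Local Hint Resolve mI : core.

Let cF n : continuous (F n). Proof. exact: (F_cont HF). Qed.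
Let c0_ge0' : 0 <= c0. Proof. exact: form_const_ge0. Qed.

Lemma dot_comb n (a b : nat -> R) :
  dot (fun x => \sum_(i < n) a i * F i x) (fun x => \sum_(i < n) b i * F i x) =
  \sum_(i < n) a i * b i.
Proof.
have ca (c : nat -> R) i : continuous (fun x => c i * F i x) by apply: contZ.
rewrite (@dot_suml _ L n (fun i x => a i * F i x))//; last first.
  by apply: (@cont_sum _ n (fun i x => b i * F i x)).
apply: eq_bigr => i _; rewrite dotC (@dot_suml _ L n (fun i x => b i * F i x))//.
rewrite (bigD1 i)//= big1 => [|j ji].
  by rewrite dotZl ?dotZr// HO eqxx /=; ring.
rewrite dotZl ?dotZr// HO (_ : (nat_of_ord j == i) = false) /=; first by ring.
by apply/negbTE; rewrite (inj_eq val_inj).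
Qed.

Lemma dot_comb1 n (a : nat -> R) f : continuous f ->
  dot f (fun x => \sum_(i < n) a i * F i x) = \sum_(i < n) a i * dot f (F i).
Proof.
move=> cf; have ca (c : nat -> R) i : continuous (fun x => c i * F i x) by apply: contZ.
rewrite dotC (@dot_suml _ L n (fun i x => a i * F i x))//.
by apply: eq_bigr => i _; rewrite dotZl// dotC.
Qed.

Lemma mu_ge1' n : 1 <= mu n. Proof. exact: mu_ge1 L0 HF HO n. Qed.

Definition grad_const := 4 + 2 * c0.
Definition local_weyl_const := 1 / L + 2 * grad_const.

(** The function g = sum_i F_i(x) F_i is the projection of the Dirac mass at x:
g(x) = ||g||^2 is the sum to be bounded, call it S. Its energy is at most of
the order mu_n S, and the trace inequality gives S^2 <= C sqrt(mu_n) S. *)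
Lemma local_weyl n x : 0 <= x <= L ->
  \sum_(i < n) F i x ^+ 2 <= local_weyl_const * Num.sqrt (mu n).
Proof.
move=> xI.
set S := \sum_(i < n) _.
pose g z := \sum_(i < n) F i x * F i z.
have dg := dom_sum n (fun i => domZ (F i x) (HF i)).
have [Cg _ _ _] := dg.
have gg : dot g g = S.
  by rewrite /g (@dot_comb n (fun i => F i x) (fun i => F i x)); apply: eq_bigr => i _; rewrite expr2.
have gx : g x = S by apply: eq_bigr => i _; rewrite expr2.
have S0 : 0 <= S by apply: sumr_ge0 => i _; exact: sqr_ge0.
have g2 : - dot (fun z => \sum_(i < n) F i x * (- (2 * lam i) * F i z)) g <= 2 * mu n * S.
  rewrite (_ : (fun z => _) = fun z => \sum_(i < n) (- (2 * lam i) * F i x) * F i z); last first.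
    by apply/funext => z; apply: eq_bigr => i _; ring.
  rewrite /g (@dot_comb n (fun i => - (2 * lam i) * F i x) (fun i => F i x)).
  rewrite -sumrN mulr_sumr; apply: ler_sum => i _.
  have -> : - (- (2 * lam i) * F i x * F i x) = 2 * lam i * F i x ^+ 2 by ring.
  rewrite ler_wpM2r ?sqr_ge0// ler_pM2l//.
  apply: (@le_trans _ _ (lam n)); first by apply: Hlam; exact: ltnW.
  by have c00 := c0_ge0'; rewrite /shifted_lam /spectral_shift lerDl; lra.
have := form_bound L0 dg; rewrite -/g gg.
set y := dot _ _ => Hy.
have m1 := mu_ge1' n.
have y_le : y <= grad_const * mu n * S.
  have : c0 * S <= c0 * mu n * S by rewrite ler_wpM2r// ler_peMr.
  by rewrite /grad_const; lra.
have := trace_ineq L0 Cg xI; rewrite -/(g x) -/g gx gg -/y => HT.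
have K4 : 1 <= grad_const by have c00 := c0_ge0'; rewrite /grad_const; lra.
have Hs : Num.sqrt S * Num.sqrt y <= grad_const * Num.sqrt (mu n) * S.
  have -> : grad_const * Num.sqrt (mu n) * S = Num.sqrt S * (grad_const * Num.sqrt (mu n) * Num.sqrt S).
    by rewrite -[in LHS](sqr_sqrtr S0); ring.
  rewrite ler_wpM2l ?sqrtr_ge0//.
  have -> : grad_const * Num.sqrt (mu n) * Num.sqrt S = Num.sqrt (grad_const ^+ 2 * mu n * S).
    have Kw0 : 0 <= grad_const by lra.
    have mu0 : 0 <= mu n by lra.
    by rewrite sqrtrM ?mulr_ge0 ?sqr_ge0// sqrtrM ?sqr_ge0// sqrtr_sqr ger0_norm.
  rewrite ler_wsqrtr//; apply: (le_trans y_le).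
  rewrite ler_wpM2r// ler_wpM2r//; first lra.
  by rewrite expr2 ler_peMr//; lra.
have [S00|Sn] := eqVneq S 0.
  rewrite S00 mulr_ge0 ?sqrtr_ge0// /local_weyl_const addr_ge0 ?divr_ge0 ?(ltW L0)//; lra.
have Sp : 0 < S by rewrite lt_def Sn.
rewrite -(ler_pM2r Sp) -expr2; apply: (le_trans HT).
have s1 : 1 <= Num.sqrt (mu n) by rewrite -[leLHS]sqrtr1 ler_wsqrtr.
have : S / L <= 1 / L * Num.sqrt (mu n) * S.
  rewrite mul1r (mulrC S) ler_wpM2r// ler_peMr// invr_ge0 ltW//.
by rewrite /local_weyl_const; lra.
Qed.

(** The constant that results from integrating [local_weyl] over the interval,
where the sum integrates to n; the factor 4 pays for replacing n by n + 1 and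
the minimum with 1 for the index 0. *)
Definition weyl_const := Num.min 1 (1 / (L * local_weyl_const) ^+ 2) / 4.

Lemma local_weyl_const_gt0 : 0 < local_weyl_const.
Proof. by rewrite /local_weyl_const ltr_wpDl ?divr_ge0 ?(ltW L0)// /grad_const; have := c0_ge0'; lra. Qed.

Lemma weyl_const_gt0 : 0 < weyl_const.
Proof.
by rewrite divr_gt0// lt_min ltr01 divr_gt0// exprn_gt0// mulr_gt0// local_weyl_const_gt0.
Qed.

Lemma weyl n : weyl_const * n.+1%:R ^+ 2 <= mu n.
Proof.
have K0 := local_weyl_const_gt0; have m1 := mu_ge1' n.
case: n m1 => [|n] m1.
  rewrite expr1n mulr1; apply: le_trans m1; rewrite ler_pdivrMr// mul1r.
  by apply: (@le_trans _ _ 1); [rewrite ge_min lexx|lra].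
set N := n.+1 in m1 *.
have HN : N%:R <= L * local_weyl_const * Num.sqrt (mu N).
  have csum : continuous (fun x => \sum_(i < N) F i x * F i x).
    by apply: (@cont_sum _ N (fun i x => F i x * F i x)) => i; exact: contM.
  have : \int[leb]_(x in `[0, L]) (\sum_(i < N) F i x * F i x) <=
     \int[leb]_(x in `[0, L]) (local_weyl_const * Num.sqrt (mu N)).
    apply: le_Rintegral => //.
    - exact: continuous_integrable.
    - by apply: continuous_integrable; exact: cont_cst.
    - move=> x /=; rewrite in_itv/= => xI; apply: le_trans (local_weyl N xI).
      by apply: ler_sum => i _; rewrite expr2.
  rewrite Rintegral_cst//= lebesgue_measure_itv/= lte_fin L0 oppr0 addr0/=.
  rewrite (_ : \int[leb]_(x in _) _ = N%:R); first by rewrite mulrC mulrA.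
  transitivity (dot (fun x => \sum_(i < N) F i x * F i x) (cst 1)).
    by apply: eq_Rintegral => x _; rewrite mulr1.
  rewrite (@dot_suml _ L N (fun i x => F i x * F i x))//; last 2 first.
  - by move=> i; exact: contM.
  - exact: cont_cst.
  rewrite (eq_bigr (fun=> 1)) => [|i _]; first by rewrite sumr_const card_ord.
  transitivity (dot (F i) (F i)); last by rewrite HO eqxx.
  by apply: eq_Rintegral => x _; rewrite mulr1.
have E : N%:R ^+ 2 <= (L * local_weyl_const) ^+ 2 * mu N.
  rewrite -[X in _ * X](@sqr_sqrtr _ (mu N)); last lra.
  by rewrite -exprMn lerXn2r ?nnegrE ?mulr_ge0 ?sqrtr_ge0 ?(ltW L0) ?(ltW K0).
have p0 : 0 < (L * local_weyl_const) ^+ 2 by rewrite exprn_gt0// mulr_gt0.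
have nn : (N.+1%:R : R) ^+ 2 <= 4 * N%:R ^+ 2.
  rewrite (_ : 4 * N%:R ^+ 2 = (2 * N%:R) ^+ 2 :> R); last by rewrite exprMn; ring.
  by rewrite lerXn2r ?nnegrE ?mulr_ge0// -natrM ler_nat mul2n -addnn /N addSn ltnS leq_addl.
apply: (@le_trans _ _ (1 / (L * local_weyl_const) ^+ 2 / 4 * (4 * N%:R ^+ 2))).
  apply: ler_pM => //.
    by rewrite ltW// weyl_const_gt0.
  by rewrite /weyl_const ler_pM2r// ge_min lexx orbT.
have -> : 1 / (L * local_weyl_const) ^+ 2 / 4 * (4 * N%:R ^+ 2) = N%:R ^+ 2 / (L * local_weyl_const) ^+ 2.
  by field; rewrite !gt_eqF.
by rewrite ler_pdivrMr// mulrC.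
Qed.

(** The energy F_n'^2 + 2 lambda_n F_n^2 is constant on the interval, and its
mean is at most of the order mu_n. This bounds F_n'^2, and F_n^2 as soon as
lambda_n is comparable with mu_n; otherwise mu_n is bounded and the trace
inequality suffices. *)
Lemma eigenfunction_bounds : exists2 K, 0 < K &
  forall n x, 0 <= x <= L -> F n x ^+ 2 <= K /\ F1 n x ^+ 2 <= K * mu n.
Proof.
pose K3 := (6 + 2 * c0) / L.
pose K4 := 1 / L + 8 + 4 * c0.
have K30 : 0 <= K3 by rewrite divr_ge0 ?(ltW L0)//; have := c0_ge0'; lra.
have L1 : 0 < 1 / L by rewrite divr_gt0.
have K40 : 0 <= K4 by rewrite /K4; have := c0_ge0'; lra.
have c10 : 0 <= c1 by rewrite /spectral_shift; have := c0_ge0'; lra.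
have cK : 0 <= c1 * K4 by rewrite mulr_ge0.
have main n x : 0 <= x <= L -> F n x ^+ 2 <= K3 + 2 * c1 * K4 /\
   F1 n x ^+ 2 <= (K3 + 2 * c1 * K4) * mu n.
  move=> xI; have [CF CF1 _ _] := HF n; have [dF cF1] := CF; have [dF1 _] := CF1.
  have m1 := mu_ge1' n.
  pose E z := F1 n z ^+ 2 + 2 * lam n * F n z ^+ 2.
  have dE (z : R) : is_derive z 1 E 0.
    by have /is_derive_eq := derD (derX2 (dF1 z)) (derZ (2 * lam n) (derX2 (dF z))); apply; ring.
  have Ec z : E z = E x by exact: is_derive0_cst.
  have fb := form_bound L0 (HF n); rewrite dotZl// HO eqxx/= in fb.
  have lm : lam n = mu n - c1 by rewrite /shifted_lam; ring.
  have LE : L * E x = dot (F1 n) (F1 n) + 2 * lam n.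
    transitivity (\int[leb]_(z in `[0, L]) E z).
      under eq_Rintegral do rewrite Ec.
      by rewrite Rintegral_cst//= lebesgue_measure_itv/= lte_fin L0 oppr0 addr0/= mulrC.
    rewrite /E RintegralD//; last 2 first.
    - by apply: continuous_integrable; apply: contM.
    - by apply: continuous_integrable; apply: contZ; apply: contM.
    congr (_ + _).
    rewrite RintegralZl//; last by apply: continuous_integrable; apply: contM.
    by have := HO n n; rewrite eqxx /ip => ->; rewrite mulr1.
  have EK : E x <= K3 * mu n.
    rewrite /K3 mulrAC ler_pdivlMr// mulrC LE.
    have : c0 <= c0 * mu n by rewrite ler_peMr.
    move: fb; rewrite lm /spectral_shift; have := c0_ge0'; lra.
  have F4 : F n x ^+ 2 <= K4 * mu n.
    apply: (le_trans (trace_ineq L0 CF xI)); rewrite HO eqxx/= sqrtr1 mul1r.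
    have : Num.sqrt (dot (F1 n) (F1 n)) <= (4 + 2 * c0) * mu n.
      have z1 : 1 <= (4 + 2 * c0) * mu n.
        have : c0 <= c0 * mu n by rewrite ler_peMr.
        have := c0_ge0'; lra.
      rewrite -[leRHS]ger0_norm ?(le_trans ler01)// -sqrtr_sqr ler_wsqrtr//.
      apply: (@le_trans _ _ ((4 + 2 * c0) * mu n)); last by rewrite expr2 ler_peMr// (le_trans ler01).
      have : c0 <= c0 * mu n by rewrite ler_peMr.
      move: fb; rewrite lm /spectral_shift; have := c0_ge0'; lra.
    have : 1 / L <= 1 / L * mu n by rewrite ler_peMr// ltW.
    by rewrite /K4; lra.
  have F5 : F n x ^+ 2 <= K3 + 2 * c1 * K4.
    have [big|small] := leP (2 * c1) (mu n); last first.
      apply: (le_trans F4); have : K4 * mu n <= K4 * (2 * c1) by rewrite ler_wpM2l// ltW.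
      lra.
    have : F n x ^+ 2 * mu n <= K3 * mu n.
      apply: le_trans EK; rewrite /E.
      have : mu n * F n x ^+ 2 <= 2 * lam n * F n x ^+ 2.
        by rewrite ler_wpM2r ?sqr_ge0// lm; lra.
      have := sqr_ge0 (F1 n x); lra.
    rewrite ler_pM2r; lra.
  split => //.
  have -> : F1 n x ^+ 2 = E x - 2 * (mu n - c1) * F n x ^+ 2 by rewrite /E lm; ring.
  have : 2 * c1 * F n x ^+ 2 <= 2 * c1 * (K4 * mu n) by rewrite ler_wpM2l// mulr_ge0.
  have : 0 <= mu n * F n x ^+ 2 by rewrite mulr_ge0 ?sqr_ge0//; lra.
  lra.
exists (K3 + 2 * c1 * K4 + 1); first by have := cK; lra.
move=> n x xI; have [A B] := main n x xI; split; first lra.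
by have := mu_ge1' n; lra.
Qed.

Lemma eigenfunction_lipschitz K : (forall n x, 0 <= x <= L -> F n x ^+ 2 <= K /\ F1 n x ^+ 2 <= K * mu n) ->
  forall n x y, 0 <= x <= L -> 0 <= y <= L -> (F n x - F n y) ^+ 2 <= K * mu n * (x - y) ^+ 2.
Proof.
move=> HK n; have [[dF cF1] _ _ _] := HF n.
have H x y : 0 <= x <= L -> 0 <= y <= L -> x <= y -> (F n y - F n x) ^+ 2 <= K * mu n * (y - x) ^+ 2.
  move=> /andP[x0 xL] /andP[y0 yL] xy.
  have [z zI ->] := @MVT_segment _ (F n) (F1 n) x y xy (fun z _ => dF z)
    (continuous_subspaceT (@cF n)).
  rewrite exprMn ler_wpM2r ?sqr_ge0//.
  move: zI; rewrite in_itv/= => /andP[xz zy].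
  by have [] := HK n z; rewrite // (le_trans x0 xz) (le_trans zy yL).
move=> x y xI yI; have [xy|/ltW yx] := leP x y; last exact: H.
by rewrite -sqrrN opprB -[(x - y) ^+ 2]sqrrN opprB; exact: H.
Qed.

Hypothesis Hspan : forall m g, robin_eigenpair L alpha beta m g ->
  exists (N : nat) (c : nat -> R), (forall n, (n < N)%N -> c n != 0 -> lam n = m) /\
    {in `[0, L], forall x, g x = \sum_(n < N) c n * F n x}.

Let half_form_bound (a b c k : R) :
  0 <= k -> b = - 2^-1 * a + k -> b <= c -> - 2 * a <= 4 * c.
Proof. by lra. Qed.

(** The remainder r_N is the image under the inverse of the shifted operator of
the remainder of h = A X, which stays bounded by Bessel's inequality. By
[minmax] the norm of r_N is of the order 1 / mu_N, and its energy is at most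
||h|| ||r_N||, so that the trace inequality turns this into convergence at
each point. *)
Lemma expansion X X1 X2 x : dom X X1 X2 -> 0 <= x <= L ->
  \sum_(n < N) dot X (F n) * F n x @[N --> \oo] --> X x.
Proof.
move=> dX xI; have [cX cX1 cX2] := dom_cont dX.
pose h z := - 2^-1 * X2 z + c1 * X z.
have Sh : solves h X by exists X1, X2; split.
have [ch _] := solves_cont Sh.
pose r N z := X z - \sum_(n < N) dot X (F n) * F n z.
pose hN N z := h z - \sum_(n < N) dot h (F n) * F n z.
have csum (a : nat -> R) N : continuous (fun z => \sum_(n < N) a n * F n z).
  by apply: (@cont_sum _ N (fun i z => a i * F i z)) => i; exact: contZ.
have dr N := domD dX (domZ (-1) (dom_sum N (fun i => domZ (dot X (F i)) (HF i)))).
have rE N : (fun z => X z + -1 * \sum_(i < N) dot X (F i) * F i z) = r N.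
  by apply/funext => z; rewrite mulN1r.
have cr N : continuous (r N) by apply: contB => //; exact: (csum (fun n => dot X (F n))).
have chN N : continuous (hN N) by apply: contB => //; exact: (csum (fun n => dot h (F n))).
have hrE N z : hN N z = - 2^-1 * (X2 z + -1 * \sum_(i < N) dot X (F i) * (- (2 * lam i) * F i z)) + c1 * r N z.
  rewrite /hN /r /h.
  have -> : \sum_(n < N) dot h (F n) * F n z =
      - 2^-1 * \sum_(i < N) dot X (F i) * (- (2 * lam i) * F i z) +
      c1 * \sum_(i < N) dot X (F i) * F i z.
    rewrite !mulr_sumr -big_split/=; apply: eq_bigr => i _.
    by rewrite (solves_coef L0 HF i Sh) /shifted_lam; field.
  by ring.
have Sr N : solves (hN N) (r N).
  exists (fun z => X1 z + -1 * \sum_(i < N) dot X (F i) * F1 i z),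
    (fun z => X2 z + -1 * \sum_(i < N) dot X (F i) * (- (2 * lam i) * F i z)).
  by split; [rewrite -rE; exact: dr|exact: hrE].
have orth N n : (n < N)%N -> dot (r N) (F n) = 0.
  move=> nN.
  have -> : dot (r N) (F n) = dot X (F n) - dot (F n) (fun z => \sum_(i < N) dot X (F i) * F i z).
    by rewrite (dotC _ (F n)); apply: dotBl => //; exact: (csum (fun n => dot X (F n))).
  rewrite (@dot_comb1 N (fun i => dot X (F i)))//.
  rewrite (bigD1 (Ordinal nN))//= big1 => [|j jn].
    by rewrite HO eqxx addr0 /= mulr1 subrr.
  by rewrite HO eq_sym (_ : (nat_of_ord j == n) = false) ?mulr0//; apply/negbTE.
pose H := dot h h.
have H0 : 0 <= H by exact: dot_ge0.
have bessel N : dot (hN N) (hN N) <= H.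
  pose p z := \sum_(i < N) dot h (F i) * F i z.
  have cp : continuous p by exact: (csum (fun n => dot h (F n))).
  have pp : dot p p = \sum_(i < N) dot h (F i) * dot h (F i).
    exact: (@dot_comb N (fun i => dot h (F i)) (fun i => dot h (F i))).
  have hp : dot h p = \sum_(i < N) dot h (F i) * dot h (F i) by exact: (@dot_comb1 N (fun i => dot h (F i))).
  have -> : dot (hN N) (hN N) = dot h h - 2 * dot h p + dot p p.
    have E u : continuous u -> dot (hN N) u = dot h u - dot p u by move=> cu; exact: dotBl.
    rewrite E// (dotC _ h) (dotC _ p) !E// (dotC _ p h); ring.
  rewrite hp pp.
  have : 0 <= \sum_(i < N) dot h (F i) * dot h (F i).
    by apply: sumr_ge0 => i _; rewrite -expr2 sqr_ge0.
  rewrite -/H; lra.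
pose e N := Num.sqrt (dot (r N) (r N)).
have e0 N : 0 <= e N by exact: sqrtr_ge0.
have m0 N : 0 < mu N by apply: lt_le_trans (mu_ge1' N).
have e_le N : e N <= Num.sqrt H / mu N.
  rewrite ler_pdivlMr// -[X in _ * X]ger0_norm ?(ltW (m0 N))//.
  rewrite -sqrtr_sqr -sqrtrM ?dot_ge0// ler_wsqrtr// mulrC.
  exact: le_trans (minmax L0 HF HO Hlam Hspan (Sr N) (@orth N)) (bessel N).
(* An upper bound for the norm of the derivative of r_N. *)
pose d N := Num.sqrt (4 * Num.sqrt H * e N + 2 * c0 * e N ^+ 2).
have r_le N : r N x ^+ 2 <= e N ^+ 2 / L + 2 * (e N * d N).
  have := dr N; rewrite rE => drN; have [Cr _ _ _] := drN.
  have e2 : dot (r N) (r N) = e N ^+ 2 by rewrite sqr_sqrtr ?dot_ge0.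
  apply: (le_trans (trace_ineq L0 Cr xI)); rewrite -/(e N) e2.
  rewrite lerD2l ler_pM2l// ler_wpM2l// ler_wsqrtr//.
  apply: (le_trans (form_bound L0 drN)); rewrite e2 lerD2r.
  have [_ _ cr2] := dom_cont drN.
  have hr : dot (hN N) (r N) <= Num.sqrt H * e N.
    apply: (le_trans (ler_norm _)); apply: (le_trans (dot_CS L (chN N) (cr N))).
    by rewrite ler_wpM2r// ler_wsqrtr// bessel.
  move: (hrE N) cr2; set r2 := (fun z => _) => hrN cr2.
  have : dot (hN N) (r N) = - 2^-1 * dot r2 (r N) + c1 * dot (r N) (r N).
    rewrite (_ : hN N = fun z => - 2^-1 * r2 z + c1 * r N z); last exact/funext.
    by rewrite dotDl ?dotZl//; exact: contZ.
  rewrite e2 -mulrA => hE; apply: half_form_bound hE hr.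
  by rewrite mulr_ge0 ?sqr_ge0// /spectral_shift addr_ge0// divr_ge0.
have mu_inv : (mu N)^-1 @[N --> \oo] --> 0.
  have b N : (mu N)^-1 <= weyl_const^-1 * (N.+1%:R)^-1.
    have awN : 0 < weyl_const * N.+1%:R by rewrite mulr_gt0 ?weyl_const_gt0.
    rewrite -invfM lef_pV2 ?posrE//.
    apply: le_trans (weyl N); rewrite ler_wpM2l ?(ltW weyl_const_gt0)//.
    by rewrite expr2 ler_peMr// ler1n.
  apply: (@squeeze0 _ _ (fun N => weyl_const^-1 * (N.+1%:R)^-1)).
  - by move=> N; rewrite invr_ge0 ltW//= b.
  - rewrite -[X in _ --> X](mulr0 weyl_const^-1); apply: cvgM; first exact: cvg_cst.
    exact: cvg_harmonic.
have e_cvg : e N @[N --> \oo] --> 0.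
  apply: (@squeeze0 _ _ (fun N => Num.sqrt H / mu N)).
  - by move=> N; rewrite e0 e_le.
  - by rewrite -[X in _ --> X](mulr0 (Num.sqrt H)); apply: cvgM => //; exact: cvg_cst.
have e2_cvg : e N ^+ 2 @[N --> \oo] --> 0.
  by rewrite -[X in _ --> X](mulr0 0); apply: cvgM.
have d_cvg : d N @[N --> \oo] --> 0.
  rewrite -[X in _ --> X](@sqrtr0 R).
  have H' : 4 * Num.sqrt H * e N + 2 * c0 * e N ^+ 2 @[N --> \oo] --> (0 : R).
    rewrite -[X in _ --> X]addr0 -[X in _ --> X + _](mulr0 (4 * Num.sqrt H)) -[X in _ --> _ + X](mulr0 (2 * c0)).
    by apply: cvgD; apply: cvgM => //; exact: cvg_cst.
  by apply: cvg_comp H' _; exact: sqrt_continuous.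
have r2_cvg : r N x ^+ 2 @[N --> \oo] --> 0.
  apply: (@squeeze0 _ _ (fun N => e N ^+ 2 / L + 2 * (e N * d N))).
  - by move=> N; rewrite sqr_ge0 r_le.
  - have : e N ^+ 2 / L + 2 * (e N * d N) @[N --> \oo] --> (0 / L + 2 * (0 * 0) : R).
      apply: cvgD; first by apply: cvgM => //; exact: cvg_cst.
      by apply: cvgM; [exact: cvg_cst|exact: cvgM].
    by rewrite mul0r !mulr0 addr0.
have r_cvg : r N x @[N --> \oo] --> 0.
  apply/norm_cvg0P.
  have : Num.sqrt (r N x ^+ 2) @[N --> \oo] --> Num.sqrt 0.
    by apply: cvg_comp r2_cvg _; exact: sqrt_continuous.
  by rewrite sqrtr0; under eq_fun do rewrite sqrtr_sqr.
have : X x - r N x @[N --> \oo] --> X x - 0 by apply: cvgB => //; exact: cvg_cst.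
rewrite subr0; apply: cvg_trans; apply: near_eq_cvg; near=> N.
by rewrite /r; ring.
Unshelve. all: by end_near. Qed.

End spectral_estimates.

(** * The characteristic function of the normal law *)

Section dct.
Context (d : measure_display) (T : measurableType d) (R : realType).
Variables (mu : {measure set T -> \bar R}) (D : set T).
Hypothesis mD : measurable D.

Lemma Rintegral_dct (f_ : nat -> T -> R) (f g : T -> R) :
  (forall n, measurable_fun D (f_ n)) ->
  (forall x, D x -> f_ n x @[n --> \oo] --> f x) ->
  mu.-integrable D (EFin \o g) ->
  (forall n x, D x -> `|f_ n x| <= g x) ->
  mu.-integrable D (EFin \o f) /\
  \int[mu]_(x in D) f_ n x @[n --> \oo] --> \int[mu]_(x in D) f x.
Proof.
move=> mf cf ig fg.
have mfl : measurable_fun D f.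
  by apply: (@measurable_fun_cvg _ _ _ D f_ f mf) => x Dx; exact: cf.
have [||||| If _ cv] := @dominated_convergence _ T R mu D mD (fun n => EFin \o f_ n)
   (EFin \o f) (EFin \o g).
- by move=> n; exact/measurable_EFinP.
- exact/measurable_EFinP.
- by apply: aeW => x Dx; apply: cvg_EFin; [exact: nearW|exact: cf].
- exact: ig.
- by apply: aeW => x n Dx; rewrite /= lee_fin fg.
split => //; rewrite /Rintegral; apply: fine_cvg.
rewrite fineK; last exact: integrable_fin_num.
exact: cv.
Qed.

End dct.

Section normal.
Context (R : realType).
Local Notation leb := (@lebesgue_measure R).
Variable s : R.
Hypothesis s0 : s != 0.
Local Notation w := (normal_pdf 0 s).

Lemma centered_normal_pdfE (r x : R) : r != 0 ->
  normal_pdf 0 r x = normal_peak r * expR (- x ^+ 2 / (r ^+ 2 *+ 2)).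
Proof. by move=> r0; rewrite normal_pdfE// /normal_fun subr0. Qed.

Lemma wE x : w x = normal_peak s * expR (- x ^+ 2 / (s ^+ 2 *+ 2)).
Proof. exact: centered_normal_pdfE. Qed.

Let s2 : 0 < s ^+ 2. Proof. by rewrite exprn_even_gt0. Qed.

Lemma w_der (x : R) : is_derive x 1 w (- (x / s ^+ 2) * w x).
Proof.
have -> : w = fun x => normal_peak s * expR (- (s ^+ 2 *+ 2)^-1 * x ^+ 2).
  by apply/funext => y; rewrite wE; congr (_ * expR _); ring.
have /is_derive_eq := derZ (normal_peak s) (der_comp (is_derive_expR _)
   (derZ (- (s ^+ 2 *+ 2)^-1) (derX2 (is_derive_id x (1 : R))))).
by apply; field.
Qed.

Lemma w_ge0 x : 0 <= w x. Proof. exact: normal_pdf_ge0. Qed.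

Lemma w_cont : continuous w. Proof. exact: continuous_normal_pdf. Qed.

Lemma w_int : leb.-integrable setT (EFin \o w).
Proof. exact: integrable_normal_pdf. Qed.

(** The factor |x| is absorbed by comparing with the normal density of twice
the standard deviation, the quotient of the densities being exp(3 x^2 / (8 s^2))
up to a constant. *)
Lemma xw_int : leb.-integrable setT (EFin \o (fun x => `|x| * w x)).
Proof.
pose c := (1 + 8 * s ^+ 2 / 3) * normal_peak s / normal_peak (2 * s).
have s20 : 2 * s != 0 by rewrite mulf_neq0.
have I2 : leb.-integrable setT (EFin \o (fun x => c * normal_pdf 0 (2 * s) x)).
  exact: (integrableZl measurableT c (integrable_normal_pdf 0 (2 * s))).
apply: (le_integrable measurableT _ _ I2).
  by apply/measurable_EFinP; apply: measurable_funM; [exact: (continuous_measurable_fun (@norm_continuous _ R))|exact: measurable_normal_pdf].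
move=> x _ /=; rewrite lee_fin.
have p1 := normal_peak_gt0 s0; have p2 := normal_peak_gt0 s20.
have c0 : 0 <= c by rewrite /c divr_ge0 ?(ltW p2)// mulr_ge0 ?(ltW p1)// addr_ge0// divr_ge0// mulr_ge0// ltW.
rewrite [leLHS]ger0_norm ?mulr_ge0 ?w_ge0// [leRHS]ger0_norm; last first.
  exact: mulr_ge0 c0 (normal_pdf_ge0 _ _ _).
rewrite wE centered_normal_pdfE//.
have -> : c * (normal_peak (2 * s) * expR (- x ^+ 2 / ((2 * s) ^+ 2 *+ 2))) =
   normal_peak s * ((1 + 8 * s ^+ 2 / 3) * expR (- x ^+ 2 / ((2 * s) ^+ 2 *+ 2))).
  by rewrite /c; field; rewrite gt_eqF.
rewrite mulrCA ler_pM2l//.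
have -> : - x ^+ 2 / ((2 * s) ^+ 2 *+ 2) = 3 * x ^+ 2 / (8 * s ^+ 2) + - x ^+ 2 / (s ^+ 2 *+ 2).
  by field.
rewrite expRD mulrA ler_wpM2r ?expR_ge0//.
set z := 3 * x ^+ 2 / (8 * s ^+ 2).
have z0 : 0 <= z by rewrite divr_ge0// mulr_ge0 ?sqr_ge0.
have zx : x ^+ 2 = 8 * s ^+ 2 / 3 * z by rewrite /z; field.
have ez : 1 + z <= expR z by exact: expR_ge1Dx.
have k0 : 0 <= 8 * s ^+ 2 / 3 by rewrite divr_ge0// mulr_ge0// sqr_ge0.
have H1 : `|x| <= 1 + x ^+ 2.
  by rewrite -[x ^+ 2]real_normK ?num_real//; have := sqr_ge0 (`|x| - 1); nra.
apply: (le_trans H1); rewrite {}zx; move: k0 ez z0; clear.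
set a := 8 * s ^+ 2 / 3; move=> a0 ez z0.
have : a * z <= a * expR z by rewrite ler_wpM2l//; lra.
lra.
Qed.

Lemma w_vanish : w n.+1%:R @[n --> \oo] --> 0.
Proof.
apply: (@squeeze0 _ _ (fun n => normal_peak s * (s ^+ 2 *+ 2) * (n.+1%:R)^-1)).
  move=> n; rewrite w_ge0/= wE -mulrA ler_pM2l ?normal_peak_gt0//.
  set k := s ^+ 2 *+ 2; have k0 : 0 < k by rewrite pmulrn_rgt0.
  rewrite mulNr expRN -[leRHS]invrK invfM invrK lef_pV2 ?posrE ?expR_gt0 ?divr_gt0//; last first.
    by rewrite mulr_gt0 ?invr_gt0.
  apply: (@le_trans _ _ (1 + n.+1%:R ^+ 2 / k)); last exact: expR_ge1Dx.
  have : k^-1 * n.+1%:R <= n.+1%:R ^+ 2 / k.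
    by rewrite mulrC ler_wpM2r ?invr_ge0 ?(ltW k0)// expr2 ler_peMr// ler1n.
  lra.
rewrite -[X in _ --> X](mulr0 (normal_peak s * (s ^+ 2 *+ 2))).
by apply: cvgM; [exact: cvg_cst|exact: cvg_harmonic].
Qed.

Lemma w_even x : w (- x) = w x. Proof. by rewrite !wE sqrrN. Qed.

Section charfun.
Variable th : R.

Let ccos u : continuous (fun x : R => cos (th + u * x)).
Proof.
move=> x; apply: (@continuous_comp _ _ _ (fun x => th + u * x) cos).
  by apply: cvgD; [exact: cvg_cst|apply: cvgM; [exact: cvg_cst|exact: cvg_id]].
exact: continuous_cos.
Qed.
Let csin u : continuous (fun x : R => sin (th + u * x)).
Proof.
move=> x; apply: (@continuous_comp _ _ _ (fun x => th + u * x) sin).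
  by apply: cvgD; [exact: cvg_cst|apply: cvgM; [exact: cvg_cst|exact: cvg_id]].
exact: continuous_sin.
Qed.

Let mcont (f : R -> R) : continuous f -> measurable_fun setT f.
Proof. exact: continuous_measurable_fun. Qed.

Let cw_int u : leb.-integrable setT (EFin \o (fun x => cos (th + u * x) * w x)).
Proof.
apply: (le_integrable measurableT _ _ w_int).
  by apply/measurable_EFinP; apply: measurable_funM; [exact: mcont|exact: measurable_normal_pdf].
move=> x _ /=; rewrite lee_fin normrM ler_piMl//.
by rewrite ler_norml cos_geN1 cos_le1.
Qed.

Let sw_int u : leb.-integrable setT (EFin \o (fun x => sin (th + u * x) * x * w x)).
Proof.
apply: (le_integrable measurableT _ _ xw_int).
  apply/measurable_EFinP; apply: measurable_funM; last exact: measurable_normal_pdf.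
  by apply: measurable_funM => //; exact: mcont.
move=> x _ /=; rewrite lee_fin -mulrA normrM.
rewrite [X in _ <= X]ger0_norm ?mulr_ge0 ?w_ge0// normrM (ger0_norm (w_ge0 x)).
by rewrite ler_piMl ?mulr_ge0 ?w_ge0// ler_norml sin_geN1 sin_le1.
Qed.

Let lin_der u (x : R) : is_derive x 1 (fun x => th + u * x) u.
Proof.
have /is_derive_eq := derD (is_derive_cst th x (1 : R)) (derZ u (is_derive_id x (1 : R))).
by apply; rewrite add0r mulr1.
Qed.

(** Integration by parts on [- n, n], with boundary terms tending to 0. *)
Let ibp u : \int[leb]_x (sin (th + u * x) * x * w x) =
  s ^+ 2 * u * \int[leb]_x (cos (th + u * x) * w x).
Proof.
pose g x := sin (th + u * x) * w x.
pose g' x := u * (cos (th + u * x) * w x) - (s ^+ 2)^-1 * (sin (th + u * x) * x * w x).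
have dg (x : R) : is_derive x 1 g (g' x).
  have /is_derive_eq := derM (der_comp (is_derive_sin _) (lin_der u x)) (w_der x).
  by apply; rewrite /g'; field.
have cg' : continuous g'.
  apply: contB; apply: contZ.
    by apply: contM; [exact: ccos|exact: w_cont].
  apply: contM; last exact: w_cont.
  by apply: contM; [exact: csin|move=> x; exact: cvg_id].
have Ig' : leb.-integrable setT (EFin \o g').
  apply: (integrableB measurableT (integrableZl measurableT u (cw_int u))
    (integrableZl measurableT (s ^+ 2)^-1 (sw_int u))).
have E1 : \int[leb]_x g' x = u * \int[leb]_x (cos (th + u * x) * w x) -
    (s ^+ 2)^-1 * \int[leb]_x (sin (th + u * x) * x * w x).
  rewrite RintegralB//.
  - by rewrite !RintegralZl.
  - exact: (integrableZl measurableT u (cw_int u)).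
  - exact: (integrableZl measurableT (s ^+ 2)^-1 (sw_int u)).
suff E2 : \int[leb]_x g' x = 0.
  rewrite E2 in E1.
  have : \int[leb]_x (sin (th + u * x) * x * w x) =
    s ^+ 2 * ((s ^+ 2)^-1 * \int[leb]_x (sin (th + u * x) * x * w x)).
    by rewrite mulrA divff ?mul1r// gt_eqF.
  move=> ->; have -> : (s ^+ 2)^-1 * \int[leb]_x (sin (th + u * x) * x * w x) =
     u * \int[leb]_x (cos (th + u * x) * w x) by lra.
  by rewrite mulrA.
pose I (n : nat) : set R := `[- (n.+1%:R : R), n.+1%:R]%classic.
have [_ cv] : leb.-integrable setT (EFin \o g') /\
    \int[leb]_x (g' \_ (I n)) x @[n --> \oo] --> \int[leb]_x g' x.
  apply: (@Rintegral_dct _ _ R leb setT measurableT (fun n => g' \_ (I n)) g' (fun x => `|g' x|)) => //.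
  - move=> n; apply/(measurable_restrictT _ _).1 => //; first exact: measurable_itv.
    by apply: measurable_funS (mcont cg') => //.
  - move=> x _; have : (fun _ : nat => g' x) @ \oo --> g' x by exact: cvg_cst.
    apply: cvg_trans; apply: near_eq_cvg.
    near=> n; rewrite patchE mem_set//=.
    rewrite /I/= in_itv/= -ler_norml.
    near: n.
    exists (Num.bound `|x|) => // n /= mn.
    by apply: (le_trans (ltW (archi_boundP (normr_ge0 x)))); rewrite ler_nat (leq_trans mn).
  - by have := integrable_abse Ig'.
  - by move=> n x _; rewrite patchE; case: ifP => // _; rewrite normr0.
have cv0 : \int[leb]_x (g' \_ (I n)) x @[n --> \oo] --> 0.
  have -> : (fun n => \int[leb]_x (g' \_ (I n)) x) = (fun n => g n.+1%:R - g (- n.+1%:R)).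
    apply/funext => n; rewrite -Rintegral_mkcond (FTC_global dg cg')//.
    by rewrite (le_trans (y := 0)) ?oppr_le0.
  rewrite -[X in _ --> X]subr0; apply: cvgB.
    apply/norm_cvg0P; apply: squeeze0 w_vanish => n.
    rewrite normr_ge0 /g normrM (ger0_norm (w_ge0 _)) ler_piMl ?w_ge0//.
    by rewrite ler_norml sin_geN1 sin_le1.
  apply/norm_cvg0P; apply: squeeze0 w_vanish => n.
  rewrite normr_ge0 /g normrM (ger0_norm (w_ge0 _)) w_even ler_piMl ?w_ge0//.
  by rewrite ler_norml sin_geN1 sin_le1.
exact: cvg_unique cv cv0.
Unshelve. all: by end_near. Qed.

(** The characteristic function at u of the centred normal law, rotated by th:
the phase gives access to real and imaginary parts without complex numbers. *)
Definition nchar u := \int[leb]_x (cos (th + u * x) * w x).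

(** Differentiation under the integral and [ibp] give a linear differential
equation, solved in [ncharE]. *)
Let nchar_der (u : R) : is_derive u 1 nchar (- (s ^+ 2 * u) * nchar u).
Proof.
have dx (v x : R) : is_derive v 1 (fun v => cos (th + v * x) * w x) (- (sin (th + v * x) * x * w x)).
  have l : is_derive v 1 (fun v => th + v * x) x.
    have /is_derive_eq := derD (is_derive_cst th v (1 : R)) (derM (is_derive_id v (1 : R)) (is_derive_cst x v 1)).
    by apply; rewrite mul1r mulr0 addr0 add0r.
  have /is_derive_eq := derM (der_comp (is_derive_cos _) l) (is_derive_cst (w x) v (1 : R)).
  by apply=> /=; rewrite /cst; ring.
have d1E v x : partial1of2 (fun u x : R => cos (th + u * x) * w x) v x = - (sin (th + v * x) * x * w x).
  by rewrite partial1of2E; have [_ ->] := dx v x.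
have Iu : (`]u - 1, u + 1[%classic : set R) u by rewrite /= in_itv/= ltrBlDr ltrDl ltr01.
have G0 (x : R) : 0 <= `|x| * w x by rewrite mulr_ge0 ?w_ge0.
have Gub (v x : R) : `]u - 1, u + 1[%classic v -> (setT : set R) x ->
    `|partial1of2 (fun u x : R => cos (th + u * x) * w x) v x| <= `|x| * w x.
  move=> _ _; rewrite d1E normrN -mulrA normrM normrM (ger0_norm (w_ge0 x)).
  by rewrite ler_piMl ?mulr_ge0 ?w_ge0// ler_norml sin_geN1 sin_le1.
have dv (v x : R) : `]u - 1, u + 1[%classic v -> (setT : set R) x ->
    derivable (fun v : R => cos (th + v * x) * w x) v 1 by move=> _ _; have [] := dx v x.
have Iv (v : R) : `]u - 1, u + 1[%classic v -> leb.-integrable setT (EFin \o (fun x => cos (th + v * x) * w x)).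
  by move=> _; exact: cw_int.
have D := derivable_under_integral measurableT Iu Iv dv G0 xw_int Gub.
have E := differentiation_under_integral measurableT Iu Iv dv G0 xw_int Gub.
apply: DeriveDef; first exact: D.
rewrite -derive1E; apply: etrans E _.
under eq_Rintegral do rewrite d1E -mulN1r.
by rewrite RintegralZl// ibp /nchar; ring.
Qed.

Lemma ncharE u : nchar u = cos th * expR (- (s ^+ 2 * u ^+ 2 / 2)).
Proof.
pose psi v := nchar v * expR (s ^+ 2 / 2 * v ^+ 2).
have d (v : R) : is_derive v 1 psi 0.
  have /is_derive_eq := derM (nchar_der v) (der_comp (is_derive_expR _)
     (derZ (s ^+ 2 / 2) (derX2 (is_derive_id v (1 : R))))).
  by apply; field.
have := is_derive0_cst u 0 d.
rewrite /psi expr0n/= mulr0 expR0 mulr1.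
have -> : nchar 0 = cos th.
  rewrite /nchar; under eq_Rintegral do rewrite mul0r addr0.
  rewrite RintegralZl//; last exact: w_int.
  by rewrite /Rintegral integral_normal_pdf mulr1.
move=> <-; rewrite -[RHS]mulrA -expRD (_ : _ + _ = 0) ?expR0 ?mulr1//.
by field.
Qed.

End charfun.

(** The law is given as a measure; its Radon-Nikodym derivative agrees almost
everywhere with the density. *)
Lemma integral_normal_prob (f : R -> R) : measurable_fun setT f -> (exists k : R, forall x, `|f x| <= k) ->
  (\int[normal_prob 0 s]_x (f x)%:E = \int[leb]_x (f x * w x)%:E)%E.
Proof.
move=> mf [k fk].
have dom := normal_prob_dominates 0 s.
rewrite -(Radon_Nikodym_change_of_variables dom)//=; last first.
  apply/integrableP; split; first exact/measurable_EFinP.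
  apply: (@le_lt_trans _ _ (\int[normal_prob 0 s]_x (cst k%:E x))%E).
    apply: ge0_le_integral => //.
    - by apply: measurableT_comp => //; exact/measurable_EFinP.
    - by move=> x _ /=; rewrite lee_fin.
  by rewrite integral_cst//= probability_setT mule1 ltry.
under [RHS]eq_integral do rewrite EFinM.
apply: ae_eq_integral => //.
- apply: emeasurable_funM; first exact/measurable_EFinP.
  by apply: (measurable_int leb); exact: Radon_Nikodym_integrable.
- apply: emeasurable_funM; first exact/measurable_EFinP.
  by apply/measurable_EFinP; exact: measurable_normal_pdf.
- apply: ae_eqe_mul2l => /=.
  rewrite Radon_NikodymE/=.
  case: cid => /= h [h1 h2 h3].
  apply: integral_ae_eq => //=.
  + by apply/measurable_EFinP; exact: measurable_normal_pdf.
  + by move=> E E01 mE; rewrite -h3.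
Qed.

End normal.

(** * Difference quotients of cosine, and a Fubini argument *)

Section realfacts.
Context (R : realType).
Implicit Types x y z : R.

Lemma ler_dist_cos x y : `|cos x - cos y| <= `|x - y|.
Proof.
wlog xy : x y / x <= y.
  by move=> H; have [|/ltW] := leP x y => xy; [exact: H|rewrite distrC [leRHS]distrC; exact: H].
have [z _ E] := @MVT_segment _ cos (fun z => - sin z) x y xy (fun z _ => is_derive_cos z)
  (continuous_subspaceT (@continuous_cos R)).
by rewrite distrC E [leRHS]distrC normrM normrN ler_piMl// sin_max.
Qed.

Lemma ler_norm_sin x : `|sin x| <= `|x|.
Proof.
have E z : sin z = - cos (z + pi / 2).
  by rewrite cosD cos_pihalf sin_pihalf; ring.
have c0 : cos (pi / 2) = 0 :> R by exact: cos_pihalf.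
have := ler_dist_cos (x + pi / 2) (pi / 2); rewrite c0 subr0 addrK.
by rewrite E normrN.
Qed.

Lemma one_minus_cos x : 1 - cos x = 2 * sin (x / 2) ^+ 2.
Proof.
have -> : cos x = cos (x / 2 + x / 2) by congr cos; field.
by rewrite cosD -!expr2 cos2sin2; ring.
Qed.

Lemma cvg_invS : ((n.+1%:R)^-1 : R) @[n --> \oo] --> 0.
Proof. exact: cvg_harmonic. Qed.

Lemma cvg_sin_quot y : n.+1%:R * sin ((n.+1%:R)^-1 * y) @[n --> \oo] --> y.
Proof.
have := der_scale y 0 (@is_derive_sin R).
rewrite mulr0 cos0 mulr1 => -[dv Ev].
have cv : (fun h : R => h^-1 *: (((fun x => sin (y * x)) \o shift 0) (h *: 1) - sin (y * 0))) @ 0^' --> y.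
  by rewrite -[X in _ --> X]Ev /derive; exact: dv.
have ci : ((n.+1%:R)^-1 : R) @[n --> \oo] --> 0^'.
  move=> A [e e0 Ae]; have := cvg_invS.
  move=> /cvgrPdist_lt /(_ e e0); apply: filterS => n Hn.
  by apply: Ae => //=; rewrite invr_eq0 pnatr_eq0.
have := cvg_comp _ _ ci cv; apply: cvg_trans; apply: near_eq_cvg; near=> n.
rewrite /= invrK mulr0 sin0 subr0 /GRing.scale/= mulr1 addr0; congr (_ * sin _).
by rewrite mulrC.
Unshelve. all: by end_near. Qed.

Lemma cvg_cos_quot y :
  n.+1%:R ^+ 2 * (1 - cos ((n.+1%:R)^-1 * y)) @[n --> \oo] --> y ^+ 2 / 2.
Proof.
have H := @cvg_sin_quot (y / 2).
have : 2 * (n.+1%:R * sin ((n.+1%:R)^-1 * (y / 2)) * (n.+1%:R * sin ((n.+1%:R)^-1 * (y / 2))))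
   @[n --> \oo] --> 2 * (y / 2 * (y / 2)).
  by apply: cvgM; [exact: cvg_cst|exact: cvgM].
rewrite (_ : 2 * (y / 2 * (y / 2)) = y ^+ 2 / 2); last by field.
apply: cvg_trans; apply: near_eq_cvg; near=> n.
rewrite /= one_minus_cos -(mulrA _ y); ring.
Unshelve. all: by end_near. Qed.

Lemma cos_quot_bound y n : `|n.+1%:R ^+ 2 * (1 - cos ((n.+1%:R)^-1 * y))| <= y ^+ 2.
Proof.
set N : R := n.+1%:R; have N0 : N != 0 by rewrite pnatr_eq0.
rewrite one_minus_cos; set z := _ / 2.
have Hz2 : sin z ^+ 2 <= z ^+ 2.
  by rewrite -(real_normK (num_real (sin z))) -(real_normK (num_real z)) lerXn2r// ?nnegrE// ler_norm_sin.
have -> : y ^+ 2 = N ^+ 2 * (4 * z ^+ 2) by rewrite /z; field.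
rewrite ger0_norm; last by rewrite mulr_ge0 ?sqr_ge0// mulr_ge0// sqr_ge0.
rewrite ler_wpM2l ?sqr_ge0//.
have := sqr_ge0 z; lra.
Qed.

Lemma sin_quot_bound y n : `|n.+1%:R * sin ((n.+1%:R)^-1 * y)| <= `|y|.
Proof.
rewrite normrM normr_nat; apply: (@le_trans _ _ (n.+1%:R * `|(n.+1%:R)^-1 * y|)).
  by rewrite ler_wpM2l// ler_norm_sin.
by rewrite normrM normfV normr_nat mulrA divff ?mul1r// pnatr_eq0.
Qed.

Lemma cvg_exp_quot (k : R) : 0 <= k ->
  n.+1%:R ^+ 2 * (1 - expR (- (k * ((n.+1%:R)^-1) ^+ 2))) @[n --> \oo] --> k.
Proof.
move=> k0.
have lo : k / (1 + k * ((n.+1%:R)^-1) ^+ 2) @[n --> \oo] --> k.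
  have : k / (1 + k * ((n.+1%:R)^-1) ^+ 2) @[n --> \oo] --> k / (1 + k * (0 * 0)).
    apply: cvgM; first exact: cvg_cst.
    apply: cvgV; first by rewrite !mulr0 addr0 oner_neq0.
    apply: cvgD; first exact: cvg_cst.
    by apply: cvgM; [exact: cvg_cst|apply: cvgM; exact: cvg_invS].
  by rewrite !mulr0 addr0 divr1.
apply: (squeeze_cvgr _ lo); last exact: cvg_cst.
near=> n.
set N : R := n.+1%:R; have N0 : N != 0 by rewrite pnatr_eq0.
set x := k * N^-1 ^+ 2; have x0 : 0 <= x by rewrite mulr_ge0 ?sqr_ge0.
have kE : k = N ^+ 2 * x by rewrite /x; field.
have E1 : 1 - x <= expR (- x) by exact: expR_ge1Dx.
have E2 : expR (- x) <= (1 + x)^-1.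
  by rewrite expRN lef_pV2 ?posrE ?expR_gt0 ?expR_ge1Dx//; lra.
have p1 : 0 < 1 + x by lra.
apply/andP; split; last first.
  by rewrite [leRHS]kE ler_wpM2l ?sqr_ge0//; lra.
rewrite {1}kE -mulrA ler_wpM2l ?sqr_ge0//.
have -> : x / (1 + x) = 1 - (1 + x)^-1 by field; rewrite gt_eqF.
lra.
Unshelve. all: by end_near. Qed.

End realfacts.

Section prob.
Context (d : measure_display) (Omega : measurableType d) (R : realType).
Variable P : probability Omega R.
Local Notation leb := (@lebesgue_measure R).
Local Notation E f := (\int[P]_o f o).
Implicit Types (X Y H : Omega -> R).
Local Notation integ f := (P.-integrable setT (EFin \o f)).

Lemma prob_integ_cst (k : R) : integ (fun=> k).
Proof. by apply: finite_measure_integrable_cst. Qed.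

Lemma integ_bounded H (f : Omega -> R) (k : R) : measurable_fun setT f ->
  (forall o, `|f o| <= k) -> integ H -> integ (fun o => H o * f o).
Proof.
move=> mf fk IH.
have IkH : integ (fun o => k * H o) by exact: (integrableZl measurableT k IH).
apply: (le_integrable measurableT _ _ IkH).
  apply/measurable_EFinP; apply: measurable_funM => //.
  by apply/measurable_EFinP; exact: measurable_int IH.
move=> o _ /=; rewrite lee_fin !normrM mulrC ler_wpM2r//.
by rewrite (le_trans (fk o))// ler_norm.
Qed.

Lemma mcos (th : R) Y : measurable_fun setT Y -> measurable_fun setT (fun o => cos (th + Y o)).
Proof.
move=> mY; apply: (measurableT_comp (f := cos)).
  exact: continuous_measurable_fun (@continuous_cos R).
exact: measurable_funD.
Qed.

(** The functions k u form a bounded measurable family; a variable orthogonal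
to each of them is orthogonal to their averages over u. *)
Lemma fubini_zero H (k : R -> Omega -> R) (C a b : R) : integ H ->
  measurable_fun setT (fun p : Omega * R => k p.2 p.1) ->
  (forall u o, `|k u o| <= C) ->
  (forall u, a <= u <= b -> E (fun o => H o * k u o) = 0) ->
  E (fun o => H o * \int[leb]_(u in `[a, b]) k u o) = 0.
Proof.
move=> IH mk kC k0.
have mH : measurable_fun setT H by apply/measurable_EFinP; exact: measurable_int IH.
pose f (p : Omega * R) : \bar R := (H p.1 * (k p.2 p.1 * \1_(`[a, b]%classic) p.2))%:E.
have mf : measurable_fun setT f.
  apply/measurable_EFinP; apply: measurable_funM; first exact: measurableT_comp.
  by apply: measurable_funM => //; apply: measurableT_comp => //; exact: measurable_indic.
have mku o : measurable_fun setT (fun u => k u o).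
  by have := measurableT_comp mk (pair1_measurable o).
have Ik o : leb.-integrable `[a, b] (EFin \o (fun u => k u o)).
  apply: (@measurable_bounded_integrable _ _ R leb).
  - by [].
  - rewrite /= lebesgue_measure_itv/=; case: ifP => _; exact: ltry.
  - by apply: measurable_funS (mku o).
  - exists C; split; [exact: num_real|move=> M CM u _; exact: le_trans (kC u o) (ltW CM)].
have C0 : 0 <= C by apply: le_trans (kC 0 point).
pose l := fine (leb (`[a, b]%classic)).
have lE : leb (`[a, b]%classic) = l%:E.
  by rewrite /l fineK//= lebesgue_measure_itv/=; case: ifP.
have mfo o : measurable_fun setT (fun u : R => f (o, u)).
  rewrite /f/=; apply/measurable_EFinP.
  apply: (@measurable_funM _ _ _ setT (fun=> H o) (fun u => k u o * \1_(`[a, b]%classic) u)) => //.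
  by apply: measurable_funM => //; exact: measurable_indic.
have If : (P \x leb)%E.-integrable setT f.
  apply: ((@integrable12ltyP _ _ _ _ _ P leb f mf).2).
  have bnd o : (\int[leb]_u `|f (o, u)| <= (`|H o| * C * l)%:E)%E.
    rewrite EFinM -lE -integral_cst//= [leRHS]integral_mkcond.
    apply: ge0_le_integral => //.
    - exact: (measurableT_comp (@abse_measurable R setT) (mfo o)).
    - by apply/(measurable_restrictT _ _).1.
    - move=> u _; rewrite /f /= patchE indicE; case: ifPn => uI.
        by rewrite mulr1 lee_fin normrM ler_wpM2l.
      by rewrite /= !mulr0 normr0.
  apply: (@le_lt_trans _ _ (\int[P]_o (`|H o| * C * l)%:E)%E).
    apply: ge0_le_integral => //.
    - by move=> o _; exact: integral_ge0.
    - have mf' : measurable_fun setT (fun p => `|f p|%E) by exact: (measurableT_comp (@abse_measurable R setT) mf).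
      exact: (@measurable_fun_fubini_tonelli_F _ _ Omega _ R leb (fun p => `|f p|%E) mf').
    - by apply/measurable_EFinP; apply: measurable_funM => //; apply: measurable_funM => //; exact: measurableT_comp.
  have : integ (fun o => C * l * `|H o|).
    exact: (integrableZl measurableT (C * l) (integrable_abse IH)).
  move=> /integrableP[_]; apply: le_lt_trans.
  apply: ge0_le_integral => //.
  - by move=> o _; rewrite lee_fin mulr_ge0 ?mulr_ge0// /l fine_ge0.
  - by apply/measurable_EFinP; apply: measurable_funM => //; apply: measurable_funM => //; exact: measurableT_comp.
  - by apply: measurableT_comp => //; apply/measurable_EFinP; apply: measurable_funM => //; exact: measurableT_comp.
  - by move=> o _ /=; rewrite lee_fin (le_trans _ (ler_norm _))//; lra.
have FE := Fubini If.
rewrite /Rintegral.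
have L o : (H o * \int[leb]_(u in `[a, b]) k u o)%:E = (\int[leb]_u f (o, u))%E.
  rewrite /f/= -RintegralZl//.
  rewrite /Rintegral fineK; last first.
    by apply: integrable_fin_num => //; exact: (integrableZl _ (H o) (Ik o)).
  rewrite integral_mkcond; apply: eq_integral => u _.
  by rewrite patchE indicE; case: ifPn => uI; rewrite ?mulr1 ?mulr0.
under eq_integral do rewrite L.
rewrite FE (_ : (\int[leb]_y _)%E = 0%E)// integral0_eq// => u _.
rewrite /f /=.
have [uI|uI] := boolP (a <= u <= b); last first.
  rewrite (_ : \1_(`[a, b]%classic) u = 0); last first.
    by rewrite indicE memNset//=; rewrite in_itv/=; exact/negP.
  by under eq_integral do rewrite !mulr0; rewrite integral0.
rewrite (_ : \1_(`[a, b]%classic) u = 1); last by rewrite indicE mem_set//= in_itv.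
under eq_integral do rewrite mulr1.
have Ihk : integ (fun o => H o * k u o).
  by apply: (integ_bounded (k := C)) => //; exact: (measurableT_comp mk (pair2_measurable u)).
have := k0 u uI; rewrite /Rintegral => E0.
by rewrite -(fineK (integrable_fin_num measurableT Ihk)) E0.
Qed.

End prob.

(** * Random variables with vanishing Fourier transform *)

Section fourier.
Context (d : measure_display) (Omega : measurableType d) (R : realType).
Variable P : probability Omega R.
Local Notation leb := (@lebesgue_measure R).
Local Notation E f := (\int[P]_o f o).
Implicit Types (X Y H : Omega -> R).
Local Notation integ f := (P.-integrable setT (EFin \o f)).

Lemma integ_meas H : integ H -> measurable_fun setT H.
Proof. by move=> IH; apply/measurable_EFinP; exact: measurable_int IH. Qed.

(** The weight H is only integrable, which suffices for bounded convergence of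
the other factor. *)
Lemma weighted_dct H (f_ : nat -> Omega -> R) (f : Omega -> R) (k : R) : integ H ->
  (forall n, measurable_fun setT (f_ n)) -> (forall n o, `|f_ n o| <= k) ->
  (forall o, f_ n o @[n --> \oo] --> f o) ->
  E (fun o => H o * f_ n o) @[n --> \oo] --> E (fun o => H o * f o).
Proof.
move=> IH mf fk cf; have mH := integ_meas IH.
have [] // := @Rintegral_dct _ _ R P setT measurableT (fun n o => H o * f_ n o) (fun o => H o * f o) (fun o => k * `|H o|).
- by move=> n; exact: measurable_funM.
- by move=> o _; apply: cvgM; [exact: cvg_cst|exact: cf].
- exact: (integrableZl measurableT k (integrable_abse IH)).
- by move=> n o _; rewrite normrM mulrC ler_wpM2r.
Qed.

Lemma weighted_dct0 H (f_ : nat -> Omega -> R) (f : Omega -> R) (k : R) : integ H ->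
  (forall n, measurable_fun setT (f_ n)) -> (forall n o, `|f_ n o| <= k) ->
  (forall o, f_ n o @[n --> \oo] --> f o) ->
  (forall n, E (fun o => H o * f_ n o) = 0) -> E (fun o => H o * f o) = 0.
Proof.
move=> IH mf fk cf f0; have := weighted_dct IH mf fk cf.
under eq_fun do rewrite f0; move=> c.
have c' : (fun _ : nat => 0 : R) @ \oo --> (0 : R) by exact: cvg_cst.
exact: cvg_unique c c'.
Qed.

Section one_dim.
Variables (H Y : Omega -> R).
Hypothesis IH : integ H.
Hypothesis mY : measurable_fun setT Y.
Hypothesis H0 : forall th u : R, E (fun o => H o * cos (th + u * Y o)) = 0.

Let mcst_comp (g : R -> R) (f : Omega -> R) : continuous g -> measurable_fun setT f ->
  measurable_fun setT (fun o => g (f o)).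
Proof. by move=> cg mf; apply: (measurableT_comp (continuous_measurable_fun cg) mf). Qed.

(** The Laplace transform of the cosine, truncated at n; as n grows it tends to
the Poisson kernel. *)
Lemma exp_cos_int (z : R) (n : nat) :
  \int[leb]_(u in `[0, n%:R]) (expR (- u) * cos (u * z)) =
  (1 + z ^+ 2)^-1 + expR (- n%:R) * (z * sin (n%:R * z) - cos (n%:R * z)) / (1 + z ^+ 2).
Proof.
have z1 : 1 + z ^+ 2 != 0 by rewrite gt_eqF// ltr_wpDr ?sqr_ge0.
pose G (u : R) := (1 + z ^+ 2)^-1 * (expR (- 1 * u) * (z * sin (z * u) - cos (z * u))).
have dG (u : R) : is_derive u 1 G (expR (- u) * cos (u * z)).
  have /is_derive_eq := derZ (1 + z ^+ 2)^-1 (derM (der_scale (- 1) u (@is_derive_expR R))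
    (derB (derZ z (der_scale z u (@is_derive_sin R))) (der_scale z u (@is_derive_cos R)))).
  by apply => /=; rewrite !mulN1r (mulrC z u); field.
have cG : continuous (fun u : R => expR (- u) * cos (u * z)).
  apply: contM => u.
    by apply: (@continuous_comp _ _ _ (fun u : R => - u) expR); [exact: continuousN|exact: continuous_expR].
  apply: (@continuous_comp _ _ _ (fun u : R => u * z) cos); last exact: continuous_cos.
  by apply: cvgM; [exact: cvg_id|exact: cvg_cst].
rewrite (FTC_global dG cG)// /G mulr0 expR0 mulr0 sin0 cos0 mulN1r (mulrC z n%:R).
by field.
Qed.

(** The Poisson kernel is an average of cosines, with exponential weights. *)
Lemma poisson_zero (s b : R) : E (fun o => H o * (1 + (s * (b - Y o)) ^+ 2)^-1) = 0.
Proof.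
pose z o := s * (b - Y o).
have mz : measurable_fun setT z by apply: measurable_funM => //; exact: measurable_funB.
pose f_ (n : nat) o := \int[leb]_(u in `[0, n%:R]) (expR (- u) * cos (u * z o)).
pose er (n : nat) o := expR (- n%:R) * (z o * sin (n%:R * z o) - cos (n%:R * z o)) / (1 + z o ^+ 2).
have p1 o : 0 < 1 + z o ^+ 2 by rewrite ltr_wpDr ?sqr_ge0.
have er_b n o : `|er n o| <= 2 * (n.+1%:R)^-1.
  rewrite /er normrM normrM normfV (ger0_norm (ltW (p1 o))) ler_pdivrMr//.
  rewrite ger0_norm ?expR_ge0//.
  have e1 : expR (- n%:R) <= (n.+1%:R : R)^-1.
    rewrite expRN lef_pV2 ?posrE ?expR_gt0//.
    by apply: le_trans (expR_ge1Dx _); rewrite -natr1 addrC.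
  have e2 : `|z o * sin (n%:R * z o) - cos (n%:R * z o)| <= 2 * (1 + z o ^+ 2).
    apply: (le_trans (ler_normB _ _)); rewrite normrM.
    have h1 : `|z o| * `|sin (n%:R * z o)| <= `|z o| by rewrite ler_piMr// sin_max.
    have h2 := cos_max (n%:R * z o).
    rewrite -(real_normK (num_real (z o))).
    have := sqr_ge0 (`|z o| - 1); have := sqr_ge0 `|z o|; lra.
  apply: (le_trans (ler_pM (expR_ge0 _) (normr_ge0 _) e1 e2)).
  by rewrite mulrCA mulrA.
apply: (@weighted_dct0 H (fun n o => (1 + z o ^+ 2)^-1 + er n o) _ 3 IH).
- move=> n; pose g x : R := (1 + x ^+ 2)^-1 +
    expR (- n%:R) * (x * sin (n%:R * x) - cos (n%:R * x)) / (1 + x ^+ 2).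
  suff cg : continuous g by exact: (mcst_comp cg mz).
  have cinv : continuous (fun x : R => (1 + x ^+ 2)^-1).
    move=> x; apply: cvgV; first by rewrite gt_eqF// ltr_wpDr ?sqr_ge0.
    by apply: cvgD; [exact: cvg_cst|apply: cvgM; exact: cvg_id].
  have cnx : continuous (fun x : R => n%:R * x) by apply: contZ => x; exact: cvg_id.
  apply: contD => //; apply: contM => //; apply: contZ; apply: contB.
    apply: contM; first by move=> x; exact: cvg_id.
    by move=> x; apply: (@continuous_comp _ _ _ (fun x : R => n%:R * x) sin); [exact: cnx|exact: continuous_sin].
  by move=> x; apply: (@continuous_comp _ _ _ (fun x : R => n%:R * x) cos); [exact: cnx|exact: continuous_cos].
- move=> n o; apply: (le_trans (ler_normD _ _)).
  have -> : 3 = 1 + 2 :> R by rewrite addrC natr1.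
  apply: lerD; first by rewrite normfV (ger0_norm (ltW (p1 o))) invf_le1// lerDl sqr_ge0.
  by apply: (le_trans (er_b n o)); rewrite ler_piMr// invf_le1// ler1n.
- move=> o; rewrite -[X in _ --> X]addr0; apply: cvgD; first exact: cvg_cst.
  apply/norm_cvg0P; apply: (@squeeze0 _ _ (fun n => 2 * (n.+1%:R)^-1)).
    by move=> n; rewrite normr_ge0 er_b.
  by rewrite -[X in _ --> X](mulr0 2); apply: cvgM; [exact: cvg_cst|exact: cvg_invS].
move=> n.
have -> : (fun o => H o * ((1 + z o ^+ 2)^-1 + er n o)) =
  (fun o => H o * \int[leb]_(u in `[0, n%:R]) (Num.min 1 (expR (- u)) * cos (u * z o))).
  apply/funext => o; rewrite /er -exp_cos_int; congr (_ * _).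
  apply: eq_Rintegral => u; rewrite inE/= in_itv/= => /andP[u0 _].
  by rewrite min_r// -expR0 ler_expR oppr_le0.
(* The weight exp(- u) is capped at 1 so that it is bounded for all u. *)
apply: (@fubini_zero _ _ _ P H (fun u o => Num.min 1 (expR (- u)) * cos (u * z o)) 1) => //.
- apply: measurable_funM.
    apply: (measurableT_comp (f := fun u : R => Num.min 1 (expR (- u)))) => //.
    apply: measurable_minr => //; apply: measurableT_comp => //; exact: measurableT_comp.
  apply: (measurableT_comp (continuous_measurable_fun (@continuous_cos R))).
  apply: measurable_funM => //; exact: (measurableT_comp mz measurable_fst).
- move=> u o; rewrite normrM -[leRHS]mulr1 ler_pM// ?cos_max//.
  by rewrite ger0_norm ?le_min ?ler01 ?expR_ge0// ge_min lexx.
- move=> u /andP[u0 _].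
  have := H0 (u * s * b) (- (u * s)) => E0.
  have mc : integ (fun o => H o * cos (u * s * b + - (u * s) * Y o)).
    apply: (integ_bounded (k := 1)) => //; last by move=> o; exact: cos_max.
    by apply: mcos; exact: measurable_funM.
  rewrite (_ : (fun o => _) = fun o => Num.min 1 (expR (- u)) * (H o * cos (u * s * b + - (u * s) * Y o))); last first.
    apply/funext => o; rewrite /z mulrCA; congr (_ * (_ * cos _)); ring.
  by rewrite RintegralZl// E0 mulr0.
Qed.

(** The Poisson kernel is integrated in its location b. *)
Lemma atan_zero (s a b : R) : a <= b ->
  E (fun o => H o * (atan (s * (b - Y o)) - atan (s * (a - Y o)))) = 0.
Proof.
move=> ab.
have datan o (x : R) : is_derive x 1 (fun x => atan (s * (x - Y o))) (s * (1 + (s * (x - Y o)) ^+ 2)^-1).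
  have /is_derive_eq := der_comp (is_derive1_atan _) (derZ s (derB (is_derive_id x (1 : R)) (is_derive_cst (Y o) x 1))).
  by apply; rewrite subr0 mulr1 mulrC.
have cinv o : continuous (fun x : R => s * (1 + (s * (x - Y o)) ^+ 2)^-1).
  apply: contZ => x; apply: cvgV; first by rewrite gt_eqF// ltr_wpDr ?sqr_ge0.
  have c : continuous (fun x : R => s * (x - Y o)).
    by apply: contZ; apply: contB => y; [exact: cvg_id|exact: cvg_cst].
  by apply: cvgD; [exact: cvg_cst|apply: cvgM; exact: c].
have -> : (fun o => H o * (atan (s * (b - Y o)) - atan (s * (a - Y o)))) =
    (fun o => H o * \int[leb]_(x in `[a, b]) (s * (1 + (s * (x - Y o)) ^+ 2)^-1)).
  by apply/funext => o; rewrite (FTC_global (datan o) (cinv o)).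
apply: (@fubini_zero _ _ _ P H (fun x o => s * (1 + (s * (x - Y o)) ^+ 2)^-1) `|s|) => //.
- apply: measurable_funM => //.
  have cg : continuous (fun x : R => (1 + x ^+ 2)^-1).
    move=> x; apply: cvgV; first by rewrite gt_eqF// ltr_wpDr ?sqr_ge0.
    by apply: cvgD; [exact: cvg_cst|apply: cvgM; exact: cvg_id].
  apply: (measurableT_comp (continuous_measurable_fun cg)).
  apply: measurable_funM => //; apply: measurable_funB => //.
  exact: (measurableT_comp mY measurable_fst).
- move=> x o; rewrite normrM normfV ler_piMr// invf_le1.
    by rewrite ger0_norm ?lerDl ?addr_ge0 ?sqr_ge0.
  by rewrite normr_gt0 gt_eqF// ltr_wpDr ?sqr_ge0.
- move=> x _; have := poisson_zero s x => E0.
  rewrite (_ : (fun o => _) = fun o => s * (H o * (1 + (s * (x - Y o)) ^+ 2)^-1)); last first.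
    by apply/funext => o; ring.
  rewrite RintegralZl//; first by rewrite E0 mulr0.
  have cg : continuous (fun x : R => (1 + x ^+ 2)^-1).
    move=> y; apply: cvgV; first by rewrite gt_eqF// ltr_wpDr ?sqr_ge0.
    by apply: cvgD; [exact: cvg_cst|apply: cvgM; exact: cvg_id].
  apply: (integ_bounded (k := 1)) => //.
    apply: (mcst_comp cg); apply: measurable_funM => //; exact: measurable_funB.
  move=> o; rewrite normfV invf_le1.
    by rewrite ger0_norm ?lerDl ?addr_ge0 ?sqr_ge0.
  by rewrite normr_gt0 gt_eqF// ltr_wpDr ?sqr_ge0.
Qed.

Lemma norm_atan_le (x : R) : `|atan x| <= pi / 2.
Proof. by rewrite ler_norml ltW ?atan_gtNpi2// ltW ?atan_ltpi2. Qed.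

Let matan (f : Omega -> R) : measurable_fun setT f -> measurable_fun setT (fun o => atan (f o)).
Proof. by apply: mcst_comp => x; exact: continuous_atan. Qed.

Lemma cvg_atan_infty (u : nat -> R) : (forall A : R, \forall n \near \oo, A <= u n) ->
  atan (u n) @[n --> \oo] --> pi / 2.
Proof.
move=> uA; apply: (cvg_comp u (@atan R) _ (@cvgy_atan R)).
by apply/cvgryPge.
Qed.

(** Letting a tend to minus infinity in [atan_zero] gives the function
atan(s (c - Y)) + pi / 2; a scale s growing faster than c approaches b from
below makes it tend to pi times the indicator of Y < b. *)
Lemma half_line_zero (b : R) : E (fun o => H o * \1_[set x | x < b] (Y o)) = 0.
Proof.
have pi0 : 0 <= pi / 2 :> R by rewrite divr_ge0// pi_ge0.
have step1 (s c : R) : 0 < s -> E (fun o => H o * (atan (s * (c - Y o)) + pi / 2)) = 0.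
  move=> s0.
  apply: (@weighted_dct0 H (fun n o => atan (s * (c - Y o)) - atan (s * (c - n%:R - Y o))) _ pi IH).
  - move=> n; apply: measurable_funB; apply: matan; apply: measurable_funM => //; exact: measurable_funB.
  - move=> n o; apply: (le_trans (ler_normB _ _)).
    have := norm_atan_le (s * (c - Y o)); have := norm_atan_le (s * (c - n%:R - Y o)); lra.
  - move=> o; apply: cvgD; first exact: cvg_cst.
    under eq_fun do rewrite -atanN.
    apply: cvg_atan_infty => A.
    exists (Num.bound (`|A| / s + `|c - Y o|)) => // n /= Hn.
    have h0 : 0 <= `|A| / s + `|c - Y o| by rewrite addr_ge0// divr_ge0// ltW.
    have : `|A| / s + `|c - Y o| <= n%:R.
      by apply: (le_trans (ltW (archi_boundP h0))); rewrite ler_nat.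
    move=> h1; have : `|A| <= s * (n%:R - `|c - Y o|).
      by rewrite mulrC -ler_pdivrMr//; lra.
    have : s * (n%:R - `|c - Y o|) <= s * (n%:R - (c - Y o)).
      by rewrite ler_pM2l// lerB// ler_norm.
    have -> : - (s * (c - n%:R - Y o)) = s * (n%:R - (c - Y o)) by ring.
    have := ler_norm A; lra.
  - by move=> n; apply: atan_zero; rewrite gerBl.
have H2 : E (fun o => H o * (pi * \1_[set x | x < b] (Y o))) = 0.
  (* Scale n^2 at c = b - 1/n: on the event Y = b the argument is - n, so the
       limit there is 0 and the strict inequality is obtained. *)
  pose t (n : nat) o := (n.+1%:R) ^+ 2 * (b - (n.+1%:R)^-1 - Y o).
  apply: (@weighted_dct0 H (fun n o => atan (t n o) + pi / 2) _ pi IH).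
  - move=> n; apply: measurable_funD => //; apply: matan; apply: measurable_funM => //; exact: measurable_funB.
  - move=> n o; apply: (le_trans (ler_normD _ _)); rewrite (ger0_norm pi0).
    have := norm_atan_le (t n o); lra.
  - move=> o; have tE n : t n o = n.+1%:R * (n.+1%:R * (b - Y o) - 1).
      have n0 : (n.+1%:R : R) != 0 by rewrite pnatr_eq0.
      by rewrite /t; move: (n.+1%:R : R) n0 => N N0; field.
    have [yb|yb] := ltP (Y o) b.
      rewrite indicE mem_set//= mulr1.
      suff h : atan (t n o) @[n --> \oo] --> pi / 2.
        have Hh := cvgD h (cvg_cst (pi / 2)).
        have E2 : pi / 2 + pi / 2 = pi :> R by field.
        rewrite E2 in Hh; exact: Hh.
      apply: cvg_atan_infty => A; have p0 : 0 < b - Y o by rewrite subr_gt0.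
      exists (Num.bound ((`|A| + 1) / (b - Y o))) => // n /= Hn.
      have h0 : 0 <= (`|A| + 1) / (b - Y o) by rewrite divr_ge0 ?ltW// ltr_wpDl.
      have : (`|A| + 1) / (b - Y o) <= n.+1%:R.
        by apply: (le_trans (ltW (archi_boundP h0))); rewrite ler_nat (leq_trans Hn).
      rewrite ler_pdivrMr// => h1; rewrite tE.
      have h2 : `|A| <= n.+1%:R * (b - Y o) - 1 by lra.
      apply: (le_trans (ler_norm A)); apply: (le_trans h2).
      by rewrite ler_peMl ?ler1n// (le_trans _ h2).
    rewrite indicE memNset/=; last by apply/negP; rewrite -leNgt.
    rewrite mulr0.
    suff h : atan (t n o) @[n --> \oo] --> - (pi / 2).
      have Hh := cvgD h (cvg_cst (pi / 2)); rewrite addNr in Hh; exact: Hh.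
    under eq_fun do rewrite -[t _ o]opprK atanN.
    apply: cvgN; apply: cvg_atan_infty => A.
    exists (Num.bound `|A|) => // n /= Hn.
    apply: (le_trans (ler_norm A)); apply: (le_trans (ltW (archi_boundP (normr_ge0 A)))).
    apply: (@le_trans _ _ n.+1%:R); first by rewrite ler_nat (leq_trans Hn).
    rewrite tE -mulrN ler_peMr// opprB lerBrDr.
    by rewrite gerDl// mulr_ge0_le0// subr_le0.
  - by move=> n; apply: step1; rewrite exprn_gt0.
have I1 : integ (fun o => H o * \1_[set x | x < b] (Y o)).
  apply: (integ_bounded (k := 1)) => //.
    apply: (measurableT_comp _ mY); apply: measurable_indic.
    by rewrite (_ : [set x | x < b] = `]-oo, b[%classic)//; apply/seteqP; split => x; rewrite /= in_itv.
  by move=> o; rewrite indicE; case: (_ \in _); rewrite ?normr1 ?normr0.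
move: H2; rewrite (_ : (fun o => _) = fun o => pi * (H o * \1_[set x | x < b] (Y o))); last first.
  by apply/funext => o; ring.
by rewrite RintegralZl// => /eqP; rewrite mulf_eq0 gt_eqF ?pi_gt0//= => /eqP.
Qed.

End one_dim.

End fourier.

(** * Fourier transforms and generated sigma-algebras *)

Section sigma.
Context (d : measure_display) (Omega : measurableType d) (R : realType).
Variable P : probability Omega R.
Local Notation E f := (\int[P]_o f o).
Implicit Types (X H : Omega -> R).
Local Notation integ f := (P.-integrable setT (EFin \o f)).

Lemma integ_set H (A : set Omega) : measurable A -> integ H -> P.-integrable A (EFin \o H).
Proof. by move=> mA; apply: integrableS. Qed.

Lemma integral_indicM H (A : set Omega) : measurable A -> integ H ->
  (\int[P]_(o in A) (H o)%:E = (E (fun o => H o * \1_A o))%:E)%E.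
Proof.
move=> mA IH; rewrite /Rintegral fineK.
  rewrite [LHS]integral_mkcond; apply: eq_integral => o _.
  by rewrite patchE indicE; case: ifPn => _; rewrite ?mulr1 ?mulr0.
apply: integrable_fin_num => //; apply: (integ_bounded (k := 1)) => //.
by move=> o; rewrite indicE; case: (_ \in _); rewrite ?normr1 ?normr0.
Qed.

Lemma integral_setC0 H (S : set Omega) : measurable S -> integ H ->
  (\int[P]_o (H o)%:E = 0)%E -> (\int[P]_(o in S) (H o)%:E = 0)%E ->
  (\int[P]_(o in ~` S) (H o)%:E = 0)%E.
Proof.
move=> mS IH H0 S0.
have dS : [disjoint S & ~` S] by apply/disj_setPCl.
have mH : measurable_fun (S `|` ~` S) (EFin \o H).
  by rewrite setUv; exact: measurable_int IH.
have := @integral_setU _ Omega R P S (~` S) (EFin \o H) mS (measurableC mS) mH dS.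
by rewrite setUv/= H0 S0 add0e.
Qed.

Lemma integral_bigcup0 H (F : (set Omega)^nat) : (forall k, measurable (F k)) ->
  trivIset setT F -> integ H -> (forall k, (\int[P]_(o in F k) (H o)%:E = 0)%E) ->
  (\int[P]_(o in \bigcup_k F k) (H o)%:E = 0)%E.
Proof.
move=> mF tF IH F0; rewrite integral_bigcup//.
  by rewrite eseries0// => k _ _; exact: F0.
by apply: integ_set => //; exact: bigcupT_measurable.
Qed.

Lemma sigma_sub_measurable (G : set (set Omega)) : G `<=` measurable ->
  <<s G >> `<=` measurable.
Proof. by move=> GM; apply: smallest_sub => //; exact: sigma_algebra_measurable. Qed.

(** Dynkin's pi-lambda theorem. *)
Lemma zero_on_sigma H (G : set (set Omega)) : integ H -> G `<=` measurable ->
  setI_closed G -> (\int[P]_o (H o)%:E = 0)%E ->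
  (forall A, G A -> (\int[P]_(o in A) (H o)%:E = 0)%E) ->
  forall A, <<s G >> A -> (\int[P]_(o in A) (H o)%:E = 0)%E.
Proof.
move=> IH GM GI H0 HG.
have sub := sigma_sub_measurable GM.
apply: (@dynkin_induction _ (g_sigma_algebraType G) G
   (fun A => (\int[P]_(o in (A : set Omega)) (H o)%:E = 0)%E)) => //.
- by move=> S mS; apply: integral_setC0 => //; exact: sub.
- by move=> F mF tF F0; apply: integral_bigcup0 => // k; exact: (sub _ (mF k)).
Qed.

Section family.
Variables (m : nat) (Y : 'I_m -> Omega -> R).
Hypothesis mY : forall j, measurable_fun setT (Y j).

Definition lin (l : seq (R * 'I_m)) o := \sum_(p <- l) p.1 * Y p.2 o.

(** The signed measure H dP has an image under Y with vanishing Fourier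
transform; the phase th covers sines and cosines at once. *)
Definition fourier_null H := forall (th : R) l, E (fun o => H o * cos (th + lin l o)) = 0.

Lemma mlin l : measurable_fun setT (lin l).
Proof. by apply: measurable_sum => p; exact: measurable_funM. Qed.

Lemma integ_cos H (th : R) l : integ H -> integ (fun o => H o * cos (th + lin l o)).
Proof.
move=> IH; apply: (integ_bounded (k := 1)) => //; last by move=> o; exact: cos_max.
by apply: mcos; exact: mlin.
Qed.

Lemma lin_cons t j l o : lin ((t, j) :: l) o = t * Y j o + lin l o.
Proof. by rewrite /lin big_cons. Qed.

Lemma mhalf (j : 'I_m) (b : R) : measurable_fun setT (fun o => \1_[set x | x < b] (Y j o) : R).
Proof.
apply: (measurableT_comp _ (mY j)); apply: measurable_indic.
by rewrite (_ : [set x | x < b] = `]-oo, b[%classic)//; apply/seteqP; split => x; rewrite /= in_itv.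
Qed.

Lemma half_le1 (j : 'I_m) (b : R) o : `|\1_[set x | x < b] (Y j o) : R| <= 1.
Proof. by rewrite indicE; case: (_ \in _); rewrite ?normr1 ?normr0. Qed.

(** The product formula for cosines shows that H cos(th + l(Y)) has vanishing
cosine integrals against Y j, so [half_line_zero] applies to it. The property
is thus preserved by restriction to a half space, and can be iterated over
the coordinates. *)
Lemma fourier_null_half H j (b : R) : integ H -> fourier_null H ->
  fourier_null (fun o => H o * \1_[set x | x < b] (Y j o)).
Proof.
move=> IH H0 th l.
have := @half_line_zero _ Omega R P (fun o => H o * cos (th + lin l o)) (Y j) (integ_cos th l IH) (mY j) _ b.
rewrite (_ : (fun o => H o * cos (th + lin l o) * _) =
  (fun o => H o * \1_[set x | x < b] (Y j o) * cos (th + lin l o))); last first.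
  by apply/funext => o; ring.
apply => th' u.
rewrite (_ : (fun o => _) = fun o => 2^-1 * (H o * cos (th + th' + lin ((u, j) :: l) o)) +
   2^-1 * (H o * cos (th - th' + lin ((- u, j) :: l) o))); last first.
  apply/funext => o; rewrite !lin_cons.
  set p := th + lin l o; set q := th' + u * Y j o.
  rewrite (_ : th + th' + _ = p + q); last by rewrite /p /q; ring.
  rewrite (_ : th - th' + _ = p - q); last by rewrite /p /q; ring.
  by rewrite cosD cosB; field.
rewrite RintegralD//; last 2 first.
- exact: (integrableZl measurableT 2^-1 (integ_cos _ _ IH)).
- exact: (integrableZl measurableT 2^-1 (integ_cos _ _ IH)).
by rewrite !RintegralZl ?H0 ?mulr0 ?addr0//; exact: integ_cos.
Qed.

Definition box (l : seq ('I_m * R)) : set Omega := [set o | all (fun p => Y p.1 o < p.2) l].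

Lemma box_cons j b l : box ((j, b) :: l) = (Y j @^-1` [set x | x < b]) `&` box l.
Proof. by apply/seteqP; split => o; [move=> /andP[]|move=> [? ?]; apply/andP]. Qed.

Lemma box_nil : box [::] = setT. Proof. by apply/seteqP; split. Qed.

Lemma box_measurable l : measurable (box l).
Proof.
elim: l => [|[j b] l IHl]; first by rewrite box_nil.
rewrite box_cons; apply: measurableI => //; rewrite -[X in measurable X]setTI; apply: mY => //.
by rewrite (_ : [set x | x < b] = `]-oo, b[%classic)//; apply/seteqP; split => x; rewrite /= in_itv.
Qed.

Lemma fourier_null_box H l : integ H -> fourier_null H -> E (fun o => H o * \1_(box l) o) = 0.
Proof.
elim: l H => [|[j b] l IHl] H IH H0.
  rewrite box_nil; have := H0 0 [::].
  congr (_ = _); apply: eq_Rintegral => o _.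
  by rewrite /lin big_nil addr0 cos0 indicE mem_set.
rewrite (_ : (fun o => _) = fun o => H o * \1_[set x | x < b] (Y j o) * \1_(box l) o).
  apply: IHl; last exact: fourier_null_half.
  by apply: (integ_bounded (k := 1)) => //; [exact: mhalf|exact: half_le1].
by apply/funext => o; rewrite box_cons indicI/= mulrA.
Qed.

(** Uniqueness of Fourier transforms in several variables: the boxes form a
pi-system generating the sigma-algebra of Y. *)
Lemma fourier_null_sigma H : integ H -> fourier_null H -> forall A, generated_sigma Y A ->
  (\int[P]_(o in A) (H o)%:E = 0)%E.
Proof.
move=> IH H0 A GA.
pose G := [set B | exists l, B = box l].
have GM : G `<=` measurable by move=> _ [l ->]; exact: box_measurable.
have GI : setI_closed G.
  move=> _ _ [l1 ->] [l2 ->]; exists (l1 ++ l2).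
  apply/seteqP; split => o; rewrite /box /= all_cat; first by move=> [-> ->].
  by move=> /andP[].
have HG B : G B -> (\int[P]_(o in B) (H o)%:E = 0)%E.
  by move=> [l ->]; rewrite integral_indicM//; [rewrite fourier_null_box|exact: box_measurable].
apply: (zero_on_sigma IH GM GI) => //.
  by rewrite -box_nil; apply: HG; exists [::].
move: A GA; apply: smallest_sub; first exact: smallest_sigma_algebra.
move=> _ [j _ [B mB <-]].
have mYG : measurable_fun (setT : set (g_sigma_algebraType G)) (Y j : g_sigma_algebraType G -> R).
  apply: (measurability _ (RGenInftyO.measurableE R)) => _ [_ [b ->] <-].
  rewrite setTI; apply: sub_sigma_algebra; exists [:: (j, b)].
  by rewrite box_cons box_nil setIT; congr (_ @^-1` _); apply/seteqP; split => x; rewrite /= in_itv.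
by have := mYG measurableT B mB.
Qed.

End family.
End sigma.

(** * Gaussian variables and residuals *)

(** A row is in the row space of a matrix when it kills the kernel. This is how
the normal equations are solved when the Gram matrix is singular. *)
Lemma gram_solvable (R : fieldType) (m : nat) (G : 'M[R]_m) (b : 'rV[R]_m) :
  (forall v : 'cV[R]_m, G *m v = 0 -> b *m v = 0) -> exists a : 'rV[R]_m, a *m G = b.
Proof.
move=> H; have : (b <= G)%MS.
  rewrite submxE; apply/eqP/rowP => j; rewrite [RHS]mxE.
  have E : G *m (cokermx G *m delta_mx j (0 : 'I_1)) = 0.
    by rewrite mulmxA mulmx_coker mul0mx.
  by have := H _ E; rewrite mulmxA -colE => /matrixP/(_ 0 0); rewrite [LHS]mxE [RHS]mxE.
by move=> /submxP [a ->]; exists a.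
Qed.

Section cond.
Context (d : measure_display) (Omega : measurableType d) (R : realType).
Variable P : probability Omega R.
Local Notation E f := (\int[P]_o f o).
Implicit Types (X Y Z H : Omega -> R).
Local Notation integ f := (P.-integrable setT (EFin \o f)).
Local Notation sqint := (L2 P setT).
Local Notation cov := (ip P setT).
Local Notation mT := (@measurableT _ Omega).

Lemma L2_cst (k : R) : sqint (fun=> k).
Proof. by split => //; exact: prob_integ_cst. Qed.

Lemma L2_integ Z : sqint Z -> integ Z.
Proof.
move=> LZ; have := L2_intM mT LZ (L2_cst 1).
by apply: eq_integrable => // o _; rewrite /= mulr1.
Qed.

(** Centred Gaussian variables, possibly degenerate, through their
characteristic function, a description that passes to mean-square limits. *)
Definition gaussian Z := sqint Z /\
  forall th : R, E (fun o => cos (th + Z o)) = cos th * expR (- (cov Z Z / 2)).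

Lemma integ_cosZ (th : R) Z : measurable_fun setT Z -> integ (fun o => cos (th + Z o)).
Proof.
move=> mZ; have := integ_bounded (k := 1) (mcos th mZ) (fun o => cos_max _) (prob_integ_cst P 1).
by apply: eq_integrable => // o _; rewrite /= mul1r.
Qed.

(** The cosine is 1-Lipschitz, so its integrals are continuous for the norm of
L^2. *)
Lemma gaussian_lim Z (Zn : nat -> Omega -> R) : sqint Z -> (forall n, gaussian (Zn n)) ->
  cov (fun o => Z o - Zn n o) (fun o => Z o - Zn n o) @[n --> \oo] --> 0 -> gaussian Z.
Proof.
move=> LZ GZ c0; have LZn n : sqint (Zn n) := (GZ n).1.
split => // th.
have cvar : cov (Zn n) (Zn n) @[n --> \oo] --> cov Z Z by apply: cvg_ip.
have cexp : cos th * expR (- (cov (Zn n) (Zn n) / 2)) @[n --> \oo] --> cos th * expR (- (cov Z Z / 2)).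
  apply: cvgM; first exact: cvg_cst.
  apply: (cvg_comp _ (@expR R) _ (@continuous_expR R _)).
  by apply: cvgN; apply: cvgM => //; exact: cvg_cst.
have csq : Num.sqrt (cov (fun o => Z o - Zn n o) (fun o => Z o - Zn n o)) @[n --> \oo] --> 0.
  by rewrite -[X in _ --> X](@sqrtr0 R); apply: cvg_comp c0 _; exact: sqrt_continuous.
have bnd n : `|E (fun o => cos (th + Z o)) - cos th * expR (- (cov (Zn n) (Zn n) / 2))| <=
    Num.sqrt (cov (fun o => Z o - Zn n o) (fun o => Z o - Zn n o)).
  have LD := L2B mT LZ (LZn n).
  rewrite -(GZ n).2 -RintegralB//; last 2 first.
  - by apply: integ_cosZ; exact: LZ.1.
  - by apply: integ_cosZ; exact: (LZn n).1.
  apply: (le_trans (le_normr_Rintegral _ _)) => //.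
    have := integrableB mT (integ_cosZ th LZ.1) (integ_cosZ th (LZn n).1); exact.
  have LA : sqint (fun o => `|Z o - Zn n o|).
    split; first by apply: measurableT_comp => //; exact: LD.1.
    apply: eq_integrable LD.2 => // o _ /=.
    by rewrite real_normK ?num_real.
  apply: (@le_trans _ _ (cov (fun o => `|Z o - Zn n o|) (fun=> 1))).
    apply: le_Rintegral => //.
    - have := integrable_abse (integrableB mT (integ_cosZ th LZ.1) (integ_cosZ th (LZn n).1)).
      by apply: eq_integrable.
    - by apply: (L2_intM mT LA (L2_cst 1)).
    - move=> o _; rewrite mulr1; apply: (le_trans (ler_dist_cos _ _)).
      by rewrite opprD addrACA subrr add0r.
  apply: (le_trans (ler_norm _)); apply: (le_trans (ip_le_sqrt mT LA (L2_cst 1))).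
  have -> : cov (fun=> 1) (fun=> 1) = 1.
    by rewrite /ip mulr1 Rintegral_cst//= probability_setT mul1r.
  rewrite sqrtr1 mulr1 le_eqVlt; apply/orP; left; apply/eqP; congr Num.sqrt.
  by apply: eq_Rintegral => o _; rewrite -!expr2 real_normK ?num_real.
have c' : cos th * expR (- (cov (Zn n) (Zn n) / 2)) @[n --> \oo] --> E (fun o => cos (th + Z o)).
  apply/cvgrPdist_le => e e0.
  move/cvgrPdist_le : csq => /(_ e e0); apply: filterS => n.
  rewrite sub0r normrN ger0_norm ?sqrtr_ge0// => H; exact: le_trans (bnd n) H.
exact: cvg_unique c' cexp.
Qed.

Section residual.
Variables (m : nat) (Y : 'I_m -> Omega -> R) (r : Omega -> R).
Hypothesis LY : forall j, sqint (Y j).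
Hypothesis Lr : sqint r.
Hypothesis orth : forall j, cov r (Y j) = 0.
Hypothesis Gr : forall (s : R) l, gaussian (fun o => s * r o + lin Y l o).
Let v := cov r r.

Let mY j : measurable_fun setT (Y j). Proof. exact: (LY j).1. Qed.

Lemma L2_lin l : sqint (lin Y l).
Proof. by apply: (@L2_sum _ _ _ P setT mT _ l xpredT (fun p o => p.1 * Y p.2 o)) => p _; exact: L2Z. Qed.

Lemma cov_lin l : cov r (lin Y l) = 0.
Proof.
rewrite /lin (@ip_sumr _ _ _ P setT mT _ l xpredT (fun p o => p.1 * Y p.2 o))//.
  by rewrite big1// => p _; rewrite ipZr// orth mulr0.
by move=> p _; exact: L2Z.
Qed.

(** The variance of s r + l(Y) is the sum of the two variances because r is
orthogonal to Y; hence the exponential factors. *)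
Lemma char_res (s th : R) l : E (fun o => cos (th + (s * r o + lin Y l o))) =
  expR (- (s ^+ 2 * v / 2)) * E (fun o => cos (th + lin Y l o)).
Proof.
rewrite (Gr s l).2.
have G0 := Gr 0 l; rewrite (_ : (fun o => 0 * r o + lin Y l o) = lin Y l) in G0; last first.
  by apply/funext => o; rewrite mul0r add0r.
rewrite G0.2 mulrCA -expRD; congr (_ * expR _).
have Ls := L2Z mT s Lr; have Ll := L2_lin l.
rewrite ipDl ?ipDr ?ipZl ?ipZr ?cov_lin//; try exact: L2D.
by rewrite [cov (lin Y l) r]ipC cov_lin -/v; field.
Qed.

Let mlinY l : measurable_fun setT (lin Y l). Proof. exact: mlin. Qed.

Let icos (th : R) l : integ (fun o => cos (th + lin Y l o)).
Proof. exact: integ_cosZ. Qed.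

(** By [char_res] the integral of cos(th + s r + l(Y)) is even in s, so that
sin(s r) is orthogonal to every cosine of Y; divide by s and let s tend
to 0. *)
Lemma fourier_null_res : fourier_null P Y r.
Proof.
move=> th l; pose p := pi / 2 : R.
have shift z : cos (th + z) = - sin ((th - p) + z).
  have -> : th + z = (th - p + z) + p by ring.
  by rewrite cosD cos_pihalf sin_pihalf; ring.
have mr : measurable_fun setT r := Lr.1.
have ms s : measurable_fun setT (fun o => s * r o) by exact: measurable_funM.
have i2 (s t : R) : integ (fun o => cos (t + (s * r o + lin Y l o))).
  by apply: integ_cosZ; exact: measurable_funD.
have z s : E (fun o => sin (s * r o) * cos (th + lin Y l o)) = 0.
  pose t := th - p.
  have := char_res s t l; have := char_res (- s) t l; rewrite sqrrN => <- H.
  have : E (fun o => 2^-1 * (cos (t + (s * r o + lin Y l o)) - cos (t + (- s * r o + lin Y l o)))) = 0.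
    rewrite RintegralZl//; last by have := integrableB mT (i2 s t) (i2 (- s) t); exact.
    by rewrite RintegralB// H subrr mulr0.
  move=> <-; apply: eq_Rintegral => o _; rewrite shift -/t.
  rewrite (_ : t + (s * r o + lin Y l o) = (t + lin Y l o) + s * r o); last by ring.
  rewrite (_ : t + (- s * r o + lin Y l o) = (t + lin Y l o) - s * r o); last by ring.
  by rewrite cosD cosB; field.
have [_ cv] : integ (fun o => r o * cos (th + lin Y l o)) /\
   E (fun o => n.+1%:R * sin ((n.+1%:R)^-1 * r o) * cos (th + lin Y l o)) @[n --> \oo] -->
   E (fun o => r o * cos (th + lin Y l o)).
  apply: (@Rintegral_dct _ Omega R P setT mT (fun n o => n.+1%:R * sin ((n.+1%:R)^-1 * r o) * cos (th + lin Y l o)) _ (fun o => `|r o|)).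
  - move=> n; apply: measurable_funM; last exact: mcos.
    by apply: measurable_funM => //; apply: (measurableT_comp (continuous_measurable_fun (@continuous_sin R))).
  - by move=> o _; apply: cvgM; [exact: cvg_sin_quot|exact: cvg_cst].
  - exact: (integrable_abse (L2_integ Lr)).
  - move=> n o _; rewrite normrM -[leRHS]mulr1 ler_pM// ?cos_max//; exact: sin_quot_bound.
have c0 : E (fun o => n.+1%:R * sin ((n.+1%:R)^-1 * r o) * cos (th + lin Y l o)) @[n --> \oo] --> (0 : R).
  under eq_fun => n.
    under eq_Rintegral do rewrite -mulrA.
    rewrite RintegralZl//; last first.
      apply: (integ_bounded (k := 1)); [exact: mcos|by move=> o; exact: cos_max|].
      have := integ_bounded (k := 1) (measurableT_comp (continuous_measurable_fun (@continuous_sin R)) (ms (n.+1%:R)^-1)) (fun o => sin_max _) (prob_integ_cst P 1).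
      by apply: eq_integrable => // o _; rewrite /= mul1r.
    rewrite z mulr0; over.
  exact: cvg_cst.
exact: cvg_unique cv c0.
Qed.

(** The second difference in s of the identity [char_res] at 0: the left side
yields r^2, the right side the variance v. *)
Lemma fourier_null_res2 : fourier_null P Y (fun o => r o ^+ 2 - v).
Proof.
move=> th l.
have mr : measurable_fun setT r := Lr.1.
have ms s : measurable_fun setT (fun o => s * r o) by exact: measurable_funM.
have i2 (s t : R) : integ (fun o => cos (t + (s * r o + lin Y l o))).
  by apply: integ_cosZ; exact: measurable_funD.
pose c := E (fun o => cos (th + lin Y l o)).
have z s : E (fun o => (1 - cos (s * r o)) * cos (th + lin Y l o)) = (1 - expR (- (v / 2 * s ^+ 2))) * c.
  have H1 := char_res s th l; have H2 := char_res (- s) th l.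
  transitivity (E (fun o => cos (th + lin Y l o) - 2^-1 *
     (cos (th + (s * r o + lin Y l o)) + cos (th + (- s * r o + lin Y l o))))).
    apply: eq_Rintegral => o _.
    rewrite (_ : th + (s * r o + lin Y l o) = (th + lin Y l o) + s * r o); last by ring.
    rewrite (_ : th + (- s * r o + lin Y l o) = (th + lin Y l o) - s * r o); last by ring.
    by move: (th + lin Y l o) => q; rewrite cosD cosB; field.
  have i3 := integrableD mT (i2 s th) (i2 (- s) th).
  rewrite RintegralB//; last exact: (integrableZl mT 2^-1 i3).
  rewrite RintegralZl//.
  rewrite RintegralD// H1 H2 sqrrN -/c (_ : v / 2 * s ^+ 2 = s ^+ 2 * v / 2); last by ring.
  by field.
have ir2 : integ (fun o => r o ^+ 2) := Lr.2.
have ir2c : integ (fun o => r o ^+ 2 * cos (th + lin Y l o)).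
  by apply: (integ_bounded (k := 1)) => //; [exact: mcos|move=> o; exact: cos_max].
have [_ cv] : integ (fun o => r o ^+ 2 / 2 * cos (th + lin Y l o)) /\
   E (fun o => n.+1%:R ^+ 2 * (1 - cos ((n.+1%:R)^-1 * r o)) * cos (th + lin Y l o)) @[n --> \oo] -->
   E (fun o => r o ^+ 2 / 2 * cos (th + lin Y l o)).
  apply: (@Rintegral_dct _ Omega R P setT mT (fun n o => n.+1%:R ^+ 2 * (1 - cos ((n.+1%:R)^-1 * r o)) * cos (th + lin Y l o)) _ (fun o => r o ^+ 2)) => //.
  - move=> n; apply: measurable_funM; last exact: mcos.
    apply: measurable_funM => //; apply: measurable_funB => //.
    by apply: (measurableT_comp (continuous_measurable_fun (@continuous_cos R))).
  - by move=> o _; apply: cvgM; [exact: cvg_cos_quot|exact: cvg_cst].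
  - move=> n o _; rewrite normrM -[leRHS]mulr1 ler_pM// ?cos_max//; exact: cos_quot_bound.
have v0 : 0 <= v / 2 by rewrite divr_ge0// ip_ge0.
have c0 : E (fun o => n.+1%:R ^+ 2 * (1 - cos ((n.+1%:R)^-1 * r o)) * cos (th + lin Y l o)) @[n --> \oo] --> v / 2 * c.
  under eq_fun => n.
    under eq_Rintegral do rewrite -mulrA.
    rewrite RintegralZl//; last first.
      apply: (integ_bounded (k := 1)); [exact: mcos|by move=> o; exact: cos_max|].
      have mc : measurable_fun setT (fun o => cos ((n.+1%:R)^-1 * r o)).
        by apply: (measurableT_comp (continuous_measurable_fun (@continuous_cos R))).
      have := integ_bounded (k := 1) mc (fun o => cos_max _) (prob_integ_cst P 1) => ic.
      have := integrableB mT (prob_integ_cst P 1) ic.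
      by apply: eq_integrable => // o _; rewrite /= mul1r.
    rewrite z mulrA; over.
  by apply: cvgM; [exact: cvg_exp_quot|exact: cvg_cst].
have E1 : E (fun o => r o ^+ 2 / 2 * cos (th + lin Y l o)) = v / 2 * c by exact: cvg_unique cv c0.
have E2 : E (fun o => r o ^+ 2 * cos (th + lin Y l o)) = v * c.
  have : 2^-1 * E (fun o => r o ^+ 2 * cos (th + lin Y l o)) = v / 2 * c.
    rewrite -E1; transitivity (E (fun o => 2^-1 * (r o ^+ 2 * cos (th + lin Y l o)))).
      by rewrite RintegralZl.
    by apply: eq_Rintegral => o _; ring.
  by move=> H; apply: (@mulfI _ 2^-1) => //; rewrite H; ring.
under eq_Rintegral do rewrite mulrBl.
rewrite RintegralB//; last by exact: (integrableZl mT v (icos th l)).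
by rewrite RintegralZl// -/c E2 subrr.
Qed.

End residual.

End cond.

(** * Conditional variance in a Gaussian family *)

Lemma fin_sub0 (R : realType) (x y : \bar R) : x \is a fin_num -> y \is a fin_num ->
  (x - y = 0)%E -> x = y.
Proof.
move=> fx fy; rewrite -(fineK fx) -(fineK fy) -EFinB => -[] /eqP.
by rewrite subr_eq0 => /eqP ->.
Qed.

Section condexp.
Context (d : measure_display) (Omega : measurableType d) (R : realType).
Variable P : probability Omega R.
Local Notation E f := (\int[P]_o f o).
Implicit Types (X Y Z H : Omega -> R).
Local Notation integ f := (P.-integrable setT (EFin \o f)).
Local Notation sqint := (L2 P setT).
Local Notation cov := (ip P setT).
Local Notation mT := (@measurableT _ Omega).

Lemma sigma_meas_fun (G : set (set Omega)) Z :
  (forall B : set R, measurable B -> <<s G >> (Z @^-1` B)) <->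
  measurable_fun (setT : set (g_sigma_algebraType G)) (Z : g_sigma_algebraType G -> R).
Proof.
split=> [H _ B mB|H B mB]; first by rewrite setTI; exact: H.
by have := H measurableT B mB; rewrite setTI.
Qed.

Lemma sub_meas_fun (G : set (set Omega)) Z : G `<=` measurable ->
  (forall B : set R, measurable B -> <<s G >> (Z @^-1` B)) -> measurable_fun setT Z.
Proof.
move=> GM H _ B mB; rewrite setTI; apply: (sigma_sub_measurable GM); exact: H.
Qed.

(** The event that Z1 exceeds Z2 belongs to the sigma-algebra, and the integral
of Z1 - Z2 over it is zero. *)
Lemma cond_exp_le_ae (G : set (set Omega)) X Z1 Z2 : G `<=` measurable ->
  is_cond_exp P <<s G >> X Z1 -> is_cond_exp P <<s G >> X Z2 ->
  {ae P, forall o, Z1 o <= Z2 o}.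
Proof.
move=> GM [m1 i1 e1] [m2 i2 e2].
pose S : set Omega := [set o | 0 < Z1 o - Z2 o].
have GS : <<s G >> S.
  have mD : measurable_fun (setT : set (g_sigma_algebraType G)) (fun o : g_sigma_algebraType G => Z1 o - Z2 o).
    by apply: measurable_funB; apply/sigma_meas_fun.
  have := mD measurableT `]0, +oo[%classic (measurable_itv _); rewrite setTI.
  by congr (<<s G >> _); apply/seteqP; split => o; rewrite /S /= in_itv/= andbT.
have mS : measurable S by exact: (sigma_sub_measurable GM).
have iS1 := integ_set mS i1; have iS2 := integ_set mS i2.
have iD := integrableB mS iS1 iS2.
have S0 : (\int[P]_(o in S) (Z1 o - Z2 o)%:E = 0)%E.
  have := integralB mS iS1 iS2; rewrite /= e1// e2// => H.
  under eq_integral do rewrite EFinB.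
  rewrite H subee//; rewrite -e2//; exact: integrable_fin_num.
have Sabs : (\int[P]_(o in S) `|(Z1 o - Z2 o)%:E| = 0)%E.
  rewrite -S0; apply: eq_integral => o; rewrite inE => /= So.
  by rewrite ger0_norm// ltW.
have mf : measurable_fun S (fun o => (Z1 o - Z2 o)%:E) by exact: measurable_int iD.
have := (ae_eq_integral_abs P mS mf).1 Sabs.
apply: filterS => o Ho; rewrite leNgt; apply/negP => lt.
have So : S o by rewrite /S/= subr_gt0.
by have := Ho So; rewrite /S/= in So * => -[]; move: So => /[swap] ->; rewrite ltxx.
Qed.

Lemma cond_exp_unique (G : set (set Omega)) X Z1 Z2 : G `<=` measurable ->
  is_cond_exp P <<s G >> X Z1 -> is_cond_exp P <<s G >> X Z2 ->
  {ae P, forall o, Z1 o = Z2 o}.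
Proof.
move=> GM H1 H2.
have := cond_exp_le_ae GM H1 H2; have := cond_exp_le_ae GM H2 H1.
by apply: filterS2 => o h1 h2; apply/eqP; rewrite eq_le h1 h2.
Qed.

(** As soon as one version exists, the chosen one is a version and agrees with
it almost surely. *)
Lemma cond_expP (G : set (set Omega)) X Z : G `<=` measurable ->
  is_cond_exp P <<s G >> X Z ->
  is_cond_exp P <<s G >> X (cond_exp P <<s G >> X) /\
  {ae P, forall o, cond_exp P <<s G >> X o = Z o}.
Proof.
move=> GM HZ.
have H : is_cond_exp P <<s G >> X (cond_exp P <<s G >> X).
  by rewrite /cond_exp; exact: (@xgetI _ _ _ Z HZ).
by split => //; exact: (cond_exp_unique GM H HZ).
Qed.

Section gaussian_family.
Variables (m : nat) (Y : 'I_m -> Omega -> R) (X : Omega -> R).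
Hypothesis LY : forall j, sqint (Y j).
Hypothesis LX : sqint X.
Hypothesis GXY : forall (s : R) l, gaussian P (fun o => s * X o + lin Y l o).

Let gens := \bigcup_j preimage_set_system setT (Y j) measurable.

Let gens_meas : gens `<=` measurable.
Proof. by move=> _ [j _ [B mB <-]]; exact: ((LY j).1 mT B mB). Qed.

Definition comb (a : 'I_m -> R) o := \sum_j a j * Y j o.

Lemma L2_comb a : sqint (comb a).
Proof.
rewrite /comb; apply: (@L2_sum _ _ _ P setT mT _ _ xpredT (fun j o => a j * Y j o)) => j _.
exact: L2Z.
Qed.

Lemma cov_comb a Z : sqint Z -> cov Z (comb a) = \sum_j a j * cov Z (Y j).
Proof.
move=> LZ; rewrite /comb (@ip_sumr _ _ _ P setT mT _ _ xpredT (fun j o => a j * Y j o))//.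
  by apply: eq_bigr => j _; rewrite ipZr.
by move=> j _; exact: L2Z.
Qed.

(** The normal equations; they are compatible because a combination of the Y j
of norm zero is orthogonal to X. *)
Lemma projection : exists a, forall j, cov (fun o => X o - comb a o) (Y j) = 0.
Proof.
pose Gm := \matrix_(i, j) cov (Y i) (Y j).
pose b := \row_j cov X (Y j).
have [a aG] : exists a : 'rV[R]_m, a *m Gm = b.
  apply: gram_solvable => v Gv.
  pose w := comb (fun j => v j 0).
  have Lw : sqint w by exact: L2_comb.
  have Yw i : cov (Y i) w = 0.
    rewrite cov_comb//; have /matrixP/(_ i 0) := Gv; rewrite !mxE => E0.
    by rewrite -[RHS]E0; apply: eq_bigr => j _; rewrite mxE mulrC.
  have ww : cov w w = 0.
    by rewrite {2}/w cov_comb// big1// => j _; rewrite ipC Yw mulr0.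
  have Xw : cov X w = 0.
    have := ip_CS mT LX Lw; rewrite ww mulr0 => H.
    by apply/eqP; rewrite -sqrf_eq0 eq_le H sqr_ge0.
  apply/matrixP => i k; rewrite (ord1 i) (ord1 k) !mxE -[RHS]Xw cov_comb//.
  by apply: eq_bigr => j _; rewrite mxE mulrC.
exists (fun j => a 0 j) => j.
rewrite ipBl//; last exact: L2_comb.
have /matrixP/(_ 0 j) := aG; rewrite !mxE => <-.
rewrite [cov (comb _) _]ipC cov_comb//.
by apply/eqP; rewrite subr_eq0; apply/eqP; apply: eq_bigr => i _; rewrite mxE ipC.
Qed.

Lemma residual_gaussian a (s : R) l : gaussian P (fun o => s * (X o - comb a o) + lin Y l o).
Proof.
have := GXY s ([seq (- s * a j, j) | j <- index_enum 'I_m] ++ l).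
rewrite (_ : (fun o => s * X o + _) = fun o => s * (X o - comb a o) + lin Y l o)//.
apply/funext => o; rewrite /lin big_cat/= big_map/= /comb mulrBr -addrA; congr (_ + _).
congr (_ + _); rewrite mulr_sumr -sumrN; apply: eq_bigr => j _; ring.
Qed.

(** The residual r of the projection and its centred square r^2 - v both have
integral zero on the sigma-algebra of Y. The first fact says that the
projection is the conditional expectation, the second that the conditional
expectation of r^2 is the constant v. *)
Theorem cond_var_gaussian : exists2 a : 'I_m -> R,
  forall c : 'I_m -> R, cov (fun o => X o - comb a o) (fun o => X o - comb a o) <=
    cov (fun o => X o - comb c o) (fun o => X o - comb c o) &
  {ae P, forall o, cond_var P (generated_sigma Y) X o =
    cov (fun o => X o - comb a o) (fun o => X o - comb a o)}.
Proof.
have [a orth] := projection; exists a.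
  move=> c; pose r o := X o - comb a o.
  have Lr : sqint r by apply: L2B => //; exact: L2_comb.
  pose w := comb (fun j => a j - c j).
  have Lw : sqint w by exact: L2_comb.
  have rw : cov r w = 0 by rewrite cov_comb// big1// => j _; rewrite orth mulr0.
  have -> : (fun o => X o - comb c o) = (fun o => r o + w o).
    apply/funext => o; rewrite /r /w /comb -addrA; congr (_ + _).
    by rewrite -!sumrN -big_split/=; apply: eq_bigr => j _; ring.
  have Lrw : sqint (fun o => r o + w o) by exact: L2D.
  rewrite -/r (ipDl mT Lr Lw Lrw) (ipDr mT Lr Lw Lr) (ipDr mT Lr Lw Lw).
  by rewrite (ipC P setT w r) rw addr0 add0r lerDl ip_ge0.
pose r o := X o - comb a o; rewrite -/r; set v := cov r r.
have Lr : sqint r by apply: L2B => //; exact: L2_comb.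
have Gr := residual_gaussian a.
have F1 := fourier_null_res LY Lr orth Gr.
have F2 := fourier_null_res2 LY Lr orth Gr.
have mY j : measurable_fun setT (Y j) := (LY j).1.
have ir := L2_integ Lr.
have ir2 : integ (fun o => r o ^+ 2 - v).
  by apply: (integrableB mT Lr.2 (prob_integ_cst P v)).
have GE A : <<s gens >> A -> measurable A by exact: sigma_sub_measurable.
have HZ : is_cond_exp P <<s gens >> X (comb a).
  split.
  - apply/sigma_meas_fun; apply: measurable_sum => j; apply: measurable_funM => //.
    by apply/sigma_meas_fun => B mB; apply: sub_sigma_algebra; exists j => //; exists B => //; rewrite setTI.
  - by apply: L2_integ; exact: L2_comb.
  - move=> A GA; have mA := GE A GA.
    have := fourier_null_sigma mY ir F1 GA; rewrite /r.
    have iX := integ_set mA (L2_integ LX).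
    have iC := integ_set mA (L2_integ (L2_comb a)).
    under eq_integral do rewrite EFinB.
    rewrite integralB// => H.
    have fX := integrable_fin_num mA iX; have fC := integrable_fin_num mA iC.
    exact/esym/(fin_sub0 fX fC H).
have [HZ' ZE] := cond_expP gens_meas HZ.
have [mZ' iZ' _] := HZ'.
have mZ : measurable_fun setT (cond_exp P <<s gens >> X) by exact: (sub_meas_fun gens_meas mZ').
have Hv : is_cond_exp P <<s gens >> (fun o => (X o - cond_exp P <<s gens >> X o) ^+ 2) (fun=> v).
  split.
  - by apply/sigma_meas_fun; exact: measurable_cst.
  - exact: prob_integ_cst.
  - move=> A GA; have mA := GE A GA.
    transitivity (\int[P]_(o in A) (r o ^+ 2)%:E)%E.
      have := fourier_null_sigma mY ir2 F2 GA.
      have i1 := integ_set mA Lr.2; have i2 := integ_set mA (prob_integ_cst P v).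
      under eq_integral do rewrite EFinB.
      rewrite integralB// => H.
      have f1 := integrable_fin_num mA i1; have f2 := integrable_fin_num mA i2.
      exact/esym/(fin_sub0 f1 f2 H).
    apply: ae_eq_integral => //.
    + by apply/measurable_EFinP; apply: measurable_funS (measurable_funX 2 Lr.1).
    + apply/measurable_EFinP; apply: (@measurable_funS _ _ _ _ setT) => //.
      by apply: measurable_funX; apply: measurable_funB => //; exact: LX.1.
    + by move: ZE; apply: filterS => o Ho _; rewrite Ho.
have [_] := cond_expP gens_meas Hv.
by rewrite /cond_var.
Qed.

End gaussian_family.

(** The parameter s is identified as the variance through the second difference
of the characteristic function at 0. *)
Lemma gaussian_of_law Z (s : R) : sqint Z ->
  (forall B : set R, measurable B -> P (Z @^-1` B) = gaussian_law 0 s B) -> gaussian P Z.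
Proof.
move=> LZ law; have mZ := LZ.1.
have charE (th u : R) : E (fun o => cos (th + u * Z o)) = cos th * expR (- (s ^+ 2 / 2 * u ^+ 2)).
  pose g (x : R) := cos (th + u * x).
  have cg : continuous g.
    move=> x; apply: (@continuous_comp _ _ _ (fun x => th + u * x) cos); last exact: continuous_cos.
    by apply: cvgD; [exact: cvg_cst|apply: cvgM; [exact: cvg_cst|exact: cvg_id]].
  have mg : measurable_fun setT g by exact: continuous_measurable_fun.
  have ig : integ (g \o Z).
    by apply: (@integ_cosZ _ _ _ P th (fun o => u * Z o)); exact: measurable_funM.
  have T1 : (\int[P]_o (g (Z o))%:E = \int[pushforward P (Z : Omega -> measurableTypeR R)]_x (g x)%:E)%E.
    rewrite integral_pushforward//; first by exact/measurable_EFinP.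
  have [s0|s0] := eqVneq s 0.
    rewrite /Rintegral T1 (@eq_measure_integral _ _ _ setT (\d_(0 : measurableTypeR R))); last first.
      by move=> A mA _; rewrite /= /pushforward law// /gaussian_law s0 eqxx.
    rewrite integral_dirac//; last exact/measurable_EFinP.
    by rewrite diracT mul1e /g /= mulr0 addr0 s0 expr0n/= !mul0r oppr0 expR0 mulr1.
  have T2 : (\int[pushforward P (Z : Omega -> measurableTypeR R)]_x (g x)%:E = \int[normal_prob 0 s]_x (g x)%:E)%E.
    apply: eq_measure_integral => A mA _.
    by rewrite /= /pushforward law// /gaussian_law (negbTE s0).
  rewrite /Rintegral T1 T2 integral_normal_prob//; last by exists 1 => x; exact: cos_max.
  have := ncharE s0 th u; rewrite /nchar /Rintegral => ->.
  by congr (_ * expR (- _)); ring.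
have varE : cov Z Z = s ^+ 2.
  have [_ cv] : integ (fun o => Z o ^+ 2 / 2) /\
     E (fun o => n.+1%:R ^+ 2 * (1 - cos ((n.+1%:R)^-1 * Z o))) @[n --> \oo] --> E (fun o => Z o ^+ 2 / 2).
    apply: (@Rintegral_dct _ Omega R P setT mT (fun n o => n.+1%:R ^+ 2 * (1 - cos ((n.+1%:R)^-1 * Z o))) _ (fun o => Z o ^+ 2)) => //.
    - move=> n; apply: measurable_funM => //; apply: measurable_funB => //.
      by apply: (measurableT_comp (continuous_measurable_fun (@continuous_cos R))); exact: measurable_funM.
    - by move=> o _; exact: cvg_cos_quot.
    - exact: LZ.2.
    - by move=> n o _; exact: cos_quot_bound.
  have k0 : 0 <= s ^+ 2 / 2 by rewrite divr_ge0 ?sqr_ge0.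
  have c0 : E (fun o => n.+1%:R ^+ 2 * (1 - cos ((n.+1%:R)^-1 * Z o))) @[n --> \oo] --> s ^+ 2 / 2.
    have := cvg_exp_quot k0; apply: cvg_trans; apply: near_eq_cvg; near=> n.
    have ic : integ (fun o => cos ((n.+1%:R)^-1 * Z o)).
      have mnZ : measurable_fun setT (fun o => (n.+1%:R)^-1 * Z o) by exact: measurable_funM.
      have := @integ_cosZ _ _ _ P 0 _ mnZ.
      by apply: eq_integrable => // o _; rewrite /= add0r.
    have i1c := integrableB mT (prob_integ_cst P 1) ic.
    rewrite RintegralZl//.
    rewrite RintegralB//; last exact: prob_integ_cst.
    rewrite Rintegral_cst//= probability_setT mulr1; congr (_ * (1 - _)).
    have := charE 0 (n.+1%:R)^-1; rewrite cos0 mul1r => <-.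
    by apply: eq_Rintegral => o _; rewrite add0r.
  have E1 : E (fun o => Z o ^+ 2 / 2) = s ^+ 2 / 2 by exact: cvg_unique cv c0.
  have E2 : E (fun o => Z o ^+ 2 / 2) = 2^-1 * cov Z Z.
    transitivity (E (fun o => 2^-1 * (Z o * Z o))).
      by apply: eq_Rintegral => o _; ring.
    by rewrite RintegralZl//; exact: L2_intM.
  by apply: (@mulfI _ 2^-1) => //; rewrite -E2 E1 mulrC.
split => // th; rewrite varE.
have := charE th 1; rewrite expr1n mulr1 => <-.
by apply: eq_Rintegral => o _; rewrite mul1r.
Unshelve. all: by end_near. Qed.

End condexp.

(** * Integrals against white noise *)

Section wiener.
Context (d : measure_display) (Omega : measurableType d) (R : realType).
Variables (P : probability Omega R) (L : R) (xi : set (R * R) -> {RV P >-> R}).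
Hypothesis hxi : white_noise L xi.
Local Notation E f := (\int[P]_o f o).
Local Notation D := (spacetime L).
Local Notation sqint := (L2 P setT).
Local Notation cov := (ip P setT).
Local Notation mT := (@measurableT _ Omega).
Implicit Types (h g : R * R -> R) (X Z : Omega -> R).

Let lb2 : {measure set (measurableTypeR R * measurableTypeR R) -> \bar R} := leb2.
Local Notation sqint2 := (L2 lb2 D).
Local Notation ip2 := (ip lb2 D).

Lemma mD : measurable (D : set (measurableTypeR R * measurableTypeR R)).
Proof. by apply: measurableX. Qed.
Local Hint Resolve mD : core.

Lemma cell_L2 A : finite_cell L A -> sqint2 \1_A.
Proof.
move=> [mA AD fA]; apply: L2_lty; first exact: measurable_indic.
have -> : (\int[lb2]_(p in D) (\1_A p ^+ 2)%:E = \int[lb2]_(p in D) (\1_A p)%:E)%E.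
  by apply: eq_integral => p _; rewrite indicE; case: (_ \in _); rewrite ?expr1n ?expr0n.
by rewrite integral_indic// (le_lt_trans _ fA)// le_measure ?inE//; exact: measurableI.
Qed.

Lemma cell_ip A B : finite_cell L A -> finite_cell L B -> ip2 \1_A \1_B = fine (lb2 (A `&` B)).
Proof.
move=> [mA AD fA] [mB BD fB]; rewrite /ip /Rintegral; congr fine.
under eq_integral do rewrite -[_ * _]/((\1_A \* \1_B) _) -indicI.
rewrite integral_indic//; last exact: measurableI.
by congr (lb2 _); apply: setIidl => p [/AD].
Qed.

Lemma cell_cov A B : finite_cell L A -> finite_cell L B ->
  cov (xi A) (xi B) = fine (lb2 (A `&` B)).
Proof.
move=> cA cB; have := hxi.2 A B cA cB; rewrite unlock /= => H.
by rewrite /ip /Rintegral; congr fine; rewrite -H.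
Qed.

Lemma cell_sq A : finite_cell L A -> sqint (xi A).
Proof.
move=> cA; apply: L2_lty => //.
have := hxi.2 A A cA cA; rewrite unlock /= => H.
rewrite (eq_integral (fun o => (xi A o * xi A o)%:E)); last by move=> o _; rewrite expr2.
by rewrite H setIid; case: cA.
Qed.

Definition stepf (n : nat) (c : nat -> R) (A : nat -> set (R * R)) (p : R * R) : R :=
  \sum_(i < n) c i * \1_(A i) p.
Definition stepX (n : nat) (c : nat -> R) (A : nat -> set (R * R)) (o : Omega) : R :=
  \sum_(i < n) c i * xi (A i) o.

(** The graph of the integral on step functions. It is kept as a relation, which
avoids proving that the integral does not depend on the decomposition. *)
Definition step g Z := exists n c A, [/\ forall i, finite_cell L (A i),
  g = stepf n c A & Z = stepX n c A].

Lemma step_L2 g Z : step g Z -> sqint2 g /\ sqint Z.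
Proof.
move=> [n [c [A [cA -> ->]]]]; split.
  rewrite /stepf; apply: (@L2_sum _ _ _ lb2 D mD _ _ xpredT (fun (i : 'I_n) p => c i * \1_(A i) p)) => i _.
  by apply: L2Z => //; exact: cell_L2.
rewrite /stepX; apply: (@L2_sum _ _ _ P setT mT _ _ xpredT (fun (i : 'I_n) o => c i * xi (A i) o)) => i _.
by apply: L2Z => //; exact: cell_sq.
Qed.

(** Both sides expand into the same double sum of areas of intersections. *)
Lemma step_isometry g Z : step g Z -> cov Z Z = ip2 g g.
Proof.
move=> S; have [Lg LZ] := step_L2 S; move: S => [n [c [A [cA gE ZE]]]].
have L1 i : sqint2 (fun p => c i * \1_(A i) p) by apply: L2Z => //; exact: cell_L2.
have L2' i : sqint (fun o => c i * xi (A i) o) by apply: L2Z => //; exact: cell_sq.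
have e1 h : sqint2 h -> ip2 g h = \sum_(i < n) c i * ip2 \1_(A i) h.
  move=> Lh; rewrite gE /stepf (@ip_suml _ _ _ lb2 D mD _ _ xpredT (fun (i : 'I_n) p => c i * \1_(A i) p))//.
  by apply: eq_bigr => i _; rewrite ipZl//; exact: cell_L2.
have e2 X : sqint X -> cov Z X = \sum_(i < n) c i * cov (xi (A i)) X.
  move=> LX; rewrite ZE /stepX (@ip_suml _ _ _ P setT mT _ _ xpredT (fun (i : 'I_n) o => c i * xi (A i) o))//.
  by apply: eq_bigr => i _; rewrite ipZl//; exact: cell_sq.
rewrite e1// e2//; apply: eq_bigr => i _; congr (_ * _).
rewrite ipC e2; last exact: cell_sq.
rewrite ipC e1; last exact: cell_L2.
by apply: eq_bigr => j _; rewrite cell_cov// cell_ip.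
Qed.

Lemma step_gaussian g Z : step g Z -> gaussian P Z.
Proof.
move=> S; have [_ LZ] := step_L2 S; move: S => [n [c [A [cA _ ZE]]]].
have [s Hs] := hxi.1 n (fun i => c i) (fun i => A i) (fun i => cA i).
apply: (@gaussian_of_law _ _ _ P Z s LZ) => B mB; rewrite -Hs//.
by rewrite ZE.
Qed.

Lemma step0 : step (fun=> 0) (fun=> 0).
Proof.
exists 0%N, (fun=> 0), (fun=> set0); split.
- by move=> _; split => //; rewrite measure0.
- by apply/funext => p; rewrite /stepf big_ord0.
- by apply/funext => p; rewrite /stepX big_ord0.
Qed.

Lemma stepZ k g Z : step g Z -> step (fun p => k * g p) (fun o => k * Z o).
Proof.
move=> [n [c [A [cA -> ->]]]]; exists n, (fun i => k * c i), A; split => //.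
- by apply/funext => p; rewrite /stepf mulr_sumr; apply: eq_bigr => i _; rewrite mulrA.
- by apply/funext => p; rewrite /stepX mulr_sumr; apply: eq_bigr => i _; rewrite mulrA.
Qed.

Lemma stepD g Z g' Z' : step g Z -> step g' Z' -> step (fun p => g p + g' p) (fun o => Z o + Z' o).
Proof.
move=> [n [c [A [cA -> ->]]]] [n' [c' [A' [cA' -> ->]]]].
exists (n + n')%N, (fun i => if (i < n)%N then c i else c' (i - n)%N),
  (fun i => if (i < n)%N then A i else A' (i - n)%N); split.
- by move=> i; case: ifP.
- apply/funext => p; rewrite /stepf big_split_ord/=; congr (_ + _); apply: eq_bigr => i _.
    by rewrite ltn_ord.
  by rewrite ltnNge leq_addr/= addKn.
- apply/funext => p; rewrite /stepX big_split_ord/=; congr (_ + _); apply: eq_bigr => i _.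
    by rewrite ltn_ord.
  by rewrite ltnNge leq_addr/= addKn.
Qed.

(** The closure of [step] in the product of the two L^2 spaces. *)
Definition wiener h X := [/\ sqint2 h, sqint X & exists gn Zn,
  [/\ forall n : nat, step (gn n) (Zn n),
    ip2 (fun p => h p - gn n p) (fun p => h p - gn n p) @[n --> \oo] --> 0 &
    cov (fun o => X o - Zn n o) (fun o => X o - Zn n o) @[n --> \oo] --> 0]].

Lemma wiener_of_is h X : measurable_fun setT X -> is_wiener_integral L xi h X -> wiener h X.
Proof.
move=> mX [mh [k [c [A [cA c1 c2]]]]].
have S n : step (stepf (k n) (c n) (A n)) (stepX (k n) (c n) (A n)) by exists (k n), (c n), (A n).
have [Lh ch] := L2_cvg mD mh (fun n => (step_L2 (S n)).1) c1.
have c2' : (\int[P]_o ((X o - stepX (k n) (c n) (A n) o) ^+ 2)%:E)%E @[n --> \oo] --> 0%E.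
  by move: c2; rewrite unlock.
have [LX cX] := L2_cvg mT mX (fun n => (step_L2 (S n)).2) c2'.
by split => //; exists (fun n => stepf (k n) (c n) (A n)), (fun n => stepX (k n) (c n) (A n)).
Qed.

Lemma wiener0 X : measurable_fun setT X -> {ae P, forall o, X o = 0} -> wiener (fun=> 0) X.
Proof.
move=> mX X0.
have E0 : (\int[P]_o (X o ^+ 2)%:E = 0)%E.
  rewrite (ae_eq_integral (cst 0%E))//.
  - by rewrite integral_cst// mul0e.
  - by apply/measurable_EFinP; exact: measurable_funX.
  - by move: X0; apply: filterS => o -> _; rewrite expr0n.
have LX : sqint X by apply: L2_lty => //; rewrite E0.
split => //; first exact: L20.
exists (fun _ _ => 0), (fun _ _ => 0); split.
- by move=> _; exact: step0.
- rewrite (_ : (fun _ => _) = fun=> 0); first exact: cvg_cst.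
  by apply/funext => n; rewrite subrr ip0l.
- rewrite (_ : (fun _ => _) = fun=> 0); first exact: cvg_cst.
  apply/funext => n; under [X in ip _ _ X _]eq_fun do rewrite subr0.
  under [X in ip _ _ _ X]eq_fun do rewrite subr0.
  by apply: EFin_inj; rewrite -L2_EFin.
Qed.

Lemma sqnorm_cvgZ k (T : nat -> R) : T @ \oo --> 0 -> k * T n @[n --> \oo] --> (0 : R).
Proof. by move=> T0; rewrite -[X in _ --> X](mulr0 k); apply: cvgM => //; exact: cvg_cst. Qed.

Lemma wienerZ k h X : wiener h X -> wiener (fun p => k * h p) (fun o => k * X o).
Proof.
move=> [Lh LX [gn [Zn [S ch cX]]]]; split; [exact: L2Z|exact: L2Z|].
exists (fun n p => k * gn n p), (fun n o => k * Zn n o); split.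
- by move=> n; exact: stepZ.
- rewrite (_ : (fun n => _) = fun n => (k * k) * ip2 (fun p => h p - gn n p) (fun p => h p - gn n p)).
    exact: sqnorm_cvgZ.
  apply/funext => n; have Ld := L2B mD Lh (step_L2 (S n)).1.
  rewrite -mulrA -(ipZr mD)// -(ipZl mD)//; last exact: L2Z.
  by apply: eq_ip => p _; rewrite mulrBr.
- rewrite (_ : (fun n => _) = fun n => (k * k) * cov (fun p => X p - Zn n p) (fun p => X p - Zn n p)).
    exact: sqnorm_cvgZ.
  apply/funext => n; have Ld := L2B mT LX (step_L2 (S n)).2.
  rewrite -mulrA -(ipZr mT)// -(ipZl mT)//; last exact: L2Z.
  by apply: eq_ip => p _; rewrite mulrBr.
Qed.

Lemma wienerD h X h' X' : wiener h X -> wiener h' X' ->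
  wiener (fun p => h p + h' p) (fun o => X o + X' o).
Proof.
move=> [Lh LX [gn [Zn [S ch cX]]]] [Lh' LX' [gn' [Zn' [S' ch' cX']]]].
split; [exact: L2D|exact: L2D|].
exists (fun n p => gn n p + gn' n p), (fun n o => Zn n o + Zn' n o); split.
- by move=> n; exact: stepD.
- have H : 2 * ip2 (fun p => h p - gn n p) (fun p => h p - gn n p) +
      2 * ip2 (fun p => h' p - gn' n p) (fun p => h' p - gn' n p) @[n --> \oo] --> (0 : R).
    by rewrite -[X in _ --> X](addr0 0); apply: cvgD; exact: sqnorm_cvgZ.
  apply: squeeze0 H => n; rewrite ip_ge0/=.
  have Ld := L2B mD Lh (step_L2 (S n)).1; have Ld' := L2B mD Lh' (step_L2 (S' n)).1.
  apply: le_trans (ip_sqD mD Ld Ld'); rewrite le_eqVlt; apply/orP; left; apply/eqP.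
  by apply: eq_ip => p _; rewrite opprD addrACA.
- have H : 2 * cov (fun p => X p - Zn n p) (fun p => X p - Zn n p) +
      2 * cov (fun p => X' p - Zn' n p) (fun p => X' p - Zn' n p) @[n --> \oo] --> (0 : R).
    by rewrite -[X in _ --> X](addr0 0); apply: cvgD; exact: sqnorm_cvgZ.
  apply: squeeze0 H => n; rewrite ip_ge0/=.
  have Ld := L2B mT LX (step_L2 (S n)).2; have Ld' := L2B mT LX' (step_L2 (S' n)).2.
  apply: le_trans (ip_sqD mT Ld Ld'); rewrite le_eqVlt; apply/orP; left; apply/eqP.
  by apply: eq_ip => p _; rewrite opprD addrACA.
Qed.

Lemma wiener_sum (I : Type) (s : seq I) (h : I -> R * R -> R) (X : I -> Omega -> R) :
  (forall i, wiener (h i) (X i)) ->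
  wiener (fun p => \sum_(i <- s) h i p) (fun o => \sum_(i <- s) X i o).
Proof.
move=> W; elim: s => [|i s IH].
  under eq_fun do rewrite big_nil; under [Y in wiener _ Y]eq_fun do rewrite big_nil.
  by apply: wiener0 => //; exact: aeW.
under eq_fun do rewrite big_cons; under [Y in wiener _ Y]eq_fun do rewrite big_cons.
exact: wienerD.
Qed.

Lemma wiener_gaussian h X : wiener h X -> gaussian P X.
Proof.
move=> [_ LX [gn [Zn [S _ cX]]]].
by apply: (gaussian_lim LX _ cX) => n; exact: step_gaussian (S n).
Qed.

Lemma wiener_isometry h X : wiener h X -> cov X X = ip2 h h.
Proof.
move=> [Lh LX [gn [Zn [S ch cX]]]].
have c1 := cvg_ip mD Lh Lh (fun n => (step_L2 (S n)).1) (fun n => (step_L2 (S n)).1) ch ch.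
have c2 := cvg_ip mT LX LX (fun n => (step_L2 (S n)).2) (fun n => (step_L2 (S n)).2) cX cX.
have c3 : cov (Zn n) (Zn n) @[n --> \oo] --> ip2 h h.
  move: c1; apply: cvg_trans; apply: near_eq_cvg; near=> n.
  by rewrite -(step_isometry (S n)).
exact: cvg_unique c2 c3.
Unshelve. all: by end_near. Qed.

(** Linear combinations of integrals against the noise are again such integrals,
hence Gaussian; by [wiener_isometry] the residual variances of
[cond_var_gaussian] are squared distances between integrands. *)
Theorem cond_var_wiener (m : nat) (h : R * R -> R) (X : {RV P >-> R})
    (hY : 'I_m -> R * R -> R) (Y : 'I_m -> {RV P >-> R}) :
  wiener h X -> (forall j, wiener (hY j) (Y j)) ->
  exists2 a : 'I_m -> R,
    forall c : 'I_m -> R,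
      ip2 (fun p => h p - \sum_j a j * hY j p) (fun p => h p - \sum_j a j * hY j p) <=
      ip2 (fun p => h p - \sum_j c j * hY j p) (fun p => h p - \sum_j c j * hY j p) &
    {ae P, forall o, cond_var P (generated_sigma Y) X o =
      ip2 (fun p => h p - \sum_j a j * hY j p) (fun p => h p - \sum_j a j * hY j p)}.
Proof.
move=> WX WY.
have LX : sqint X by case: WX.
have LY j : sqint (Y j) by case: (WY j).
have G (s : R) l : gaussian P (fun o => s * X o + lin Y l o).
  apply: wiener_gaussian; apply: wienerD; first exact: wienerZ WX.
  by apply: (@wiener_sum _ l (fun p q => p.1 * hY p.2 q) (fun p o => p.1 * Y p.2 o)) => p; exact: wienerZ.
have iso (c : 'I_m -> R) : cov (fun o => X o - comb Y c o) (fun o => X o - comb Y c o) =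
    ip2 (fun p => h p - \sum_j c j * hY j p) (fun p => h p - \sum_j c j * hY j p).
  apply: wiener_isometry.
  have := wienerD WX (wienerZ (-1) (@wiener_sum _ (index_enum 'I_m) (fun j p => c j * hY j p)
    (fun j o => c j * Y j o) (fun j => wienerZ (c j) (WY j)))).
  rewrite (_ : (fun p => h p + _) = fun p => h p - \sum_j c j * hY j p); last first.
    by apply/funext => p; rewrite mulN1r.
  by rewrite (_ : (fun o => X o + _) = fun o => X o - comb Y c o)//; apply/funext => o; rewrite mulN1r.
have [a amin aeq] := cond_var_gaussian LY LX G.
exists a; first by move=> c; rewrite -!iso.
by rewrite -iso.
Qed.

End wiener.

(** * Tensor products on space-time *)

Section tensor.
Context (R : realType) (L : R).
Local Notation leb := (@lebesgue_measure R).
Local Notation D := (spacetime L).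
Let lb2 : {measure set (measurableTypeR R * measurableTypeR R) -> \bar R} := leb2.
Local Notation sqint2 := (L2 lb2 D).
Local Notation ip2 := (ip lb2 D).
Let I0 : set (measurableTypeR R) := `[0, +oo[.
Let IL : set (measurableTypeR R) := `[0, L].
Local Notation ipt := (ip leb `[0, +oo[).
Local Notation dot := (ip leb `[0, L]).
Implicit Types (u v : R -> R).

Definition tensor u v (p : R * R) := u p.1 * v p.2.

Lemma tensor_integral u v : leb.-integrable setT (EFin \o u) -> leb.-integrable setT (EFin \o v) ->
  lb2.-integrable setT (EFin \o tensor u v) /\
  \int[lb2]_p tensor u v p = \int[leb]_s u s * \int[leb]_y v y.
Proof.
move=> Iu Iv.
have mu : measurable_fun setT u by apply/measurable_EFinP; exact: measurable_int Iu.
have mv : measurable_fun setT v by apply/measurable_EFinP; exact: measurable_int Iv.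
have mf : measurable_fun (setT : set (measurableTypeR R * measurableTypeR R)) (EFin \o tensor u v).
  apply/measurable_EFinP; apply: measurable_funM.
    exact: (measurableT_comp mu measurable_fst).
  exact: (measurableT_comp mv measurable_snd).
pose k := \int[leb]_y `|v y|.
have kE : (\int[leb]_y `|(v y)%:E| = k%:E)%E.
  rewrite /k /Rintegral fineK//.
  exact: (integrable_fin_num measurableT (integrable_abse Iv)).
have Iuv : lb2.-integrable setT (EFin \o tensor u v).
  apply: ((@integrable12ltyP _ _ _ _ _ leb leb (EFin \o tensor u v) mf).2).
  rewrite (eq_integral (fun s : measurableTypeR R => `|(u s)%:E| * k%:E)%E); last first.
    move=> s _; rewrite /tensor/= -kE -ge0_integralZl//.
    + by apply: eq_integral => y _; rewrite normrM EFinM.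
    + by apply: measurableT_comp => //; exact/measurable_EFinP.
  rewrite ge0_integralZr//.
  - rewrite lte_mul_pinfty//; first exact: integral_ge0.
      by apply: integrable_fin_num => //; exact: integrable_abse.
    exact: ltry.
  - by apply: measurableT_comp => //; exact/measurable_EFinP.
  - by rewrite lee_fin; apply: Rintegral_ge0.
split => //.
rewrite /Rintegral -(integral12_prod_meas1 Iuv)/fubini_F.
have -> : (\int[leb]_s \int[leb]_y (EFin \o tensor u v) (s, y) =
    \int[leb]_s ((u s)%:E * (\int[leb]_y v y)%:E))%E.
  apply: eq_integral => s _; rewrite /tensor/=.
  under eq_integral do rewrite EFinM.
  by rewrite integralZl// /Rintegral fineK//; exact: integrable_fin_num.
rewrite integralZr// fineM//; exact: integrable_fin_num.
Qed.

Lemma tensor_patch u v : (tensor u v) \_ D = tensor (u \_ I0) (v \_ IL).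
Proof.
apply/funext => -[s y]; rewrite /tensor !patchE /=.
have -> : ((s, y) \in D) = (s \in I0) && (y \in IL).
  apply/idP/andP; first by rewrite inE => -[/= h1 h2]; split; rewrite inE.
  by rewrite !inE => -[h1 h2]; split.
by case: (s \in I0); case: (y \in IL); rewrite /= ?mulr0 ?mul0r.
Qed.

Lemma integrable_patch (A : set (measurableTypeR R)) u : measurable A ->
  leb.-integrable A (EFin \o u) -> leb.-integrable setT (EFin \o (u \_ A)).
Proof.
move=> mA Iu; rewrite -restrict_EFin; apply/integrable_restrict => //; rewrite setTI.
exact: Iu.
Qed.

Lemma tensor_integral_on u v : leb.-integrable I0 (EFin \o u) -> leb.-integrable IL (EFin \o v) ->
  lb2.-integrable D (EFin \o tensor u v) /\
  \int[lb2]_(p in D) tensor u v p = \int[leb]_(s in I0) u s * \int[leb]_(y in IL) v y.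
Proof.
move=> Iu Iv; have mI0 : measurable I0 by exact: measurable_itv.
have mIL : measurable IL by exact: measurable_itv.
have [] := tensor_integral (integrable_patch mI0 Iu) (integrable_patch mIL Iv).
rewrite -tensor_patch => H1 H2; split.
  move: H1; rewrite -restrict_EFin => H1.
  have := (integrable_restrict lb2 (mD L) measurableT (EFin \o tensor u v)).2 H1.
  by rewrite setTI.
by rewrite Rintegral_mkcond H2 -!Rintegral_mkcond.
Qed.

Lemma tensor_L2 u v : L2 leb `[0, +oo[ u -> L2 leb `[0, L] v -> sqint2 (tensor u v).
Proof.
move=> [mu Iu] [mv Iv]; split.
  apply/(measurable_restrictT (tensor u v) (mD L)); rewrite tensor_patch.
  have mu' : measurable_fun setT (u \_ I0) by apply/(measurable_restrictT u (measurable_itv _)).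
  have mv' : measurable_fun setT (v \_ IL) by apply/(measurable_restrictT v (measurable_itv _)).
  apply: measurable_funM.
    exact: (measurableT_comp mu' measurable_fst).
  exact: (measurableT_comp mv' measurable_snd).
have [H _] := tensor_integral_on Iu Iv.
by apply: eq_integrable H => //; [exact: mD|move=> p _; rewrite /tensor/= exprMn].
Qed.

Lemma tensor_ip u v u' v' : L2 leb `[0, +oo[ u -> L2 leb `[0, L] v ->
  L2 leb `[0, +oo[ u' -> L2 leb `[0, L] v' ->
  ip2 (tensor u v) (tensor u' v') = ipt u u' * dot v v'.
Proof.
move=> Lu Lv Lu' Lv'.
have mI0 : measurable (`[0, +oo[ : set (measurableTypeR R)) by exact: measurable_itv.
have mIL : measurable (`[0, L] : set (measurableTypeR R)) by exact: measurable_itv.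
have [_ H] := tensor_integral_on (L2_intM mI0 Lu Lu') (L2_intM mIL Lv Lv').
by rewrite /ip -H; apply: eq_Rintegral => p _; rewrite /tensor; ring.
Qed.

(** Lower semicontinuity of the norm under pointwise convergence. *)
Lemma fatou_sq (h : R * R -> R) (g : nat -> R * R -> R) (B : R) :
  (forall n, sqint2 (g n)) -> (forall p, D p -> g n p @[n --> \oo] --> h p) ->
  (forall n, ip2 (g n) (g n) <= B) -> sqint2 h /\ ip2 h h <= B.
Proof.
move=> Lg gh gB.
have mh : measurable_fun D h.
  by apply: (@measurable_fun_cvg _ _ _ D g h (fun n => (Lg n).1)).
have F : (\int[lb2]_(p in D) (h p ^+ 2)%:E <= B%:E)%E.
  have H' : (\int[lb2]_(p in D) limn_einf (fun n => (g n p ^+ 2)%:E) <=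
     limn_einf (fun n => \int[lb2]_(p in D) (g n p ^+ 2)%:E))%E.
    apply: (@fatou _ _ R lb2 D (mD L) (fun n p => (g n p ^+ 2)%:E)) => [n|n p _].
      by apply/measurable_EFinP; apply: measurable_funX; exact: (Lg n).1.
    by rewrite lee_fin sqr_ge0.
  have -> : (\int[lb2]_(p in D) (h p ^+ 2)%:E = \int[lb2]_(p in D) limn_einf (fun n => (g n p ^+ 2)%:E))%E.
    apply: eq_integral => p; rewrite inE => Dp; apply/esym.
    have c : (g n p ^+ 2)%:E @[n --> \oo] --> (h p ^+ 2)%:E.
      apply: cvg_EFin; first exact: nearW.
      by apply: cvgM; exact: gh.
    rewrite is_cvg_limn_einfE; first exact: cvg_lim c.
    by apply/cvg_ex; eexists; exact: c.
  apply: (le_trans H').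
  rewrite (_ : (fun n => _) = fun n => (ip2 (g n) (g n))%:E); last first.
    by apply/funext => n; rewrite L2_EFin//; exact: mD.
  rewrite limn_einf_lim; apply: lime_le; first exact: is_cvg_einfs.
  apply: nearW => n; apply: (@le_trans _ _ (ip2 (g n) (g n))%:E); last by rewrite lee_fin.
  by apply: ereal_inf_lbound; exists n => //=.
have Lh : sqint2 h by apply: L2_lty => //; apply: le_lt_trans F _; exact: ltry.
by split => //; rewrite -lee_fin -L2_EFin//; exact: mD.
Qed.

Lemma itv_integrable u (b : R) (a c : bool) : continuous u ->
  leb.-integrable [set` Interval (BSide a 0) (BSide c b)] (EFin \o u).
Proof.
move=> cu; apply: integrableS (continuous_integrable 0 b cu) => //.
move=> s /=; rewrite !in_itv/=; case: a; case: c; rewrite /= => /andP[h1 h2]; apply/andP; split => //; exact: ltW.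
Qed.

Lemma timeL2 u (b : R) : continuous u -> L2 leb `[0, +oo[ (u \_ `]0, b[).
Proof.
move=> cu.
have mb : measurable (`]0, b[%classic : set (measurableTypeR R)) by exact: measurable_itv.
split.
  apply: (@measurable_funS _ _ _ _ setT) => //.
  apply/(measurable_restrictT _ mb); apply: measurable_funS (continuous_measurable_fun cu) => //.
have I2 := itv_integrable b false true (contM cu cu).
have I3 := integrable_patch mb I2.
apply: (@integrableS _ _ _ _ setT) => //.
apply: eq_integrable I3 => // s _ /=; rewrite !patchE.
by case: ifP => //; rewrite expr0n.
Qed.

(** Truncations to initial time intervals multiply to the shorter one; the end
points are null sets. *)
Lemma timeip u v (b b' : R) : continuous u -> continuous v -> b <= b' ->
  ipt (u \_ `]0, b[) (v \_ `]0, b'[) = \int[leb]_(s in `[0, b]) (u s * v s).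
Proof.
move=> cu cv bb'.
have cuv : continuous (fun s => u s * v s) by exact: contM.
transitivity (\int[leb]_(s in `]0, b[) (u s * v s)).
  rewrite /ip Rintegral_mkcond [RHS]Rintegral_mkcond; apply: eq_Rintegral => s _.
  rewrite !patchE !mem_setE /=.
  have [s0b|s0b] := boolP (s \in `]0, b[); last by rewrite mul0r; case: ifP.
  have -> : (s \in `]0, b'[) by move: s0b; rewrite !in_itv/= => /andP[-> sb]; exact: lt_le_trans sb bb'.
  by have -> : (s \in `[0, +oo[) by move: s0b; rewrite !in_itv/= andbT => /andP[/ltW].
have I a c := itv_integrable b a c cuv.
by rewrite (Rintegral_itv_bndo_bndc (I false true)) (Rintegral_itv_obnd_cbnd (I false false)).
Qed.

End tensor.

(** * The damped exponential kernels in time *)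

Section decay.
Context (R : realType).
Local Notation leb := (@lebesgue_measure R).
Local Notation ipt := (ip leb `[0, +oo[).
Implicit Types (l t s : R).

Definition decay l t s := expR (- l * (t - s)).

Lemma decay_der l t s : is_derive s 1 (decay l t) (l * decay l t s).
Proof.
have /is_derive_eq := derZ (- l) (derB (is_derive_cst t s 1) (is_derive_id s 1)).
move=> /(_ _ erefl) H; have /is_derive_eq := der_comp (is_derive_expR _) H.
by apply; rewrite /decay; ring.
Qed.

Lemma decay_cont l t : continuous (decay l t).
Proof. exact: (deriv_continuous (decay_der l t)). Qed.

(** Equal to (1 - exp(- 2 l t)) / (2 l), with the value t when l = 0; the integral
form treats the two cases together. *)
Definition decay_energy l t := \int[leb]_(s in `[0, t]) (decay l t s * decay l t s).

Lemma decay_sq l t s : decay l t s * decay l t s = expR (- (2 * l) * (t - s)).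
Proof. by rewrite /decay -expRD; congr expR; ring. Qed.

Lemma decay_energy_id l t : 0 <= t -> 2 * l * decay_energy l t = 1 - expR (- (2 * l) * t).
Proof.
move=> t0; have cd := contM (@decay_cont l t) (@decay_cont l t).
have D (s : R) : is_derive s 1 (fun s => decay l t s * decay l t s) (2 * l * (decay l t s * decay l t s)).
  by have /is_derive_eq := derM (decay_der l t s) (decay_der l t s); apply; ring.
have := FTC_global D (contZ (k := 2 * l) cd) t0.
rewrite RintegralZl//; last exact: continuous_integrable.
by rewrite -/(decay_energy l t) => ->; rewrite !decay_sq subrr mulr0 expR0 subr0.
Qed.

Lemma Rint_cst_itv (k t : R) : 0 <= t -> \int[leb]_(s in `[0, t]) k = k * t.
Proof.
move=> t0; have D (s : R) : is_derive s 1 (fun s => k * s) k.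
  by have /is_derive_eq := derZ k (is_derive_id s 1); apply; rewrite mulr1.
by rewrite (FTC_global D (@cont_cst _ k) t0) mulr0 subr0.
Qed.

Lemma decay_energy_ge0 l t : 0 <= decay_energy l t.
Proof. by apply: Rintegral_ge0 => s _; rewrite -expr2 sqr_ge0. Qed.

Lemma decay_energy_le c l t T : 0 <= c -> - c <= l -> 0 <= t <= T -> decay_energy l t <= expR (2 * c * T) * t.
Proof.
move=> c0 cl /andP[t0 tT]; rewrite -Rint_cst_itv//.
apply: le_Rintegral => //; [|exact/continuous_integrable/cont_cst|].
  by apply: continuous_integrable; apply: contM; exact: decay_cont.
move=> s; rewrite /= in_itv/= => /andP[s0 st].
rewrite decay_sq ler_expR; nra.
Qed.

Lemma decay_energy_add l t s : 0 <= s <= t ->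
  decay_energy l t = expR (- l * (t - s)) ^+ 2 * decay_energy l s + decay_energy l (t - s).
Proof.
move=> /andP[s0 st]; have t0 := le_trans s0 st.
have ts0 : 0 <= t - s by rewrite subr_ge0.
have [->|l0] := eqVneq l 0.
  have om0 (r : R) : 0 <= r -> decay_energy 0 r = r.
    move=> r0; rewrite /decay_energy (@eq_Rintegral _ _ _ leb `[0, r] (fun=> 1)).
      by rewrite Rint_cst_itv// mul1r.
    by move=> x _; rewrite /decay oppr0 mul0r expR0 mulr1.
  by rewrite !om0// oppr0 mul0r expR0 expr1n mul1r addrC subrK.
apply: (@mulfI _ (2 * l)); first by rewrite mulf_neq0 ?pnatr_eq0.
have e1 : expR (- l * (t - s)) ^+ 2 = expR (- (2 * l) * (t - s)).
  by rewrite expr2 -expRD; congr expR; ring.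
have e2 : expR (- (2 * l) * t) = expR (- (2 * l) * (t - s)) * expR (- (2 * l) * s).
  by rewrite -expRD; congr expR; ring.
move: (decay_energy_id l t0) (decay_energy_id l s0) (decay_energy_id l ts0); rewrite e1 e2.
move: (decay_energy l t) (decay_energy l s) (decay_energy l (t - s)) => a b c -> Hb Hc.
transitivity (expR (- (2 * l) * (t - s)) * (2 * l * b) + 2 * l * c); last by ring.
by rewrite Hb Hc; ring.
Qed.

(** The time factor of the heat kernel seen from time t: it vanishes for s
outside the past of t. *)
Definition cut_decay l t := decay l t \_ `]0, t[.

Lemma cut_decay_L2 l t : L2 leb `[0, +oo[ (cut_decay l t).
Proof. exact: timeL2 (@decay_cont l t). Qed.

Lemma cut_decay_ip l t : ipt (cut_decay l t) (cut_decay l t) = decay_energy l t.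
Proof. by rewrite timeip//; exact: decay_cont. Qed.

Lemma cut_decay_cross l s t : 0 <= s <= t -> ipt (cut_decay l s) (cut_decay l t) = expR (- l * (t - s)) * decay_energy l s.
Proof.
move=> /andP[s0 st]; rewrite timeip//; try exact: decay_cont.
rewrite /decay_energy -RintegralZl//; last by apply: continuous_integrable; apply: contM; exact: decay_cont.
apply: eq_Rintegral => x _; rewrite mulrCA; congr (_ * _).
by rewrite /decay -expRD; congr expR; ring.
Qed.

(** For s <= t, with g = exp(- l (t - s)), the energy of the increment is
(1 - g)^2 om(s) + om(t - s), where om is [decay_energy]. Since
(1 - g)^2 <= |1 - g^2| = 2 |l| om(t - s) and 2 |l| om(s) is bounded by
[decay_energy_id], the first term is at most of the order of the second. The
bound is uniform in l >= - c. *)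
Lemma increment_le c l s t T : 0 <= c -> - c <= l -> 0 <= s <= T -> 0 <= t <= T ->
  ipt (fun x => cut_decay l t x - cut_decay l s x) (fun x => cut_decay l t x - cut_decay l s x) <=
  (expR (2 * c * T) + 1) * decay_energy l `|t - s|.
Proof.
move=> c0 cl; wlog st : s t / s <= t => [H|] sT tT.
  have [|/ltW] := leP s t => st; first exact: H.
  rewrite distrC; apply: le_trans (H _ _ st tT sT).
  by rewrite le_eqVlt; apply/orP; left; apply/eqP; apply: eq_Rintegral => x _; ring.
have s0t : 0 <= s <= t by case/andP: sT => -> _.
have ts0 : 0 <= t - s by rewrite subr_ge0.
have mI : measurable (`[0, +oo[%classic : set (measurableTypeR R)) by exact: measurable_itv.
rewrite ger0_norm// ipBl ?ipBr//; try exact: cut_decay_L2; last by apply: L2B => //; exact: cut_decay_L2.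
rewrite !cut_decay_ip ipC cut_decay_cross// (decay_energy_add l s0t).
have H1 := decay_energy_id l ts0; have H2 := decay_energy_id l (proj1 (andP s0t)).
set g := expR (- l * (t - s)); have g0 : 0 < g by exact: expR_gt0.
have gE : expR (- (2 * l) * (t - s)) = g ^+ 2.
  by rewrite expr2 -expRD; congr expR; ring.
have K1 : 1 <= expR (2 * c * T).
  by rewrite -expR0 ler_expR !mulr_ge0//; case/andP: sT => s0 /(le_trans s0).
have w0 := decay_energy_ge0 l s; have v0 := decay_energy_ge0 l (t - s).
have zK : expR (- (2 * l) * s) <= expR (2 * c * T).
  case/andP: sT => s0 sT; rewrite ler_expR.
  have A1 : 0 <= (c + l) * s by apply: mulr_ge0 => //; rewrite -lerBlDl sub0r.
  have A2 : 0 <= c * (T - s) by apply: mulr_ge0 => //; rewrite subr_ge0.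
  clear - A1 A2; lra.
have z0 := expR_gt0 (- (2 * l) * s).
rewrite gE in H1.
move: (decay_energy l s) (decay_energy l (t - s)) (expR (- (2 * l) * s)) (expR (2 * c * T)) H1 H2 w0 v0 zK z0 K1 => w v z K H1 H2 w0 v0 zK z0 K1.
suff : (1 - g) ^+ 2 * w <= K * v by lra.
have [l0|l0] := leP 0 l.
  have A : (1 - g) ^+ 2 <= 2 * l * v.
    have P : 0 <= 2 * l * v by rewrite !mulr_ge0.
    have g1 : g <= 1 by rewrite -(@expr_le1 _ 2%N)//; [lra|exact: ltW].
    rewrite H1; clear - g0 g1; nra.
  apply: (@le_trans _ _ (2 * l * v * w)); first exact: ler_wpM2r.
  rewrite (_ : 2 * l * v * w = 2 * l * w * v); last by ring.
  by rewrite ler_wpM2r// H2; lra.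
have A : (1 - g) ^+ 2 <= - (2 * l * v).
  have P : 2 * l * v <= 0 by rewrite mulr_le0_ge0// mulr_ge0_le0// ltW.
  have g1 : 1 <= g by rewrite -(@expr_ge1 _ 2%N)//; [lra|exact: ltW].
  rewrite H1; clear - g1; nra.
apply: (@le_trans _ _ (- (2 * l * v) * w)); first exact: ler_wpM2r.
rewrite (_ : - (2 * l * v) * w = - (2 * l * w) * v); last by ring.
by rewrite ler_wpM2r// H2; lra.
Qed.

(** With q = r^(-1/2), the n-th term is at most
4 (1/(n + q) - 1/(n + 1 + q)), and the sum telescopes. *)
Lemma sum_min_le (r : R) N : 0 <= r ->
  \sum_(n < N) Num.min r (n.+1%:R ^- 2) <= 4 * Num.sqrt r.
Proof.
rewrite le_eqVlt => /predU1P[<-|r0].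
  rewrite sqrtr0 mulr0 big1// => n _; apply/min_idPl.
  by rewrite invr_ge0 exprn_ge0.
set a := Num.sqrt r; have a0 : 0 < a by rewrite sqrtr_gt0.
pose q := a^-1; have q0 : 0 < q by rewrite invr_gt0.
have rE : r = q ^- 2 by rewrite /q -exprVn invrK sqr_sqrtr// ltW.
suff H : \sum_(n < N) Num.min r (n.+1%:R ^- 2) <= 4 * (q^-1 - (N%:R + q)^-1).
  apply: le_trans H _; rewrite /q invrK ler_pM2l// gerBl invr_ge0.
  by rewrite addr_ge0// ltW.
elim: N => [|n IH]; first by rewrite big_ord0 add0r subrr mulr0.
rewrite big_ord_recr /=.
suff : Num.min r (n.+1%:R ^- 2) <= 4 * ((n%:R + q)^-1 - (n.+1%:R + q)^-1) by move: IH; lra.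
rewrite -natr1; have n0 : 0 <= n%:R :> R by [].
move: (n%:R) n0 => x x0 {IH}.
have e : (x + q)^-1 - (x + 1 + q)^-1 = ((x + q) * (x + 1 + q))^-1.
  by field; apply/andP; split; apply: lt0r_neq0; lra.
rewrite e rE; have P : 0 < (x + q) * (x + 1 + q) by apply: mulr_gt0; lra.
have C m : 0 < m -> (x + q) * (x + 1 + q) <= 4 * m ^+ 2 ->
    m ^- 2 <= 4 * ((x + q) * (x + 1 + q))^-1.
  move=> m0 H; rewrite -[4]invrK -invfM lef_pV2 ?posrE ?exprn_gt0//.
    by rewrite ler_pdivrMl.
  by rewrite mulr_gt0// invr_gt0.
have [xq|xq] := leP (x + 1) q; rewrite ge_min; apply/orP.
  by left; apply: C => //; nra.
by right; apply: C => //; nra.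
Qed.

Lemma bounded_series_cvg (u : nat -> R) (B : R) : (forall N, \sum_(n < N) `|u n| <= B) ->
  cvgn (series u).
Proof.
move=> H; apply: normed_cvg; apply: nondecreasing_is_cvgn.
  by apply/nondecreasing_series => n _ _; exact: normr_ge0.
by exists B => _ [N _ <-]; rewrite (le_trans _ (H N))// -(big_mkord xpredT (fun n => `|u n|)).
Qed.

End decay.

(** * The heat kernel in mean square *)

Section tensor_series.
Context (R : realType) (L : R).
Local Notation leb := (@lebesgue_measure R).
Local Notation D := (spacetime L).
Let lb2 : {measure set (measurableTypeR R * measurableTypeR R) -> \bar R} := leb2.
Local Notation sqint2 := (L2 lb2 D).
Local Notation ip2 := (ip lb2 D).
Local Notation ipt := (ip leb `[0, +oo[).
Local Notation dot := (ip leb `[0, L]).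
Variable F : nat -> R -> R.
Hypothesis cF : forall n, continuous (F n).
Hypothesis HO : forall m n, dot (F m) (F n) = (m == n)%:R.
Variable u : nat -> R -> R.
Hypothesis Lu : forall n, L2 leb `[0, +oo[ (u n).

Let LF n : L2 leb `[0, L] (F n). Proof. exact: continuous_L2. Qed.
Let Lt n : sqint2 (tensor (u n) (F n)). Proof. exact: tensor_L2. Qed.

Lemma tensor_sum_ip (s : seq nat) : uniq s ->
  ip2 (fun p => \sum_(n <- s) tensor (u n) (F n) p) (fun p => \sum_(n <- s) tensor (u n) (F n) p) =
  \sum_(n <- s) ipt (u n) (u n).
Proof.
move=> us.
have Ls : sqint2 (fun p => \sum_(n <- s) tensor (u n) (F n) p).
  exact: (@L2_sum _ _ _ lb2 D (mD L) _ s xpredT (fun n => tensor (u n) (F n))).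
rewrite (@ip_suml _ _ _ lb2 D (mD L) _ s xpredT (fun n => tensor (u n) (F n)))//.
apply: eq_big_seq => n ns.
rewrite (@ip_sumr _ _ _ lb2 D (mD L) _ s xpredT (fun n => tensor (u n) (F n)))//.
rewrite (bigD1_seq n)//= tensor_ip// HO eqxx mulr1 big1 ?addr0// => m mn.
by rewrite tensor_ip// HO eq_sym (negbTE mn) mulr0.
Qed.

(** The terms of the series are orthogonal since the F n are. Pointwise
convergence identifies the sum, and [fatou_sq] applied to the tails of the
series gives convergence in mean square. *)
Lemma tensor_series (h : R * R -> R) (B : R) :
  (forall N, \sum_(0 <= n < N) ipt (u n) (u n) <= B) ->
  (forall p, D p -> \sum_(0 <= n < N) tensor (u n) (F n) p @[N --> \oo] --> h p) ->
  let g N p := \sum_(0 <= n < N) tensor (u n) (F n) p in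
  [/\ sqint2 h, ip2 h h <= B & ip2 (fun p => h p - g N p) (fun p => h p - g N p) @[N --> \oo] --> 0].
Proof.
move=> HB gh g.
have Lg N : sqint2 (g N).
  exact: (@L2_sum _ _ _ lb2 D (mD L) _ (index_iota 0 N) xpredT (fun n => tensor (u n) (F n))).
have gB N : ip2 (g N) (g N) <= B by rewrite tensor_sum_ip// iota_uniq.
have [Lh hB] := fatou_sq Lg gh gB.
split => //.
pose a N := \sum_(0 <= n < N) ipt (u n) (u n).
have nda : nondecreasing_seq a by apply/nondecreasing_series => n _ _; exact: ip_ge0.
have ca : cvgn a.
  by apply: nondecreasing_is_cvgn => //; exists B => _ [N _ <-]; exact: HB.
have tail N : ip2 (fun p => h p - g N p) (fun p => h p - g N p) <= limn a - a N.
  have Lg' M : sqint2 (fun p => g (M + N)%N p - g N p) by apply: L2B => //; exact: mD.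
  have cg' p : D p -> g (M + N)%N p - g N p @[M --> \oo] --> h p - g N p.
    move=> Dp; apply: cvgB; last exact: cvg_cst.
    by have := gh p Dp; rewrite -(cvg_shiftn N).
  suff B' M : ip2 (fun p => g (M + N)%N p - g N p) (fun p => g (M + N)%N p - g N p) <= limn a - a N.
    by have [] := fatou_sq Lg' cg' B'.
  have NM : (N <= M + N)%N by exact: leq_addl.
  have e p : g (M + N)%N p - g N p = \sum_(N <= n < M + N) tensor (u n) (F n) p.
    exact: (sub_series_geq (fun n => tensor (u n) (F n) p) NM).
  rewrite (eq_ip lb2 (fun p _ => e p) (fun p _ => e p)) tensor_sum_ip ?iota_uniq//.
  rewrite -(sub_series_geq (fun n => ipt (u n) (u n)) NM) lerB//.
  exact: nondecreasing_cvgn_le.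
apply: (@squeeze0 R _ (fun N => limn a - a N)).
  by move=> N; rewrite ip_ge0 tail.
rewrite -[X in _ --> X](subrr (limn a)); apply: cvgB; first exact: cvg_cst.
exact: ca.
Qed.

End tensor_series.

Section heat.
Context (R : realType) (L alpha beta : R) (lam : nat -> R) (F F1 f : nat -> R -> R).
Hypothesis L0 : 0 < L.
Local Notation leb := (@lebesgue_measure R).
Local Notation D := (spacetime L).
Let lb2 : {measure set (measurableTypeR R * measurableTypeR R) -> \bar R} := leb2.
Local Notation sqint2 := (L2 lb2 D).
Local Notation ip2 := (ip lb2 D).
Local Notation ipt := (ip leb `[0, +oo[).
Local Notation dot := (ip leb `[0, L]).
Local Notation dom := (robin_dom L alpha beta).
Local Notation c1 := (spectral_shift L alpha beta).
Local Notation mu := (shifted_lam L alpha beta lam).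
Local Notation aw := (weyl_const L alpha beta).
Hypothesis HF : forall n, dom (F n) (F1 n) (fun x => - (2 * lam n) * F n x).
Hypothesis HO : forall m n, dot (F m) (F n) = (m == n)%:R.
Hypothesis Hlam : {homo lam : m n / (m <= n)%N >-> m <= n}.
Hypothesis Hf : forall n x, 0 <= x <= L -> f n x = F n x.
Variable T : R.
Hypothesis T0 : 0 < T.

Let cF n : continuous (F n). Proof. exact: (F_cont HF). Qed.
Let mu0 n : 0 < mu n. Proof. exact: mu_gt0 L0 HF HO n. Qed.
Let aw0 : 0 < aw. Proof. exact: weyl_const_gt0. Qed.
Let c10 : 0 <= c1. Proof. by rewrite /spectral_shift addr_ge0// divr_ge0// form_const_ge0. Qed.
Let lamc n : - c1 <= lam n. Proof. by have := mu0 n; rewrite /shifted_lam; lra. Qed.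
Let mI0 : measurable (`[0, +oo[%classic : set (measurableTypeR R)). Proof. exact: measurable_itv. Qed.
Local Hint Resolve mI0 : core.

Let muV n : (mu n)^-1 <= aw^-1 * n.+1%:R ^- 2.
Proof.
have P : 0 < aw * n.+1%:R ^+ 2 by apply: mulr_gt0 => //; apply: exprn_gt0.
by rewrite -invfM lef_pV2 ?posrE//; exact: (weyl L0 HF HO Hlam n).
Qed.

(** The two regimes of the energy: of the order t for short times, and at most
of the order of the inverse eigenvalue, hence 1 / n^2, always. *)
Lemma decay_energy_bound : exists2 A, 0 < A & forall n (t : R), 0 <= t <= T ->
  decay_energy (lam n) t <= A * Num.min t (n.+1%:R ^- 2) /\ mu n * decay_energy (lam n) t <= A.
Proof.
pose k := expR (2 * c1 * T); have k0 : 0 < k by exact: expR_gt0.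
pose A1 := 1 + 2 * c1 * k * T.
have A10 : 0 < A1 by rewrite ltr_wpDr// !mulr_ge0// ltW.
have AV : 0 < A1 * aw^-1 by rewrite mulr_gt0// invr_gt0.
exists (k + A1 + A1 * aw^-1); first by apply: addr_gt0 => //; apply: addr_gt0.
move=> n t /[dup] tT /andP[t0 t1].
have o1 := decay_energy_le c10 (lamc n) tT; have o0 := decay_energy_ge0 (lam n) t.
have o2 : mu n * decay_energy (lam n) t <= A1.
  have e := decay_energy_id (lam n) t0; have z0 := expR_gt0 (- (2 * lam n) * t).
  have kT : k * t <= k * T by rewrite ler_pM2l.
  have o3 : decay_energy (lam n) t <= k * T by exact: le_trans kT.
  have o4 : c1 * decay_energy (lam n) t <= c1 * (k * T) by exact: ler_wpM2l.
  have o5 : 0 <= c1 * decay_energy (lam n) t by exact: mulr_ge0.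
  have kT0 : 0 <= c1 * (k * T) by exact: le_trans o4.
  rewrite /shifted_lam mulrDl /A1; move: e o4 o5 z0 kT0.
  move: (decay_energy _ _) (expR _) => o z; lra.
have o3 : decay_energy (lam n) t <= A1 * aw^-1 * n.+1%:R ^- 2.
  rewrite -mulrA; apply: (@le_trans _ _ (A1 * (mu n)^-1)).
    by rewrite ler_pdivlMr// mulrC.
  by rewrite ler_pM2l.
split.
  have m0 : 0 <= n.+1%:R ^- 2 :> R by rewrite invr_ge0 exprn_ge0.
  have [_|_] := leP t (n.+1%:R ^- 2).
    apply: (le_trans o1); rewrite ler_wpM2r// -addrA lerDl addr_ge0// ltW//.
  by apply: (le_trans o3); rewrite ler_wpM2r// lerDr addr_ge0// ltW.
by apply: (le_trans o2); rewrite addrAC lerDr addr_ge0// ltW.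
Qed.

Lemma sum_dom (a : nat -> R) c r N : 0 <= c -> 0 <= r ->
  (forall n, a n <= c * Num.min r (n.+1%:R ^- 2)) ->
  \sum_(0 <= n < N) a n <= c * (4 * Num.sqrt r).
Proof.
move=> c0 r0 H; apply: (@le_trans _ _ (c * \sum_(n < N) Num.min r (n.+1%:R ^- 2))).
  by rewrite big_mkord mulr_sumr; apply: ler_sum.
by rewrite ler_wpM2l// sum_min_le.
Qed.

(** The n-th coefficient of [kernel p] in the orthonormal system F, as a function
of time. *)
Definition coef (p : R * R) n s := F n p.2 * cut_decay (lam n) p.1 s.

Lemma coef_L2 p n : L2 leb `[0, +oo[ (coef p n).
Proof. by apply: L2Z => //; exact: cut_decay_L2. Qed.

Lemma coef_ip p n : ipt (coef p n) (coef p n) = F n p.2 ^+ 2 * decay_energy (lam n) p.1.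
Proof. by rewrite ipZl ?ipZr ?cut_decay_ip//; try exact: cut_decay_L2; [rewrite expr2 mulrA|exact: coef_L2]. Qed.

Lemma le_min_mul (c x y X : R) : X <= c * x -> X <= c * y -> X <= c * Num.min x y.
Proof. by have [] := leP x y. Qed.

Lemma sqrB_le (x y k : R) : x ^+ 2 <= k -> y ^+ 2 <= k -> (x - y) ^+ 2 <= 4 * k.
Proof. nra. Qed.

(** A displacement is split into one in space, where the Lipschitz bound and the
uniform bound on F n give min((x - y)^2, 1/n^2), and one in time, governed by
[increment_le]. *)
Lemma coef_energy : exists2 C, 0 < C & forall p q : R * R,
  0 <= p.1 <= T -> 0 <= p.2 <= L -> 0 <= q.1 <= T -> 0 <= q.2 <= L ->
  (forall N, \sum_(0 <= n < N) ipt (coef p n) (coef p n) <= C * Num.sqrt p.1) /\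
  (forall N, \sum_(0 <= n < N) ipt (fun s => coef p n s - coef q n s) (fun s => coef p n s - coef q n s)
     <= C * (`|p.2 - q.2| + Num.sqrt `|p.1 - q.1|)).
Proof.
have [K K0 KH] := eigenfunction_bounds L0 HF HO.
have [A A0 AH] := decay_energy_bound.
pose k := expR (2 * c1 * T); have k0 : 0 < k by exact: expR_gt0.
exists (K * A * (40 + 8 * k)); first by rewrite !mulr_gt0// ltr_wpDr// mulr_ge0// ltW.
move=> p q p1 p2 q1 q2; split=> N.
  have H n : ipt (coef p n) (coef p n) <= K * A * Num.min p.1 (n.+1%:R ^- 2).
    rewrite coef_ip -mulrA; apply: ler_pM; rewrite ?sqr_ge0 ?decay_energy_ge0//.
      by have [] := KH n _ p2.
    by have [] := AH n _ p1.
  apply: (le_trans (sum_dom N _ _ H)).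
  - by rewrite mulr_ge0// ltW.
  - by case/andP: p1.
  - rewrite mulrA ler_wpM2r ?sqrtr_ge0// ler_wpM2l// ?mulr_ge0 ?(ltW K0) ?(ltW A0)//.
    by move: (k) k0 => k' k0'; lra.
pose d := p.2 - q.2; pose r := `|p.1 - q.1|.
have rT : 0 <= r <= T.
  rewrite normr_ge0 ler_norml; case/andP: p1; case/andP: q1; move=> *; lra.
have H n : ipt (fun s => coef p n s - coef q n s) (fun s => coef p n s - coef q n s) <=
   8 * K * A * Num.min (d ^+ 2) (n.+1%:R ^- 2) + 2 * K * (k + 1) * A * Num.min r (n.+1%:R ^- 2).
  have LE t : L2 leb `[0, +oo[ (cut_decay (lam n) t) by exact: cut_decay_L2.
  have LB : L2 leb `[0, +oo[ (fun s => cut_decay (lam n) p.1 s - cut_decay (lam n) q.1 s) by exact: L2B.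
  pose a := F n p.2 - F n q.2; pose b := F n q.2.
  rewrite (_ : (fun s => _) = fun s => a * cut_decay (lam n) p.1 s + b * (cut_decay (lam n) p.1 s - cut_decay (lam n) q.1 s)); last first.
    by apply/funext => s; rewrite /coef /a /b; ring.
  apply: (le_trans (ip_sqD _ _ _)) => //; [exact: L2Z|exact: L2Z|].
  have sqZ c (g : R -> R) : L2 leb `[0, +oo[ g -> ipt (fun s => c * g s) (fun s => c * g s) = c ^+ 2 * ipt g g.
    by move=> Lg; rewrite ipZl ?ipZr//; [rewrite mulrA expr2|exact: L2Z].
  rewrite !sqZ// cut_decay_ip.
  have [ow1 ow2] := AH n _ p1; have [ow3 _] := AH n _ rT.
  have incr := increment_le c10 (lamc n) q1 p1.
  have [Kp _] := KH n _ p2; have [Kq _] := KH n _ q2.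
  have lip := eigenfunction_lipschitz HF KH n p2 q2.
  have w0 := decay_energy_ge0 (lam n) p.1.
  have m0 : 0 <= n.+1%:R ^- 2 :> R by rewrite invr_ge0 exprn_ge0.
  have A2 : a ^+ 2 * decay_energy (lam n) p.1 <= 4 * K * A * d ^+ 2.
    apply: (@le_trans _ _ (K * mu n * d ^+ 2 * decay_energy (lam n) p.1)); first exact: ler_wpM2r.
    rewrite (_ : _ * decay_energy _ _ = K * (mu n * decay_energy (lam n) p.1) * d ^+ 2); last by ring.
    rewrite ler_wpM2r ?sqr_ge0//; apply: (@le_trans _ _ (K * A)); first by rewrite ler_pM2l.
    by rewrite -mulrA ler_peMl ?mulr_ge0 ?(ltW K0) ?(ltW A0)// ler1n.
  have A3 : a ^+ 2 * decay_energy (lam n) p.1 <= 4 * K * A * n.+1%:R ^- 2.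
    rewrite -[4 * K * A * _]mulrA; apply: ler_pM; rewrite ?sqr_ge0//.
      by apply: sqrB_le.
    by apply: (le_trans ow1); rewrite ler_pM2l// ge_min lexx orbT.
  have A4 := le_min_mul A2 A3.
  have A5 : b ^+ 2 * ipt (fun s => cut_decay (lam n) p.1 s - cut_decay (lam n) q.1 s) (fun s => cut_decay (lam n) p.1 s - cut_decay (lam n) q.1 s)
      <= K * ((k + 1) * (A * Num.min r (n.+1%:R ^- 2))).
    apply: ler_pM; rewrite ?sqr_ge0 ?ip_ge0//; apply: (le_trans incr).
    by rewrite ler_wpM2l// addr_ge0// ltW.
  apply: (@le_trans _ _ (2 * (4 * K * A * Num.min (d ^+ 2) (n.+1%:R ^- 2)) +
      2 * (K * ((k + 1) * (A * Num.min r (n.+1%:R ^- 2)))))).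
    by apply: lerD; rewrite ler_pM2l.
  by rewrite le_eqVlt; apply/orP; left; apply/eqP; ring.
apply: (le_trans (ler_sum_nat _)).
  by move=> n _; exact: H n.
rewrite big_split/= [leRHS]mulrDr; apply: lerD.
  rewrite -/d -(sqrtr_sqr d).
  apply: (le_trans (sum_dom N _ _ (fun n => lexx _))); rewrite ?sqr_ge0//.
    by rewrite !mulr_ge0// ltW.
  rewrite mulrA ler_wpM2r ?sqrtr_ge0//.
  have KA : 0 < K * A by rewrite mulr_gt0.
  have KAk : 0 < K * A * k by rewrite mulr_gt0.
  by move: KA KAk; lra.
apply: (le_trans (sum_dom N _ _ (fun n => lexx _))); rewrite ?normr_ge0//.
  by rewrite !mulr_ge0// ?addr_ge0// ltW.
rewrite mulrA ler_wpM2r ?sqrtr_ge0//.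
have KA : 0 < K * A by rewrite mulr_gt0.
have KAk : 0 < K * A * k by rewrite mulr_gt0.
by move: KA KAk; lra.
Qed.

Definition kernel (p : R * R) : R * R -> R :=
  (fun q => heat_kernel lam f (p.1 - q.1) p.2 q.2) \_ (`]0, p.1[ `*` `[0, L]).

(** Within the past of p the series converges absolutely, because
exp(- lambda_n r) is at most of the order 1 / (mu_n r); elsewhere all the terms
vanish. *)
Lemma kernel_series p q : 0 <= p.2 <= L -> D q ->
  \sum_(0 <= n < N) tensor (coef p n) (F n) q @[N --> \oo] --> kernel p q.
Proof.
case: p q => [t x] [s y] /= xI [/= _ yI].
have yI' : 0 <= y <= L by move: yI; rewrite in_itv.
rewrite /kernel patchE; have [|] := boolP (s \in `]0, t[).
  move=> sI; rewrite mem_set; last by split.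
  rewrite /= /heat_kernel.
  pose u n := expR (- lam n * (t - s)) * f n x * f n y.
  rewrite (_ : (fun N => _) = series u); last first.
    apply/funext => N; apply: eq_bigr => n _.
    rewrite /tensor /coef /cut_decay/= patchE mem_set// /u !Hf//.
    by rewrite /decay; ring.
  suff : cvgn (series u) by [].
  have [K K0 KH] := eigenfunction_bounds L0 HF HO.
  have r0 : 0 < t - s by move: sI; rewrite in_itv/= => /andP[_]; rewrite subr_gt0.
  pose B := expR (c1 * (t - s)) * (t - s)^-1 * aw^-1 * K.
  have B0 : 0 <= B by rewrite !mulr_ge0// ?expR_ge0// ?invr_ge0 ltW.
  apply: (@bounded_series_cvg _ _ (B * (4 * Num.sqrt 1))) => N.
  rewrite -(big_mkord xpredT (fun n => `|u n|)); apply: sum_dom => // n.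
  have -> : Num.min 1 (n.+1%:R ^- 2) = n.+1%:R ^- 2 :> R.
    by apply/min_idPr; rewrite invf_le1 ?exprn_gt0// exprn_ege1// ler1n.
  rewrite /u !Hf// !normrM ger0_norm ?expR_ge0//.
  have [Kx _] := KH n _ xI; have [Ky _] := KH n _ yI'.
  have FK : `|F n x| * `|F n y| <= K.
    rewrite -(real_normK (num_real (F n x))) in Kx; rewrite -(real_normK (num_real (F n y))) in Ky.
    move: `|F n x| `|F n y| Kx Ky => a b; nra.
  have eb : expR (- lam n * (t - s)) <= expR (c1 * (t - s)) * (t - s)^-1 * (mu n)^-1.
    rewrite (_ : - lam n * (t - s) = c1 * (t - s) + - (mu n * (t - s))); last first.
      by rewrite /shifted_lam; ring.
    rewrite expRD -mulrA ler_pM2l ?expR_gt0// -invfM expRN lef_pV2 ?posrE ?expR_gt0//.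
      by apply: le_trans (expR_ge1Dx _); rewrite [leRHS]addrC mulrC lerDl.
    by rewrite mulr_gt0.
  rewrite -mulrA; apply: (@le_trans _ _ (expR (c1 * (t - s)) / (t - s) / mu n * K)).
    by apply: ler_pM; rewrite ?expR_ge0 ?mulr_ge0.
  move: (n.+1%:R ^- 2) (muV n) => m mm.
  have -> : B * m = expR (c1 * (t - s)) / (t - s) * (aw^-1 * m) * K by rewrite /B; ring.
  by rewrite ler_wpM2r ?(ltW K0)// ler_wpM2l// mulr_ge0 ?expR_ge0// invr_ge0 ltW.
move=> sI; rewrite memNset/=; last by case=> /=; rewrite (negbTE sI).
rewrite (_ : (fun N => _) = fun=> 0); first exact: cvg_cst.
apply/funext => N; apply: big1 => n _.
by rewrite /tensor /coef /cut_decay/= patchE memNset ?mulr0 ?mul0r//=; apply/negP.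
Qed.

Lemma kernel_bounds : exists2 C, 0 < C & forall p q : R * R,
  0 <= p.1 <= T -> 0 <= p.2 <= L -> 0 <= q.1 <= T -> 0 <= q.2 <= L ->
  [/\ sqint2 (kernel p),
    ip2 (kernel p) (kernel p) <= C * Num.sqrt p.1,
    ip2 (fun z => kernel p z - kernel q z) (fun z => kernel p z - kernel q z)
      <= C * (`|p.2 - q.2| + Num.sqrt `|p.1 - q.1|) &
    let g N z := \sum_(0 <= n < N) tensor (coef p n) (F n) z in
    ip2 (fun z => kernel p z - g N z) (fun z => kernel p z - g N z) @[N --> \oo] --> 0].
Proof.
have [C C0 CH] := coef_energy; exists C => // p q p1 p2 q1 q2.
have [H1 H2] := CH p q p1 p2 q1 q2.
have [h1 h2 h3] := tensor_series cF HO (coef_L2 p) H1 (fun z Dz => kernel_series p2 Dz).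
split => //.
have Ld n : L2 leb `[0, +oo[ (fun s => coef p n s - coef q n s).
  by apply: L2B => //; exact: coef_L2.
have [|_ h4 _] := tensor_series (h := fun z => kernel p z - kernel q z) cF HO Ld H2; last exact: h4.
move=> z Dz; rewrite (_ : (fun N => _) = fun N => \sum_(0 <= n < N) tensor (coef p n) (F n) z -
    \sum_(0 <= n < N) tensor (coef q n) (F n) z).
  by apply: cvgB; exact: kernel_series.
by apply/funext => N; rewrite -sumrB; apply: eq_bigr => n _; rewrite /tensor mulrBl.
Qed.

End heat.

(** * Compactly supported bumps *)

Section bump.
Context (R : realType).
Local Notation leb := (@lebesgue_measure R).
Implicit Types (x y z c t s : R).

Definition posp y := Num.max 0 y.

Lemma posp_cases y : (0 <= y /\ posp y = y) \/ (y <= 0 /\ posp y = 0).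
Proof. by rewrite /posp; have [y0|/ltW y0] := leP 0 y; [left|right]. Qed.

Lemma posp_ge0 y : 0 <= posp y.
Proof. by rewrite /posp le_max lexx. Qed.

Lemma posp_cont : continuous posp.
Proof.
have -> : posp = fun y => 2^-1 * (y + `|y|).
  apply/funext => y; case: (posp_cases y) => -[y0 ->].
    by rewrite ger0_norm//; lra.
  by rewrite ler0_norm//; lra.
apply: contZ; apply: contD => z; first exact: cvg_id.
exact: norm_continuous.
Qed.

(** The derivative at 0 is obtained without limits: the square is the primitive
of 2 y_+ that vanishes at 0. *)
Lemma posp_sq_der y : is_derive y 1 (fun y => posp y ^+ 2) (2 * posp y).
Proof.
have cp := contZ (k := 2) posp_cont.
have [G dG] := primitive_exists cp.
have d2 (x : R) : is_derive x 1 (fun x => x ^+ 2) (2 * x).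
  by have /is_derive_eq := derX2 (is_derive_id x 1); apply; rewrite mulr1.
have c2 : continuous (fun x : R => 2 * x) by apply: contZ => z; exact: cvg_id.
have -> : (fun y => posp y ^+ 2) = fun y => G y - G 0.
  apply/funext => x; case: (posp_cases x) => -[x0 ->].
    rewrite -(FTC_global dG cp x0) (@eq_Rintegral _ _ _ leb `[0, x] (fun x => 2 * x)).
      by rewrite (FTC_global d2 c2 x0) expr0n subr0.
    by move=> z; rewrite inE/= in_itv/= => /andP[z0 _]; case: (posp_cases z) => -[h ->] //; lra.
  apply/eqP; rewrite expr0n eq_sym -oppr_eq0 opprB -(FTC_global dG cp x0).
  rewrite (@eq_Rintegral _ _ _ leb `[x, 0] (fun=> 0)) ?Rintegral_cst// ?mul0r//.
  by move=> z; rewrite inE/= in_itv/= => /andP[_ z0]; case: (posp_cases z) => -[h ->] //; lra.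
by have /is_derive_eq := derB (dG y) (is_derive_cst (G 0) y 1); apply; rewrite subr0.
Qed.

Lemma posp_cube_der y : is_derive y 1 (fun y => posp y ^+ 3) (3 * posp y ^+ 2).
Proof.
have -> : (fun y => posp y ^+ 3) = fun y => y * posp y ^+ 2.
  by apply/funext => x; case: (posp_cases x) => -[_ ->]; ring.
have /is_derive_eq := derM (is_derive_id y 1) (posp_sq_der y); apply.
by case: (posp_cases y) => -[_ ->]; ring.
Qed.

Let q z := 1 - z ^+ 2.

(** The bump (1 - z^2)_+^3; the third power is the least one for which it has two
continuous derivatives. *)
Definition kappa z := posp (q z) ^+ 3.
Definition kappa1 z := - 6 * z * posp (q z) ^+ 2.
Definition kappa2 z := - 6 * posp (q z) ^+ 2 + 24 * z ^+ 2 * posp (q z).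

Let q_der z : is_derive z 1 q (- (2 * z)).
Proof.
have /is_derive_eq := derB (is_derive_cst (1 : R) z 1) (derX2 (is_derive_id z 1)).
by apply; rewrite mulr1 sub0r.
Qed.

Lemma kappa_der z : is_derive z 1 kappa (kappa1 z).
Proof.
by have /is_derive_eq := der_comp (posp_cube_der (q z)) (q_der z); apply; rewrite /kappa1; ring.
Qed.

Lemma kappa1_der z : is_derive z 1 kappa1 (kappa2 z).
Proof.
have /is_derive_eq := derM (derZ (- 6) (is_derive_id z 1)) (der_comp (posp_sq_der (q z)) (q_der z)).
by apply; rewrite /kappa2; ring.
Qed.

Lemma kappa2_cont : continuous kappa2.
Proof.
have ci : continuous (fun z : R => z) by move=> z; exact: cvg_id.
have cq : continuous q by exact: deriv_continuous q_der.
have cpq : continuous (fun z => posp (q z)).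
  by move=> z; apply: continuous_comp; [exact: cq|exact: posp_cont].
apply: contD; first by apply: contZ; exact: contM.
by apply: contM => //; apply: contZ; exact: contM.
Qed.

Lemma kappa_off z : 1 <= z ^+ 2 -> [/\ kappa z = 0, kappa1 z = 0 & kappa2 z = 0].
Proof.
move=> z1; have p0 : posp (q z) = 0.
  by apply/max_idPl; rewrite /q; lra.
by rewrite /kappa /kappa1 /kappa2 p0; split; ring.
Qed.

Lemma kappa_bound z : [/\ `|kappa z| <= 30, `|kappa1 z| <= 30 & `|kappa2 z| <= 30].
Proof.
have [z1|/ltW z1] := leP 1 (z ^+ 2).
  by have [-> -> ->] := kappa_off z1; rewrite normr0.
have p0 := posp_ge0 (q z).
have p1 : posp (q z) <= 1 by rewrite /posp ge_max ler01/= /q gerBl sqr_ge0.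
have z2 : `|z| <= 1 by rewrite -(@expr_le1 _ 2%N)// real_normK// num_real.
rewrite /kappa /kappa1 /kappa2; move: (posp (q z)) p0 p1 => p p0 p1.
have pn n : 0 <= p ^+ n <= 1 by rewrite exprn_ge0// exprn_ile1.
have /andP[p2 p2'] := pn 2%N; have /andP[p3 p3'] := pn 3%N.
split.
- by rewrite ger0_norm//; lra.
- rewrite normrM (ger0_norm p2) normrM normrN normr_nat (@le_trans _ _ (6 * 1 * 1))//; last by lra.
  by rewrite -!mulrA ler_pM2l// ler_pM.
- have zp : 0 <= z ^+ 2 * p <= 1.
    rewrite mulr_ge0 ?sqr_ge0//= -[leRHS]mulr1; apply: ler_pM => //; exact: sqr_ge0.
  rewrite -mulrA; move: zp p2 p2'; move: (z ^+ 2 * p) (p ^+ 2) => a b /andP[a0 a1] b0 b1.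
  by rewrite ler_norml; lra.
Qed.

Lemma kappa0 : kappa 0 = 1.
Proof. by rewrite /kappa /q expr0n subr0 /posp max_r// expr1n. Qed.

Lemma kappa_ge0 z : 0 <= kappa z.
Proof. by rewrite exprn_ge0 ?posp_ge0. Qed.

Lemma kappa1_odd z : kappa1 (- z) = - kappa1 z.
Proof. by rewrite /kappa1 /q sqrrN; ring. Qed.

Lemma scaled_der (k k1 : R -> R) c d y : (forall z, is_derive z 1 k (k1 z)) ->
  is_derive y 1 (fun y => k ((y - c) * d)) (d * k1 ((y - c) * d)).
Proof.
move=> dk; have H : is_derive y 1 (fun y => (y - c) * d) d.
  have /is_derive_eq := derM (derB (is_derive_id y 1) (is_derive_cst c y 1)) (is_derive_cst d y 1).
  by apply; rewrite /cst; ring.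
by have /is_derive_eq := @der_comp _ k (fun y => (y - c) * d) y _ d (dk ((y - c) * d)) H; apply; rewrite mulrC.
Qed.

(** On the support, of length 2 d around c, the squared function is at most
m^2 times 2 / (1 + z^2) with z = (y - c) / d, whose primitive is bounded. *)
Lemma support_integral (f : R -> R) (a b c d m : R) : a <= b -> 0 < d -> continuous f ->
  (forall y, a <= y <= b -> `|f y| <= m) -> (forall y, d <= `|y - c| -> f y = 0) ->
  \int[leb]_(y in `[a, b]) (f y * f y) <= 2 * pi * m ^+ 2 * d.
Proof.
move=> ab d0 cf fm f0.
pose k z : R := (1 + z ^+ 2)^-1.
have k0 z : 0 < 1 + z ^+ 2 by rewrite ltr_pwDl// sqr_ge0.
have dk z : is_derive z 1 atan (k z).
  by apply: DeriveDef; [exact: derivable_atan|rewrite -derive1E derive1_atan].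
have ck : continuous k.
  move=> z; apply: cvgV; first by rewrite gt_eqF.
  apply: cvgD; first exact: cvg_cst.
  by rewrite expr2; apply: (@cvgM _ _ _ _ (fun z : R => z) (fun z : R => z)); exact: cvg_id.
pose h y := 2 * m ^+ 2 * d * (d^-1 * k ((y - c) * d^-1)).
have dh (y : R) : is_derive y 1 (fun y => 2 * m ^+ 2 * d * atan ((y - c) * d^-1)) (h y).
  exact: (derZ (2 * m ^+ 2 * d) (scaled_der c d^-1 y dk)).
have ch : continuous h.
  apply: contZ; apply: contZ => y.
  apply: (@continuous_comp _ _ _ (fun y => (y - c) * d^-1) k); last exact: ck.
  by apply: cvgM; [apply: cvgB; [exact: cvg_id|exact: cvg_cst]|exact: cvg_cst].
apply: (@le_trans _ _ (\int[leb]_(y in `[a, b]) h y)).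
  apply: le_Rintegral => //; try exact: continuous_integrable.
    by apply: continuous_integrable; exact: contM.
  move=> y; rewrite /= in_itv/= => yI.
  have -> : h y = 2 * m ^+ 2 * k ((y - c) * d^-1).
    by rewrite /h mulrA mulfK// gt_eqF.
  have [yd|yd] := leP d `|y - c|.
    by rewrite f0// mulr0; apply: mulr_ge0; [rewrite mulr_ge0// sqr_ge0|rewrite invr_ge0 ltW].
  have fm2 : f y ^+ 2 <= m ^+ 2.
    by rewrite -[f y ^+ 2]real_normK ?num_real// lerXn2r ?nnegrE// ?fm// (le_trans _ (fm y yI)).
  have zz : ((y - c) * d^-1) ^+ 2 <= 1.
    rewrite -[_ ^+ 2]real_normK ?num_real// expr_le1// normrM normfV (gtr0_norm d0).
    by rewrite ler_pdivrMr// mul1r ltW.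
  rewrite -expr2; apply: (le_trans fm2); rewrite mulrAC ler_peMl ?sqr_ge0// /k.
  by rewrite ler_pdivlMr// mul1r; lra.
rewrite (FTC_global dh ch ab) -mulrBr.
have H x : - (pi / 2) <= atan x <= pi / 2 by rewrite !ltW ?atan_gtNpi2 ?atan_ltpi2.
rewrite (_ : 2 * pi * m ^+ 2 * d = 2 * m ^+ 2 * d * pi); last by ring.
apply: ler_wpM2l; first by apply: mulr_ge0; [apply: mulr_ge0 => //; exact: sqr_ge0|exact: ltW].
by move: (H ((b - c) / d)) (H ((a - c) / d)); lra.
Qed.

Lemma time_bump (T : R) : 0 < T -> exists2 C, 0 < C & forall t e, 0 < e ->
  exists tau tau1 : R -> R, [/\ C1 tau tau1, tau t = 1, (forall s, e <= `|t - s| -> tau s = 0),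
    \int[leb]_(s in `[0, T]) (tau s * tau s) <= C * e &
    \int[leb]_(s in `[0, T]) (tau1 s * tau1 s) <= C * e^-1].
Proof.
move=> T0; exists (2 * pi * 30 ^+ 2); first by rewrite !mulr_gt0// pi_gt0.
move=> t e e0; pose z s := (s - t) * e^-1.
have zoff s : e <= `|s - t| -> 1 <= z s ^+ 2.
  move=> es; rewrite -[_ ^+ 2]real_normK ?num_real// exprn_ege1// normrM normfV (gtr0_norm e0).
  by rewrite ler_pdivlMr// mul1r.
have C1tau : C1 (fun s => kappa (z s)) (fun s => e^-1 * kappa1 (z s)).
  split; first by move=> s; exact: (scaled_der t e^-1 s kappa_der).
  apply: contZ; apply: (deriv_continuous (f := fun s => e^-1 * kappa2 (z s))) => s.
  exact: (scaled_der t e^-1 s kappa1_der).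
exists (fun s => kappa (z s)), (fun s => e^-1 * kappa1 (z s)); split => //.
- by rewrite /z subrr mul0r kappa0.
- by move=> s es; have [] := kappa_off (zoff s _); rewrite // distrC.
- apply: (@support_integral _ 0 T t e 30) => //; first exact: ltW.
  + exact: C1_cont C1tau.
  + by move=> s _; have [] := kappa_bound (z s).
  + by move=> s es; have [] := kappa_off (zoff s es).
- apply: le_trans (@support_integral _ 0 T t e (e^-1 * 30) _ _ _ _ _) _ => //; first exact: ltW.
  + by case: C1tau.
  + move=> s _; rewrite normrM ger0_norm ?invr_ge0 ?(ltW e0)// ler_pM2l ?invr_gt0//.
    by have [] := kappa_bound (z s).
  + by move=> s es; have [_ -> _] := kappa_off (zoff s es); rewrite mulr0.
  + by rewrite le_eqVlt; apply/orP; left; apply/eqP; field; rewrite gt_eqF.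
Qed.

End bump.

(** * Localised functions obeying the Robin conditions *)

Section space_bump.
Context (R : realType) (L alpha beta : R).
Hypothesis L0 : 0 < L.
Local Notation leb := (@lebesgue_measure R).
Local Notation dot := (ip leb `[0, L]).
Local Notation dom := (robin_dom L alpha beta).
Implicit Types (x y z c : R).

Let g := (alpha - beta) / L.
(** The logarithmic derivative of theta is - alpha at 0 and - beta at L.
Multiplying by theta therefore turns functions with vanishing derivative at
both ends into functions obeying the Robin conditions. *)
Definition theta y := expR (- alpha * y + g / 2 * y ^+ 2).
Definition theta1 y := (- alpha + g * y) * theta y.
Definition theta2 y := (g + (- alpha + g * y) ^+ 2) * theta y.

Lemma theta_der y : is_derive y 1 theta (theta1 y).
Proof.
have /is_derive_eq := @der_comp _ expR (fun y => - alpha * y + g / 2 * y ^+ 2) y _ _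
  (is_derive_expR _) (derD (derZ (- alpha) (is_derive_id y 1)) (derZ (g / 2) (derX2 (is_derive_id y 1)))).
by apply; rewrite /theta1 /theta; field.
Qed.

Lemma theta1_der y : is_derive y 1 theta1 (theta2 y).
Proof.
have H : is_derive y 1 (fun y => - alpha + g * y) g.
  have /is_derive_eq := derD (is_derive_cst (- alpha) y 1) (derZ g (is_derive_id y 1)).
  by apply; rewrite add0r mulr1.
by have /is_derive_eq := derM H (theta_der y); apply; rewrite /theta1 /theta2; ring.
Qed.

Lemma theta_cont : [/\ continuous theta, continuous theta1 & continuous theta2].
Proof.
have ct : continuous theta := deriv_continuous theta_der.
split => //; first exact: deriv_continuous theta1_der.
have cl : continuous (fun y => - alpha + g * y).
  by apply: contD; [exact: cont_cst|apply: contZ => z; exact: cvg_id].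
apply: contM => //; apply: contD; first exact: cont_cst.
exact: (contM cl cl).
Qed.

Section piece.
Variables (c d : R).
Let z y := (y - c) * d.

Definition piece y := theta y * kappa (z y).
Definition piece1 y := theta1 y * kappa (z y) + theta y * (d * kappa1 (z y)).
Definition piece2 y := theta2 y * kappa (z y) + 2 * (theta1 y * (d * kappa1 (z y))) +
  theta y * (d * (d * kappa2 (z y))).

Lemma piece_C1 : C1 piece piece1 /\ C1 piece1 piece2.
Proof.
have dk y : is_derive y 1 (fun y => kappa (z y)) (d * kappa1 (z y)).
  exact: (scaled_der c d y (@kappa_der R)).
have dk1 y : is_derive y 1 (fun y => d * kappa1 (z y)) (d * (d * kappa2 (z y))).
  exact: (derZ d (scaled_der c d y (@kappa1_der R))).
have d1 y : is_derive y 1 piece (piece1 y).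
  by have /is_derive_eq := derM (theta_der y) (dk y); apply.
have d2 y : is_derive y 1 piece1 (piece2 y).
  have /is_derive_eq := derD (derM (theta1_der y) (dk y)) (derM (theta_der y) (dk1 y)).
  by apply; rewrite /piece2; ring.
have [ct ct1 ct2] := theta_cont.
have ck := deriv_continuous dk; have ck1 := deriv_continuous dk1.
split; split => //; first exact: deriv_continuous d2.
apply: contD; [apply: contD|].
- exact: contM.
- by apply: contZ; exact: contM.
- apply: contM => //; apply: contZ; apply: contZ => y.
  apply: (@continuous_comp R R R z (@kappa2 R) y); last exact: kappa2_cont.
  by apply: cvgM; [apply: cvgB; [exact: cvg_id|exact: cvg_cst]|exact: cvg_cst].
Qed.

Lemma piece_off y : 0 < d -> d^-1 <= `|y - c| -> [/\ piece y = 0, kappa1 (z y) = 0 & piece2 y = 0].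
Proof.
move=> d0 yd; have z1 : 1 <= z y ^+ 2.
  rewrite -[_ ^+ 2]real_normK ?num_real// exprn_ege1// normrM (gtr0_norm d0).
  by rewrite -ler_pdivrMr// mul1r.
by have [e e1 e2] := kappa_off z1; rewrite /piece /piece2 e e1 e2; split => //; ring.
Qed.

Lemma piece_bound B : 0 <= B -> (forall y, 0 <= y <= L -> [/\ `|theta y| <= B, `|theta1 y| <= B & `|theta2 y| <= B]) ->
  0 < d -> 1 <= L * d -> forall y, 0 <= y <= L ->
  `|piece y| <= 30 * B /\ `|piece2 y| <= 30 * B * (1 + L) ^+ 2 * d ^+ 2.
Proof.
move=> B0 HB d0 Ld y /HB[t0 t1 t2]; have [k0 k1 k2] := kappa_bound (z y).
have dn : `|d| = d by rewrite gtr0_norm.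
split; first by rewrite normrM mulrC ler_pM.
apply: (@le_trans _ _ (B * 30 + 2 * (B * (d * 30)) + B * (d * (d * 30)))).
  apply: (le_trans (ler_normD _ _)); apply: lerD; first apply: (le_trans (ler_normD _ _)).
    apply: lerD; first by rewrite normrM ler_pM.
    rewrite normrM normr_nat ler_pM2l// normrM ler_pM// normrM dn ler_pM2l//.
  by rewrite normrM ler_pM// !normrM dn !ler_pM2l.
rewrite (_ : B * 30 + 2 * (B * (d * 30)) + B * (d * (d * 30)) = 30 * B * (1 + d) ^+ 2); last by ring.
rewrite -[leRHS]mulrA -exprMn ler_wpM2l ?mulr_ge0// lerXn2r ?nnegrE ?addr_ge0 ?mulr_ge0 ?addr_ge0 ?(ltW d0) ?(ltW L0)//.
by rewrite mulrDl mul1r addrC lerD2l.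
Qed.

End piece.

Lemma dot_sq3 (f1 f2 f3 : R -> R) K : continuous f1 -> continuous f2 -> continuous f3 ->
  dot f1 f1 <= K -> dot f2 f2 <= K -> dot f3 f3 <= K ->
  dot (fun y => f1 y + f2 y + f3 y) (fun y => f1 y + f2 y + f3 y) <= 10 * K.
Proof.
move=> cf1 cf2 cf3 H1 H2 H3.
have := dot_sqD L (contD cf1 cf2) cf3; have := dot_sqD L cf1 cf2.
by move: H1 H2 H3; lra.
Qed.

(** The bump of width d at x is completed by its reflections at the two ends,
centred at - x and 2 L - x. The sum has vanishing derivative at 0 and L, since
d <= L keeps each reflection away from the opposite end, and within the
interval the reflections vanish wherever the bump itself does. *)
Lemma space_bump : exists C a, [/\ 0 < C, 0 < a & forall x d, 0 <= x <= L -> 0 < d <= L ->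
  exists X X1 X2, [/\ dom X X1 X2, a <= X x,
    (forall y, 0 <= y <= L -> d <= `|x - y| -> X y = 0),
    dot X X <= C * d & dot X2 X2 <= C * d ^- 3]].
Proof.
have [ct ct1 ct2] := theta_cont.
have LL : 0 <= L by exact: ltW.
have [B0 B00 HB0] := cont_bound LL ct; have [B1 B10 HB1] := cont_bound LL ct1.
have [B2 B20 HB2] := cont_bound LL ct2.
have civ : continuous (fun y => expR (- (- alpha * y + g / 2 * y ^+ 2))).
  have D (y : R) : is_derive y 1 (fun y => - alpha * y + g / 2 * y ^+ 2) (- alpha + g * y).
    have /is_derive_eq := derD (derZ (- alpha) (is_derive_id y 1)) (derZ (g / 2) (derX2 (is_derive_id y 1))).
    by apply; field.
  have D' (y : R) : is_derive y 1 (fun y => expR (- (- alpha * y + g / 2 * y ^+ 2)))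
      (expR (- (- alpha * y + g / 2 * y ^+ 2)) * - (- alpha + g * y)).
    exact: (@der_comp _ expR (fun y => - (- alpha * y + g / 2 * y ^+ 2)) y _ _ (is_derive_expR _) (derN (D y))).
  exact: deriv_continuous D'.
have [B3 B30 HB3] := cont_bound LL civ.
pose B := B0 + B1 + B2 + 1.
have Bp : 0 < B by rewrite ltr_wpDl// !addr_ge0.
have HB y : 0 <= y <= L -> [/\ `|theta y| <= B, `|theta1 y| <= B & `|theta2 y| <= B].
  move=> yI; have := HB0 y yI; have := HB1 y yI; have := HB2 y yI.
  by rewrite /B; split; lra.
pose m2 := 30 * B * (1 + L) ^+ 2.
pose C := 10 * (2 * pi * ((30 * B) ^+ 2 + m2 ^+ 2)).
have B3p : 0 < B3 + 1 by rewrite ltr_wpDl.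
exists C, (B3 + 1)^-1; split; [|by rewrite invr_gt0|].
  rewrite /C !mulr_gt0 ?pi_gt0// ltr_wpDr ?sqr_ge0// exprn_gt0// mulr_gt0//.
move=> x d /andP[x0 xL] /andP[d0 dL].
pose e := d^-1; have e0 : 0 < e by rewrite invr_gt0.
have eV : e^-1 = d by rewrite invrK.
have Le : 1 <= L * e by rewrite ler_pdivlMr// mul1r.
pose P c := piece c e; pose P2 c := piece2 c e.
pose c2 := - x; pose c3 := 2 * L - x.
exists (fun y => P x y + P c2 y + P c3 y),
  (fun y => piece1 x e y + piece1 c2 e y + piece1 c3 e y),
  (fun y => P2 x y + P2 c2 y + P2 c3 y).
have [A1 A2] := piece_C1 x e; have [A3 A4] := piece_C1 c2 e; have [A5 A6] := piece_C1 c3 e.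
have off c y : d <= `|y - c| -> [/\ P c y = 0, kappa1 ((y - c) * e) = 0 & P2 c y = 0].
  by move=> h; apply: piece_off => //; rewrite eV.
have bnd c y : 0 <= y <= L -> `|P c y| <= 30 * B /\ `|P2 c y| <= m2 * e ^+ 2.
  by move=> yI; apply: piece_bound => //; exact: ltW.
have cP c : continuous (P c) by have [H _] := piece_C1 c e; exact: C1_cont H.
have cP2 c : continuous (P2 c) by have [_ [_ H]] := piece_C1 c e.
have theta0 : theta1 0 + alpha * theta 0 = 0 by rewrite /theta1; ring.
have thetaL : theta1 L + beta * theta L = 0.
  by rewrite /theta1 /g; field; rewrite gt_eqF.
have bc (t1 t k1 k2 k3 l1 l2 l3 r : R) : t1 + r * t = 0 -> l1 + l2 + l3 = 0 ->
  t1 * k1 + t * (e * l1) + (t1 * k2 + t * (e * l2)) + (t1 * k3 + t * (e * l3)) +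
  r * (t * k1 + t * k2 + t * k3) = 0.
  move=> h1 h2; transitivity ((t1 + r * t) * (k1 + k2 + k3) + t * e * (l1 + l2 + l3)); first by ring.
  by rewrite h1 h2 mul0r mulr0 addr0.
have far3 : d <= `|0 - c3|.
  rewrite /c3 ler0_norm; lra.
have far2 : d <= `|L - c2|.
  rewrite /c2 ger0_norm; lra.
split.
- split; [exact: (C1D (C1D A1 A3) A5)|exact: (C1D (C1D A2 A4) A6)| |].
    rewrite /P /piece1 /piece; apply: bc => //.
    have [_ -> _] := off _ _ far3.
    by rewrite (_ : (0 - x) * e = - ((0 - c2) * e)) ?kappa1_odd; [ring|rewrite /c2; ring].
  rewrite /P /piece1 /piece; apply: bc => //.
  have [_ -> _] := off _ _ far2.
  by rewrite (_ : (L - c3) * e = - ((L - x) * e)) ?kappa1_odd; [ring|rewrite /c3; ring].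
- have tp y : 0 <= theta y by exact: expR_ge0.
  have p0 c : 0 <= P c x by rewrite mulr_ge0 ?kappa_ge0.
  apply: (@le_trans _ _ (P x x)); last by have := p0 c2; have := p0 c3; lra.
  rewrite /P /piece subrr mul0r kappa0 mulr1 /theta -[X in expR X]opprK expRN.
  rewrite lef_pV2 ?posrE ?expR_gt0//.
  have := HB3 x; rewrite x0 xL => /(_ isT); rewrite ger0_norm ?expR_ge0//; lra.
- move=> y /andP[y0 yL] dy.
  have [-> _ _] : [/\ P x y = 0, kappa1 ((y - x) * e) = 0 & P2 x y = 0] by apply: off; rewrite distrC.
  have [-> _ _] : [/\ P c2 y = 0, kappa1 ((y - c2) * e) = 0 & P2 c2 y = 0].
    apply: off; apply: (le_trans dy); rewrite /c2 ler_norml ger0_norm; lra.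
  have [-> _ _] : [/\ P c3 y = 0, kappa1 ((y - c3) * e) = 0 & P2 c3 y = 0].
    apply: off; apply: (le_trans dy); rewrite /c3 ler_norml ler0_norm; lra.
  by rewrite !addr0.
- have H c : dot (P c) (P c) <= 2 * pi * (30 * B) ^+ 2 * d.
    apply: (@support_integral _ _ 0 L c d (30 * B)) => //.
      by move=> y yI; have [] := bnd c y yI.
    by move=> y yd; have [] := off c y yd.
  apply: (le_trans (dot_sq3 (cP x) (cP c2) (cP c3) (H x) (H c2) (H c3))).
  rewrite mulrA ler_pM2r// /C ler_pM2l// ler_pM2l ?mulr_gt0 ?pi_gt0//.
  by rewrite lerDl sqr_ge0.
- have H c : dot (P2 c) (P2 c) <= 2 * pi * (m2 * e ^+ 2) ^+ 2 * d.
    apply: (@support_integral _ _ 0 L c d (m2 * e ^+ 2)) => //.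
      by move=> y yI; have [] := bnd c y yI.
    by move=> y yd; have [] := off c y yd.
  apply: (le_trans (dot_sq3 (cP2 x) (cP2 c2) (cP2 c3) (H x) (H c2) (H c3))).
  have -> : 10 * (2 * pi * (m2 * e ^+ 2) ^+ 2 * d) = 10 * (2 * pi * m2 ^+ 2) * d ^- 3.
    by rewrite /e; field; rewrite gt_eqF.
  rewrite ler_pM2r ?invr_gt0 ?exprn_gt0// /C ler_pM2l// ler_pM2l ?mulr_gt0 ?pi_gt0//.
  by rewrite lerDr sqr_ge0.
Qed.

End space_bump.

(** * The lower bound by duality *)

Section lower.
Context (R : realType) (L alpha beta : R) (lam : nat -> R) (F F1 f : nat -> R -> R).
Hypothesis L0 : 0 < L.
Local Notation leb := (@lebesgue_measure R).
Local Notation D := (spacetime L).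
Let lb2 : {measure set (measurableTypeR R * measurableTypeR R) -> \bar R} := leb2.
Local Notation sqint2 := (L2 lb2 D).
Local Notation ip2 := (ip lb2 D).
Local Notation ipt := (ip leb `[0, +oo[).
Local Notation dot := (ip leb `[0, L]).
Local Notation dom := (robin_dom L alpha beta).
Local Notation kernel := (kernel L lam f).
Local Notation coef := (coef lam F).
Hypothesis HF : forall n, dom (F n) (F1 n) (fun x => - (2 * lam n) * F n x).
Hypothesis HO : forall m n, dot (F m) (F n) = (m == n)%:R.
Hypothesis Hlam : {homo lam : m n / (m <= n)%N >-> m <= n}.
Hypothesis Hspan : forall m g, robin_eigenpair L alpha beta m g ->
  exists (N : nat) (c : nat -> R), (forall n, (n < N)%N -> c n != 0 -> lam n = m) /\
    {in `[0, L], forall x, g x = \sum_(n < N) c n * F n x}.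
Hypothesis Hf : forall n x, 0 <= x <= L -> f n x = F n x.
Variable T : R.
Hypothesis T0 : 0 < T.

Let cF n : continuous (F n). Proof. exact: (F_cont HF). Qed.

(** The heat operator applied to the product of tau and X, which is therefore the
solution of the heat equation with this source. *)
Definition test (tau tau1 X X2 : R -> R) (z : R * R) :=
  tensor (tau1 \_ `]0, T[) X z - 2^-1 * tensor (tau \_ `]0, T[) X2 z.

Section testing.
Variables (tau tau1 X X1 X2 : R -> R).
Hypothesis Ctau : C1 tau tau1.
Hypothesis dX : dom X X1 X2.

Let ctau : continuous tau. Proof. exact: C1_cont Ctau. Qed.
Let ctau1 : continuous tau1. Proof. by case: Ctau. Qed.
Let cX : continuous X. Proof. by have [] := dom_cont dX. Qed.
Let cX2 : continuous X2. Proof. by have [] := dom_cont dX. Qed.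
Let L1 : sqint2 (tensor (tau1 \_ `]0, T[) X).
Proof. by apply: tensor_L2; [exact: timeL2|exact: continuous_L2]. Qed.
Let L2' : sqint2 (tensor (tau \_ `]0, T[) X2).
Proof. by apply: tensor_L2; [exact: timeL2|exact: continuous_L2]. Qed.

Lemma test_L2 : sqint2 (test tau tau1 X X2).
Proof. by apply: L2B; [exact: mD|exact: L1|apply: L2Z => //; exact: mD]. Qed.

(** By Green's identity - (1/2) <X'', F_n> = lambda_n <X, F_n>, so that the time
integrand becomes the derivative of exp(- lambda_n (t - s)) tau(s). *)
Lemma test_coef q n : tau 0 = 0 -> 0 <= q.1 <= T ->
  ip2 (tensor (coef q n) (F n)) (test tau tau1 X X2) = tau q.1 * (dot X (F n) * F n q.2).
Proof.
move=> tau0 /andP[q0 qT].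
have LE : L2 leb `[0, +oo[ (cut_decay (lam n) q.1) by exact: cut_decay_L2.
have Lc : L2 leb `[0, +oo[ (coef q n) by exact: coef_L2.
have LF : L2 leb `[0, L] (F n) by exact: continuous_L2.
have Lt : sqint2 (tensor (coef q n) (F n)) by exact: tensor_L2.
have mI0 : measurable (`[0, +oo[%classic : set (measurableTypeR R)) by exact: measurable_itv.
rewrite ipBr ?ipZr ?tensor_ip//; try exact: mD; try exact: timeL2; try exact: continuous_L2; last first.
  by apply: L2Z => //; exact: mD.
have tE u : continuous u -> ipt (coef q n) (u \_ `]0, T[) =
    F n q.2 * \int[leb]_(s in `[0, q.1]) (decay (lam n) q.1 s * u s).
  by move=> cu; rewrite ipZl ?timeip//; [exact: decay_cont|exact: timeL2].
rewrite (tE _ ctau1) (tE _ ctau).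
have gr : dot (F n) X2 = - (2 * lam n) * dot (F n) X.
  by rewrite -(green_sym L0 (HF n) dX) dotZl.
have cd := @decay_cont R (lam n) q.1.
have ft : lam n * \int[leb]_(s in `[0, q.1]) (decay (lam n) q.1 s * tau s) +
    \int[leb]_(s in `[0, q.1]) (decay (lam n) q.1 s * tau1 s) = tau q.1.
  rewrite -RintegralZl//; last by apply: continuous_integrable; exact: contM.
  rewrite -RintegralD//; last 2 first.
  - by apply: continuous_integrable; apply: contZ; exact: contM.
  - by apply: continuous_integrable; exact: contM.
  have dd (s : R) : is_derive s 1 (fun s => decay (lam n) q.1 s * tau s)
      (lam n * (decay (lam n) q.1 s * tau s) + decay (lam n) q.1 s * tau1 s).
    by have /is_derive_eq := derM (decay_der (lam n) q.1 s) (Ctau.1 s); apply; ring.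
  rewrite (FTC_global dd _ q0) ?tau0 ?mulr0 ?subr0; first by rewrite /decay subrr mulr0 expR0 mul1r.
  by apply: contD; [apply: contZ|]; exact: contM.
by rewrite gr (dotC L (F n) X) -ft; field.
Qed.

(** Summing [test_coef] over n produces the eigenfunction expansion of X. *)
Lemma kernel_test q : tau 0 = 0 -> 0 <= q.1 <= T -> 0 <= q.2 <= L ->
  ip2 (kernel q) (test tau tau1 X X2) = tau q.1 * X q.2.
Proof.
move=> tau0 q1 q2.
have [C C0 CH] := kernel_bounds L0 HF HO Hlam Hf T0.
have [Lk _ _ ck0] := CH q q q1 q2 q1 q2.
pose g N z := \sum_(0 <= n < N) tensor (coef q n) (F n) z.
have ck : ip2 (fun z => kernel q z - g N z) (fun z => kernel q z - g N z) @[N --> \oo] --> (0 : R).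
  exact: ck0.
have Lt n : sqint2 (tensor (coef q n) (F n)).
  by apply: tensor_L2; [exact: coef_L2|exact: continuous_L2].
have Lg N : sqint2 (g N).
  exact: (@L2_sum _ _ _ lb2 D (mD L) _ (index_iota 0 N) xpredT (fun n => tensor (coef q n) (F n))).
have c0 : (fun _ : nat => ip2 (fun z => test tau tau1 X X2 z - test tau tau1 X X2 z)
    (fun z => test tau tau1 X X2 z - test tau tau1 X X2 z)) @ \oo --> (0 : R).
  have -> : (fun z => test tau tau1 X X2 z - test tau tau1 X X2 z) = fun=> 0.
    by apply/funext => z; rewrite subrr.
  by rewrite ip0l; [exact: cvg_cst|exact: mD].
have c1 := cvg_ip (mD L) Lk test_L2 Lg (fun=> test_L2) ck c0.
have c2 : ip2 (g N) (test tau tau1 X X2) @[N --> \oo] --> tau q.1 * X q.2.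
  rewrite (_ : (fun N => _) = fun N => tau q.1 * \sum_(n < N) dot X (F n) * F n q.2).
    by apply: cvgM; [exact: cvg_cst|exact: (expansion L0 HF HO Hlam Hspan dX q2)].
  apply/funext => N; rewrite (@ip_suml _ _ _ lb2 D (mD L) _ (index_iota 0 N) xpredT (fun n => tensor (coef q n) (F n)))//; last exact: test_L2.
  by rewrite big_mkord mulr_sumr; apply: eq_bigr => n _; exact: test_coef.
exact: (cvg_unique _ c1 c2).
Qed.

Lemma test_norm : ip2 (test tau tau1 X X2) (test tau tau1 X X2) <=
  2 * (\int[leb]_(s in `[0, T]) (tau1 s * tau1 s) * dot X X) +
  2^-1 * (\int[leb]_(s in `[0, T]) (tau s * tau s) * dot X2 X2).
Proof.
have e : test tau tau1 X X2 = fun z => tensor (tau1 \_ `]0, T[) X z + - 2^-1 * tensor (tau \_ `]0, T[) X2 z.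
  by apply/funext => z; rewrite /test mulNr.
have LZ : sqint2 (fun z => - 2^-1 * tensor (tau \_ `]0, T[) X2 z) by apply: L2Z => //; exact: mD.
rewrite e; apply: (le_trans (ip_sqD (mD L) L1 LZ)).
rewrite ipZl ?ipZr//; try exact: mD.
rewrite !tensor_ip ?timeip//; try exact: timeL2; try exact: continuous_L2.
by rewrite le_eqVlt; apply/orP; left; apply/eqP; field.
Qed.

End testing.

(** The bump has width d in space and d^2 in time, with d = k M; the factor k
ensures d <= L, which [space_bump] requires, since M is at most sqrt T. *)
Lemma kernel_lower : exists2 C, 0 < C & forall m (p : R * R) (q : 'I_m -> R * R) (c : 'I_m -> R) M,
  0 <= p.1 <= T -> 0 <= p.2 <= L -> (forall j, 0 <= (q j).1 <= T /\ 0 <= (q j).2 <= L) ->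
  0 < M -> M ^+ 2 <= p.1 ->
  (forall j, M ^+ 2 <= `|p.1 - (q j).1| \/ M <= `|p.2 - (q j).2|) ->
  let r z := kernel p z - \sum_j c j * kernel (q j) z in
  C * M <= ip2 r r.
Proof.
have [Ct Ct0 Ht] := time_bump T0.
have [Cx [a [Cx0 a0 Hx]]] := space_bump alpha beta L0.
have [Ck Ck0 Hk] := kernel_bounds L0 HF HO Hlam Hf T0.
pose k := Num.min 1 (L / Num.sqrt T).
have sT : 0 < Num.sqrt T by rewrite sqrtr_gt0.
have k0 : 0 < k by rewrite /k lt_min ltr01 divr_gt0.
have k1 : k <= 1 by rewrite /k ge_min lexx.
pose C := 3 * Ct * Cx; have C0 : 0 < C by rewrite !mulr_gt0.
exists (a ^+ 2 * k / C); first by rewrite divr_gt0// mulr_gt0// exprn_gt0.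
move=> m p q c M p1 p2 hq M0 Mp far /=; set r := fun z => kernel p z - _.
pose d := k * M; have d0 : 0 < d by rewrite mulr_gt0.
have dM : d <= M by rewrite /d ler_piMl// ltW.
have dL : d <= L.
  have MT : M <= Num.sqrt T.
    rewrite -[M]ger0_norm ?(ltW M0)// -sqrtr_sqr ler_wsqrtr// (le_trans Mp)//.
    by case/andP: p1.
  apply: (@le_trans _ _ (L / Num.sqrt T * M)).
    by rewrite /d ler_pM2r// /k ge_min lexx orbT.
  by rewrite mulrAC ler_pdivrMr// ler_pM2l.
have d2 : d ^+ 2 <= M ^+ 2 by rewrite lerXn2r// nnegrE ltW.
have d20 : 0 < d ^+ 2 by rewrite exprn_gt0.
have [tau [tau1 [Ctau taup tauoff tI tI1]]] := Ht p.1 (d ^+ 2) d20.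
have [X [X1 [X2 [dX Xp Xoff xI xI2]]]] := Hx p.2 d p2 (introT andP (conj d0 dL)).
have tau0 : tau 0 = 0.
  by apply: tauoff; rewrite subr0 ger0_norm; [exact: le_trans Mp|case/andP: p1].
pose phi := test tau tau1 X X2.
have Lphi : sqint2 phi by exact: (test_L2 Ctau dX).
have Lq j : sqint2 (fun z => c j * kernel (q j) z).
  apply: L2Z; first exact: mD.
  by have [h1 h2] := hq j; have [] := Hk _ _ h1 h2 h1 h2.
have Lp : sqint2 (kernel p) by have [] := Hk _ _ p1 p2 p1 p2.
have Ls : sqint2 (fun z => \sum_j c j * kernel (q j) z).
  exact: (@L2_sum _ _ _ lb2 D (mD L) _ (index_enum 'I_m) xpredT (fun j z => c j * kernel (q j) z)).
have Lr : sqint2 r by apply: L2B => //; exact: mD.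
have rphi : ip2 r phi = X p.2.
  rewrite ipBl//; last exact: mD.
  rewrite (kernel_test Ctau dX tau0 p1 p2) taup mul1r.
  rewrite (@ip_suml _ _ _ lb2 D (mD L) _ (index_enum 'I_m) xpredT (fun j z => c j * kernel (q j) z))//.
  rewrite big1 ?subr0// => j _; have [h1 h2] := hq j.
  rewrite ipZl//; [|exact: mD|by have [] := Hk _ _ h1 h2 h1 h2].
  rewrite (kernel_test Ctau dX tau0 h1 h2).
  case: (far j) => h; first by rewrite tauoff ?mul0r ?mulr0// (le_trans d2).
  by rewrite Xoff ?mulr0// (le_trans dM).
have phin : ip2 phi phi <= C / d.
  apply: (le_trans (test_norm Ctau dX)).
  have b1 : \int[leb]_(s in `[0, T]) (tau1 s * tau1 s) * dot X X <= Ct * (d ^+ 2)^-1 * (Cx * d).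
    by apply: ler_pM => //; [apply: Rintegral_ge0 => s _; rewrite -expr2 sqr_ge0|exact: dot_ge0].
  have b2 : \int[leb]_(s in `[0, T]) (tau s * tau s) * dot X2 X2 <= Ct * d ^+ 2 * (Cx * d ^- 3).
    by apply: ler_pM => //; [apply: Rintegral_ge0 => s _; rewrite -expr2 sqr_ge0|exact: dot_ge0].
  have e1 : Ct * (d ^+ 2)^-1 * (Cx * d) = Ct * Cx / d by field; rewrite gt_eqF.
  have e2 : Ct * d ^+ 2 * (Cx * d ^- 3) = Ct * Cx / d by field; rewrite gt_eqF.
  have P : 0 < Ct * Cx / d by rewrite divr_gt0// mulr_gt0.
  rewrite e1 in b1; rewrite e2 in b2.
  have -> : C / d = 3 * (Ct * Cx / d) by rewrite /C; ring.
  move: b1 b2 P; lra.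
have CS := ip_CS (mD L) Lr Lphi; rewrite rphi in CS.
have a2 : a ^+ 2 <= ip2 r r * (C / d).
  apply: (@le_trans _ _ (X p.2 ^+ 2)); first by rewrite lerXn2r// nnegrE ?(le_trans (ltW a0) Xp)// ltW.
  by apply: (le_trans CS); rewrite ler_wpM2l// ip_ge0.
have -> : a ^+ 2 * k / C * M = a ^+ 2 / (C / d) by rewrite /d; field; rewrite !gt_eqF.
by rewrite ler_pdivrMr// divr_gt0.
Qed.

End lower.

(** * The two-sided bound *)

Section eigensystem.
Context (R : realType) (L alpha beta : R) (lam : nat -> R) (f : nat -> R -> R).
Local Notation leb := (@lebesgue_measure R).
Local Notation dot := (ip leb `[0, L]).

(** The given eigenfunctions are replaced by functions with the same values on
the interval that are smooth on the whole line. *)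
Lemma eigensystem_extension : 0 < L -> robin_eigensystem L alpha beta lam f ->
  exists F F1 : nat -> R -> R,
  [/\ forall n, robin_dom L alpha beta (F n) (F1 n) (fun x => - (2 * lam n) * F n x),
      forall m n, dot (F m) (F n) = (m == n)%:R,
      forall m g, robin_eigenpair L alpha beta m g ->
        exists (N : nat) (c : nat -> R), (forall n, (n < N)%N -> c n != 0 -> lam n = m) /\
          {in `[0, L], forall x, g x = \sum_(n < N) c n * F n x} &
      forall n x, 0 <= x <= L -> f n x = F n x].
Proof.
move=> L0 [ep _ ort span].
have [C HC] := choice (fun n => fundamental_system (lam n)).
have [S HS] := choice HC.
have rep n := eigenpair_repr L0 (HS n) (ep n).
pose F n x := f n 0 * phi alpha (C n) (S n) x.
have fF n x : 0 <= x <= L -> f n x = F n x by have [H _] := rep n; exact: H.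
exists F, (fun n x => f n 0 * dphi alpha (lam n) (C n) (S n) x); split; last exact: fF.
- move=> n; have [_ D0] := rep n.
  have := domZ (f n 0) (phi_dom (HS n) D0).
  rewrite (_ : (fun x => f n 0 * (- (2 * lam n) * phi alpha (C n) (S n) x)) =
    fun x => - (2 * lam n) * F n x)//.
  by apply/funext => x; rewrite /F; ring.
- move=> m n; rewrite -[RHS]/(fine ((m == n)%:R)%:E) -ort /ip /Rintegral; congr fine.
  apply: eq_integral => x; rewrite inE/= in_itv/= => xI.
  by rewrite !fF.
- move=> m g /span[N [c [c1 c2]]]; exists N, c; split => // x xI; rewrite c2//.
  by apply: eq_bigr => n _; rewrite fF//; move: xI; rewrite in_itv.
Qed.

End eigensystem.

Lemma rho_sq (R : realType) (p q : R * R) :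
  rho p q ^+ 2 = Num.max (Num.sqrt `|p.1 - q.1|) `|p.2 - q.2|.
Proof.
have e1 (a : R) : 0 <= a -> (a `^ (1 / 4)) ^+ 2 = Num.sqrt a.
  move=> a0; rewrite -powR_mulrn ?powR_ge0// -powRrM (_ : 1 / 4 * 2%:R = 2^-1); last by field.
  exact: powR12_sqrt.
have e2 (a : R) : 0 <= a -> (a `^ (1 / 2)) ^+ 2 = a.
  move=> a0; rewrite -powR_mulrn ?powR_ge0// -powRrM (_ : 1 / 2 * 2%:R = 1); last by field.
  exact: powRr1.
rewrite /rho -(e1 _ (normr_ge0 (p.1 - q.1))) -[X in _ = Num.max _ X](e2 _ (normr_ge0 (p.2 - q.2))).
set a := _ `^ _; set b := _ `^ (1 / 2).
have a0 : 0 <= a by exact: powR_ge0.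
have b0 : 0 <= b by exact: powR_ge0.
have [ab|ab] := leP a b; first by rewrite max_r// lerXn2r.
by rewrite max_l// lerXn2r// ltW.
Qed.

Theorem lemma3p8 (R : realType) (d : measure_display)
    (Omega : measurableType d) (P : probability Omega R)
    (L alpha beta : R) (lam : nat -> R) (f : nat -> R -> R)
    (xi : set (R * R) -> {RV P >-> R}) (w : R * R -> {RV P >-> R}) (T : R)
    (hL : 0 < L) (hT : 0 < T)
    (heig : robin_eigensystem L alpha beta lam f)
    (hxi : white_noise L xi)
    (hw : mild_solution L lam f xi w) :
  exists C1 C2 : R, [/\ 0 < C1, 0 < C2 &
    forall (m : nat) (p : R * R) (q : 'I_m.+1 -> R * R),
      (`[0, T] `*` `[0, L]) p ->
      (forall j, (`[0, T] `*` `[0, L]) (q j)) ->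
      let M := Num.min
        (\big[Num.min/rho p (q ord0) ^+ 2]_(j < m.+1) (rho p (q j) ^+ 2))
        (Num.sqrt p.1) in
      let V := cond_var P (generated_sigma (fun j => w (q j))) (w p) in
      {ae P, forall o, C1 * M <= V o <= C2 * M}].
Proof.
have [_ Hlam _ _] := heig.
have [F [F1 [HF HO Hspan Hf]]] := eigensystem_extension hL heig.
have [C C0 HC] := kernel_bounds hL HF HO Hlam Hf hT.
have [c c0 Hc] := kernel_lower hL HF HO Hlam Hspan Hf hT.
exists c, (2 * C); split; [exact: c0|by rewrite mulr_gt0|].
move=> m p q pI qI M V.
have box r : (`[0, T] `*` `[0, L]) r -> 0 <= r.1 <= T /\ 0 <= r.2 <= L.
  by move=> [] /=; rewrite !in_itv.
have [p1 p2] := box _ pI.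
have hq j := box _ (qI j).
have W r : (`[0, T] `*` `[0, L]) r -> wiener L xi (kernel L lam f r) (w r).
  case: r => t x rI; have [/= /andP[t0 _] xI] := box _ rI.
  have mw : measurable_fun setT (w (t, x)) by [].
  move: t0; rewrite le_eqVlt => /predU1P[t0|t0].
    rewrite (_ : kernel L lam f (t, x) = fun=> 0).
      by apply: wiener0 => //; rewrite -t0; apply: hw.2; rewrite in_itv.
    apply/funext => z; rewrite /kernel patchE memNset//= -t0 => -[/=].
    by rewrite in_itv/= => /andP[a b]; have := lt_trans a b; rewrite ltxx.
  by apply: wiener_of_is => //; apply: hw.1 => //; rewrite in_itv.
have [a amin aeq] := cond_var_wiener hxi (W p pI) (fun j => W (q j) (qI j)).
apply: filterS aeq => o Vo; rewrite /V Vo.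
have M0 : 0 <= M by rewrite le_min sqrtr_ge0 andbT; apply: le_bigmin => *; exact: sqr_ge0.
have Mr j : M <= rho p (q j) ^+ 2.
  by rewrite /M ge_min; apply/orP; left; exact: bigmin_le_cond.
apply/andP; split.
  have [->|Mn] := eqVneq M 0; first by rewrite mulr0; exact: ip_ge0.
  have Mp : 0 < M by rewrite lt_def Mn.
  apply: Hc => //.
    have : M <= Num.sqrt p.1 by rewrite ge_min lexx orbT.
    case/andP: p1 => p10 _ H.
    by rewrite -(sqr_sqrtr p10) lerXn2r// nnegrE ?sqrtr_ge0.
  move=> j; have := Mr j; rewrite rho_sq le_max => /orP[H|H]; last by right.
  by left; rewrite -(sqr_sqrtr (normr_ge0 _)) lerXn2r// nnegrE ?sqrtr_ge0.
rewrite -ler_pdivrMl ?mulr_gt0// le_min; apply/andP; split.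
  have H j : (2 * C)^-1 * ip leb2 (spacetime L)
      (fun z => kernel L lam f p z - \sum_j a j * kernel L lam f (q j) z)
      (fun z => kernel L lam f p z - \sum_j a j * kernel L lam f (q j) z) <= rho p (q j) ^+ 2.
    rewrite ler_pdivrMl ?mulr_gt0//; apply: (le_trans (amin (fun i => (i == j)%:R))).
    under [X in ip _ _ X _]eq_fun => z.
      rewrite (bigD1 j)//= eqxx mul1r big1 ?addr0; last first.
        by move=> i /negbTE->; rewrite mul0r.
      over.
    under [X in ip _ _ _ X]eq_fun => z.
      rewrite (bigD1 j)//= eqxx mul1r big1 ?addr0; last first.
        by move=> i /negbTE->; rewrite mul0r.
      over.
    have [q1 q2] := hq j; have [_ _ H _] := HC p (q j) p1 p2 q1 q2.
    apply: (le_trans H); rewrite (mulrC 2) -mulrA ler_pM2l// rho_sq mulr_natl mulr2n.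
    by apply: lerD; rewrite le_max lexx ?orbT.
  by apply: le_bigmin => *; exact: H.
rewrite ler_pdivrMl ?mulr_gt0//; apply: (le_trans (amin (fun=> 0))).
under [X in ip _ _ X _]eq_fun do under eq_bigr do rewrite mul0r.
under [X in ip _ _ X _]eq_fun do rewrite big1_eq subr0.
under [X in ip _ _ _ X]eq_fun do under eq_bigr do rewrite mul0r.
under [X in ip _ _ _ X]eq_fun do rewrite big1_eq subr0.
have [_ H _ _] := HC p p p1 p2 p1 p2.
apply: (le_trans H); rewrite -mulrA ler_peMl// ?ler1n//.
by rewrite mulr_ge0 ?sqrtr_ge0// ltW.
Qed.
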